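(* Let $d,N\ge 1$ be integers and $p\ge 1$. Let $\mu^n$ ($n\in\mathbb{N}$) and $\mu$ be Borel probability measures on $(\mathbb{R}^d)^N$ such that: (i) $\mu^n\rightharpoonup\mu$ in duality with $C_b((\mathbb{R}^d)^N)$; (ii) for every $j=1,\dots,N$, $\mu^n_j\in\mathcal{P}^{1,p}(\mathbb{R}^d)$ for all $n$ and $\mu_j\in\mathcal{P}^{1,p}(\mathbb{R}^d)$, with $\lim_{n\to\infty} d^{1,p}(\mu^n_j,\mu_j)=0$. Then, for every $\varepsilon>0$, $$\lim_{n\to\infty} d^{1,p}\big(\Theta^\varepsilon[\mu^n],\Theta^\varepsilon[\mu]\big)=0.$$
   Context: $\mathcal{P}(\mathbb{R}^m)$ is the set of Borel probability measures on $\mathbb{R}^m$. For $p\ge1$, $\mathcal{P}^{1,p}(\mathbb{R}^m)$ is the set of $\mu\in\mathcal{P}(\mathbb{R}^m)$ that are absolutely continuous with respect to Lebesgue measure $\mathcal{L}^m$ and satisfy $(d\mu/d\mathcal{L}^m)^{1/p}\in W^{1,p}(\mathbb{R}^m)$. On it one uses the distance $d^{1,p}(\mu,\nu)=\|(d\mu/d\mathcal{L}^m)^{1/p}-(d\nu/d\mathcal{L}^m)^{1/p}\|_{W^{1,p}(\mathbb{R}^m)}$. The space $(\mathbb{R}^d)^N$ is identified with $\mathbb{R}^{dN}$. For $\mu\in\mathcal{P}((\mathbb{R}^d)^N)$, $\mu_j=\pi^j_\#\mu$ is its $j$-th marginal, where $\pi^j(x_1,\dots,x_N)=x_j$. $\mu^n_j$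 denotes the $j$-th marginal of $\mu^n$. Smoothing operator: for $\varepsilon>0$ let $\eta^\varepsilon(z)=(2\pi\varepsilon)^{-d/2}\exp(-|z|^2/(2\varepsilon))$ for $z\in\mathbb{R}^d$ (Euclidean norm). For $\mu\in\mathcal{P}((\mathbb{R}^d)^N)$ let $\Lambda^\varepsilon[\mu]$ be the probability measure with Lebesgue density $\Lambda^\varepsilon[\mu](Y)=\int\prod_{k=1}^N\eta^\varepsilon(y_k-x_k)\,d\mu(X)$, $Y=(y_1,\dots,y_N)$, $X=(x_1,\dots,x_N)$. Let $(\mu_k*\eta^\varepsilon)(y)=\int\eta^\varepsilon(y-x)\,d\mu_k(x)$. Then $\Theta^\varepsilon[\mu]\in\mathcal{P}((\mathbb{R}^d)^N)$ is defined by $$\int\psi\,d\Theta^\varepsilon[\mu]=\iint\psi(X)\prod_{k=1}^N\left(\frac{\eta^\varepsilon(y_k-x_k)}{(\mu_k*\eta^\varepsilon)(y_k)}\,d\mu_k(x_k)\right)d\Lambda^\varepsilon[\mu](Y)\quad\text{for all }\psi\in C_b((\mathbb{R}^d)^N).$$ (It is a fact that $\Theta^\varepsilon[\mu]\in\mathcal{P}^{1,p}((\mathbb{R}^d)^N)$ whenever all marginals $\mu_j$ belong to $\mathcal{P}^{1,p}(\mathbb{R}^d)$.) *)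

(* Defs.v *)
From HB Require Import structures.
From mathcomp Require Import all_boot all_order all_algebra.
From mathcomp Require Import all_classical all_reals all_analysis.
From mathcomp Require Import measurable_realfun.

Set Implicit Arguments.
Unset Strict Implicit.
Unset Printing Implicit Defensive.

Import Order.TTheory GRing.Theory Num.Theory.
Import numFieldNormedType.Exports.

Local Open Scope classical_set_scope.
Local Open Scope charge_scope.
Local Open Scope ring_scope.

(* (R^d)^N is 'M[R]_(N, d), a configuration X having the points row k X;
   R^d is 'rV[R]_d = 'M[R]_(1, d). Function spaces and Lebesgue measure are
   defined once for 'M[R]_(m, n), i.e. for R^(mn). The library norm on matrices
   is the sup norm: only the topology and the differentiability that it induces
   are used, Euclidean norms are written out. *)

Section borel_matrix.
Context {R : realType} {m n : nat}.
Local Notation M := 'M[R]_(m, n).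

HB.instance Definition _ := @isMeasurable.Build (sigma_display (@open M)) M
  <<s @open M >> (@sigma_algebra0 _ setT (@open M)) (@sigma_algebraC _ (@open M))
  (@sigma_algebra_bigcup _ setT (@open M)).

End borel_matrix.

Section measurable_matrix.
Context {R : realType} {m n : nat}.
Local Notation M := 'M[R]_(m, n).

Lemma measurable_fun_mx_open d (T : measurableType d) (f : T -> M) :
  (forall U : set M, open U -> measurable (f @^-1` U)) ->
  measurable_fun [set: T] f.
Proof.
move=> H; apply: (measurability (@open M)) => //.
by move=> _ [U oU <-]; rewrite setTI; exact: H.
Qed.

Lemma measurable_mx_coord i j : measurable_fun [set: M] (fun A : M => A i j).
Proof.
apply: (measurability _ (RGenOpens.measurableE R)).
move=> _ [_ [a [b ->] <-]]; rewrite setTI; apply: sub_sigma_algebra.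
apply: open_comp; last exact: interval_open.
by move=> A _; exact: coord_continuous.
Qed.

Lemma measurable_fun_mxP d (T : measurableType d) (f : T -> M) :
  (forall i j, measurable_fun [set: T] (fun x => f x i j)) ->
  measurable_fun [set: T] f.
Proof.
move=> mf; apply: measurable_fun_mx_open => U oU.
pose B (q : 'M[rat]_(m, n)) k : set M :=
  [set A | forall i j, `|(ratr (q i j) : R) - A i j| < k.+1%:R^-1].
have mB q k : measurable (f @^-1` B q k).
  rewrite [X in measurable X](_ : _ = \bigcap_(i in [set: 'I_m])
      \bigcap_(j in [set: 'I_n])
      ((fun x => f x i j) @^-1` ball (ratr (q i j) : R) k.+1%:R^-1)).
    apply: fin_bigcap_measurable => // i _; apply: fin_bigcap_measurable => // j _.
    by rewrite -[X in measurable X]setTI; apply: mf => //; exact: measurable_ball.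
  by apply/seteqP; split => [x Bx i _ j _|x Bx i j]; [exact: Bx|exact: (Bx i I j I)].
rewrite [X in measurable X](_ : _ = \bigcup_(qk in [set: 'M[rat]_(m, n) * nat])
   (f @^-1` (if `[< B qk.1 qk.2 `<=` U >] then B qk.1 qk.2 else set0))).
  apply: countable_bigcupT_measurable => [|[q k]]; first exact: countableP.
  by case: ifP => _; rewrite ?preimage_set0//; exact: mB.
apply/seteqP; split => [x /= Ux|x [[q k] _]] /=; last by case: asboolP => // + Bx; exact.
have /nbhs_ballP[e /= e0 eU] : nbhs (f x) U by exact: open_nbhs_nbhs.
have [k ke] : exists k : nat, k.+1%:R^-1 + k.+1%:R^-1 < e.
  have [k] := @ltr_add_invr R _ _ (divr_gt0 e0 (ltr0n R 2)).
  rewrite add0r => ke; exists k.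
  by rewrite [ltRHS]splitr ltrD.
have qP i j : exists q : rat, `|(ratr q : R) - f x i j| < k.+1%:R^-1.
  have B0 : ball (f x i j) k.+1%:R^-1 !=set0.
    by exists (f x i j); apply: ballxx; rewrite invr_gt0.
  have oB : open (ball (f x i j) k.+1%:R^-1 : set R).
    by apply: ball_open; rewrite invr_gt0.
  have [y [/= yB [q _ qy]]] := @dense_rat R _ B0 oB.
  by exists q; rewrite qy distrC.
exists (\matrix_(i, j) sval (cid (qP i j)), k) => //=.
case: asboolP => [_ i j|]; first by rewrite mxE; case: cid.
case=> A BA; apply: eU; split => // i j.
have := BA i j; rewrite mxE; case: cid => /= q qk qA.
suff: `|f x i j - A i j| < e by [].
rewrite -(subrKA (ratr q)) (le_lt_trans (ler_normD _ _))// (lt_trans _ ke)//.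
by rewrite ltrD// distrC.
Qed.

End measurable_matrix.

Section measurable_rows.
Context {R : realType} {m n : nat}.
Local Notation M := 'M[R]_(m, n).

Lemma measurable_row (k : 'I_m) :
  measurable_fun [set: M] (row k : M -> 'rV[R]_n).
Proof.
apply: measurable_fun_mxP => i j.
by under eq_fun do rewrite mxE; exact: measurable_mx_coord.
Qed.

HB.instance Definition _ (k : 'I_m) :=
  isMeasurableFun.Build _ _ M 'rV[R]_n (row k) (measurable_row k).

Definition mx_of_rows (t : m.-tuple 'rV[R]_n) : M :=
  \matrix_(k, j) tnth t k 0 j.

Lemma measurable_mx_of_rows : measurable_fun [set: m.-tuple 'rV[R]_n] mx_of_rows.
Proof.
apply: measurable_fun_mxP => i j; under eq_fun do rewrite mxE.
apply: (@measurableT_comp _ _ _ _ _ _ (fun v : 'rV[R]_n => v 0 j)) => /=.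
  exact: measurable_mx_coord.
exact: measurable_tnth.
Qed.

HB.instance Definition _ :=
  isMeasurableFun.Build _ _ _ M mx_of_rows measurable_mx_of_rows.

Definition mx_of_entries (t : (m * n).-tuple (measurableTypeR R)) : M :=
  \matrix_(i, j) tnth t (mxvec_index i j).

Lemma measurable_mx_of_entries :
  measurable_fun [set: (m * n).-tuple (measurableTypeR R)] mx_of_entries.
Proof.
apply: measurable_fun_mxP => i j; under eq_fun do rewrite mxE.
exact: measurable_tnth.
Qed.

HB.instance Definition _ :=
  isMeasurableFun.Build _ _ _ M mx_of_entries measurable_mx_of_entries.

Lemma measurable_entries_of_mx : measurable_fun [set: M]
  (fun A : M => [tuple mxvec A 0 i | i < m * n]
     : (m * n).-tuple (measurableTypeR R)).
Proof.
apply/measurable_fun_tnthP => k; rewrite /comp.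
under eq_fun do rewrite tnth_mktuple.
case/mxvec_indexP: k => i j; under eq_fun do rewrite mxvecE.
exact: measurable_mx_coord.
Qed.

Lemma mx_of_entriesK :
  cancel mx_of_entries (fun A : M => [tuple mxvec A 0 i | i < m * n]).
Proof.
move=> t; apply: eq_from_tnth => k; rewrite tnth_mktuple.
by case/mxvec_indexP: k => i j; rewrite mxvecE mxE.
Qed.

End measurable_rows.

(* The image of a measure by a measurable function: [distribution] without the
   restriction to probability measures. *)
Section image_measure.
Context d1 d2 (T1 : measurableType d1) (T2 : measurableType d2) (R : realType).

Definition image_measure (mu : {measure set T1 -> \bar R})
  (f : {mfun T1 >-> T2}) := pushforward mu f.

Section instance.
Variables (mu : {measure set T1 -> \bar R}) (f : {mfun T1 >-> T2}).
Local Notation nu := (image_measure mu f).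

Let nu0 : nu set0 = 0%E. Proof. exact: measure0. Qed.

Let nu_ge0 A : (0 <= nu A)%E. Proof. exact: measure_ge0. Qed.

Let nu_sigma_additive : semi_sigma_additive nu.
Proof. exact: measure_semi_sigma_additive. Qed.

HB.instance Definition _ :=
  isMeasure.Build _ _ _ nu nu0 nu_ge0 nu_sigma_additive.

End instance.

Lemma sigma_finite_image_measure (mu : {measure set T1 -> \bar R})
    (f : {mfun T1 >-> T2}) (g : T2 -> T1) :
  sigma_finite [set: T1] mu -> measurable_fun [set: T2] g -> cancel f g ->
  sigma_finite [set: T2] (image_measure mu f).
Proof.
move=> [F FT Foo] mg fK.
exists (fun i => g @^-1` F i) => [|i].
  by rewrite -preimage_bigcup -FT preimage_setT.
have [mF Fi] := Foo i.
split; first by rewrite -[X in measurable X]setTI; exact: mg.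
rewrite /image_measure /pushforward (_ : f @^-1` _ = F i)//.
by apply/seteqP; split => x /=; rewrite fK.
Qed.

End image_measure.

Section tuple_product.
Context {d} {T : measurableType d} {R : realType}.

Definition cons_pair n (x : T * n.-tuple T) : n.+1.-tuple T :=
  [the n.+1.-tuple T of x.1 :: x.2].

Lemma measurable_cons_pair n : measurable_fun [set: _] (@cons_pair n).
Proof. exact: measurable_cons. Qed.

HB.instance Definition _ n :=
  isMeasurableFun.Build _ _ _ _ (@cons_pair n) (@measurable_cons_pair n).

Section product_cons.
Context n (m1 : {sigma_finite_measure set T -> \bar R})
  (m2 : {sigma_finite_measure set (n.-tuple T) -> \bar R}).

Definition product_cons := image_measure (m1 \x m2)%E (@cons_pair n).

HB.instance Definition _ := Measure.on product_cons.

Let product_cons_sigma_finite : sigma_finite setT product_cons.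
Proof.
apply: (@sigma_finite_image_measure _ _ (T * n.-tuple T)%type _ _ _ _
  (fun t => (thead t, [tuple of behead t]))).
- have /sigma_finiteP[F [TF ndF Foo]] := sigma_finiteT m1.
  have /sigma_finiteP[G [TG ndG Goo]] := sigma_finiteT m2.
  exists (fun k => F k `*` G k) => [|k].
    rewrite -setXTT TF TG predeqE => -[x y]; split.
      move=> [/= [i _ Fx] [j _ Gy]]; exists (maxn i j) => //; split.
      - by move: x Fx; exact/subsetPset/ndF/leq_maxl.
      - by move: y Gy; exact/subsetPset/ndG/leq_maxr.
    by move=> [i _ []/= ? ?]; split; exists i.
  have [? ?] := Foo k; have [? ?] := Goo k.
  split; first exact: measurableX.
  by rewrite [ltLHS]product_measure1E// lte_mul_pinfty// ge0_fin_numE.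
- by apply/measurable_fun_pair => /=;
    [exact: measurable_tnth|exact: measurable_behead].
- by case=> x t; congr pair; apply: val_inj.
Qed.

HB.instance Definition _ :=
  Measure_isSigmaFinite.Build _ _ _ product_cons product_cons_sigma_finite.

End product_cons.

Fixpoint tuple_product n : ('I_n -> {sigma_finite_measure set T -> \bar R}) ->
    {sigma_finite_measure set (n.-tuple T) -> \bar R} :=
  match n with
  | 0 => fun _ => \d_([tuple] : 0.-tuple T)
  | n'.+1 => fun m =>
      product_cons (m ord0) (tuple_product (fun i => m (lift ord0 i)))
  end.

End tuple_product.

Section lebesgue_mx.
Context (R : realType) (m n : nat).

Definition lebesgue_mx := image_measure
  (tuple_product (fun _ : 'I_(m * n) => @lebesgue_measure R))
  (@mx_of_entries R m n).

HB.instance Definition _ := Measure.on lebesgue_mx.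

Let lebesgue_mx_sigma_finite : sigma_finite setT lebesgue_mx.
Proof.
exact: (sigma_finite_image_measure (sigma_finiteT _)
  measurable_entries_of_mx (@mx_of_entriesK R m n)).
Qed.

HB.instance Definition _ :=
  Measure_isSigmaFinite.Build _ _ _ lebesgue_mx lebesgue_mx_sigma_finite.

End lebesgue_mx.

Section sobolev.
Context {R : realType} {m n : nat}.
Local Notation M := 'M[R]_(m, n).
Local Notation leb := (@lebesgue_mx R m n).
Implicit Types (f g phi : M -> R) (p : R).

Definition partial (ij : 'I_m * 'I_n) f : M -> R :=
  fun x => 'D_(delta_mx ij.1 ij.2) f x.

(* s = [::] gives the differentiability of phi itself. Differentiability at
   every order makes all the iterated partial derivatives continuous. *)
Definition smooth phi :=
  forall (s : seq ('I_m * 'I_n)) x, differentiable (foldr partial phi s) x.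

Definition test_function phi :=
  smooth phi /\ compact (closure [set x | phi x != 0]).

Definition weak_partial ij f g := forall phi, test_function phi ->
  (\int[leb]_x (f x * partial ij phi x)%:E =
   - \int[leb]_x (g x * phi x)%:E)%E.

Definition sobolev1 p f :=
  f \in Lfun leb p%:E /\
  forall ij, exists2 g, g \in Lfun leb p%:E & weak_partial ij f g.

(* The weak partial derivative of f, chosen up to a null set; meaningful for
   f in W^{1,p}. *)
Definition weak_derivative p ij f : M -> R :=
  get [set g | g \in Lfun leb p%:E /\ weak_partial ij f g].

Definition weak_gradient_norm p f : M -> R :=
  fun x => Num.sqrt (\sum_ij weak_derivative p ij f x ^+ 2).

(* (||f||_p^p + || |grad f| ||_p^p)^(1/p), with |grad f| Euclidean. *)
Definition sobolev1_norm p f : \bar R :=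
  (('N[leb]_p%:E[EFin \o f] `^ p +
    'N[leb]_p%:E[EFin \o weak_gradient_norm p f] `^ p) `^ p^-1)%E.

Implicit Types mu nu : probability M R.

(* The Radon-Nikodym derivative is real-valued and almost everywhere
   nonnegative. *)
Definition density mu : M -> R :=
  fun x => fine ('d (charge_of_finite_measure mu) '/d leb x).

Definition root_density p mu : M -> R := fun x => density mu x `^ p^-1.

Definition P1p p mu := mu `<< leb /\ sobolev1 p (root_density p mu).

(* The distance on P^{1,p}, extended by +oo: a sequence can be at distance
   tending to 0 from mu only if mu and eventually its terms are in P^{1,p}. *)
Definition d1p p mu nu : \bar R :=
  if `[< P1p p mu /\ P1p p nu >]
  then sobolev1_norm p (root_density p mu \- root_density p nu)
  else +oo%E.

Definition Cb (psi : M -> R) :=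
  continuous psi /\ exists C, forall x, `|psi x| <= C.

Definition weak_cvg (mu_ : nat -> probability M R) mu := forall psi, Cb psi ->
  (\int[mu_ k]_x (psi x)%:E)%E @[k --> \oo] --> (\int[mu]_x (psi x)%:E)%E.

End sobolev.

Section theta.
Context {R : realType} {N d : nat}.
Local Notation X := 'M[R]_(N, d).
Implicit Types (mu nu : probability X R) (eps : R) (x y z : X).

Definition marginal (j : 'I_N) mu : probability 'rV[R]_d R :=
  distribution mu (row j).

Definition eta eps (v : 'rV[R]_d) : R :=
  (2 * pi * eps) `^ (- (d%:R / 2)) *
  expR (- (\sum_i v 0 i ^+ 2) / (2 * eps)).

Lemma eta_ge0 eps v : 0 <= eta eps v.
Proof. by rewrite mulr_ge0// ?powR_ge0// expR_ge0. Qed.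

Definition smoothing_kernel eps y x : R := \prod_k eta eps (row k y - row k x).

Lemma smoothing_kernel_ge0 eps y x : 0 <= smoothing_kernel eps y x.
Proof. by apply: prodr_ge0 => k _; exact: eta_ge0. Qed.

Lemma measurable_eta eps : measurable_fun [set: 'rV[R]_d] (eta eps).
Proof.
apply: measurable_funM => //; apply: measurableT_comp => //.
apply: measurable_funM => //; apply: measurableT_comp => //.
rewrite /index_enum; elim: (Finite.enum _) => [|i s ih].
  by under eq_fun do rewrite big_nil; exact: measurable_cst.
under eq_fun do rewrite big_cons; apply: measurable_funD => //.
by apply: measurable_funX; exact: (measurable_mx_coord 0 i).
Qed.

Lemma measurable_smoothing_kernel eps :
  measurable_fun [set: X * X] (fun yx => smoothing_kernel eps yx.1 yx.2).
Proof.
rewrite /smoothing_kernel /index_enum; elim: (Finite.enum _) => [|k s ih].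
  by under eq_fun do rewrite big_nil; exact: measurable_cst.
under eq_fun do rewrite big_cons; apply: measurable_funM => //.
apply: measurableT_comp; first exact: measurable_eta.
apply: measurable_fun_mxP => i j; under eq_fun do rewrite !mxE.
apply: measurable_funB.
- exact: (measurableT_comp (measurable_mx_coord k j) measurable_fst).
- exact: (measurableT_comp (measurable_mx_coord k j) measurable_snd).
Qed.

Definition Lambda_density eps mu y : \bar R :=
  (\int[mu]_x (smoothing_kernel eps y x)%:E)%E.

Lemma Lambda_density_ge0 eps mu y : (0 <= Lambda_density eps mu y)%E.
Proof. by apply: integral_ge0 => x _; rewrite lee_fin smoothing_kernel_ge0. Qed.

Lemma measurable_Lambda_density eps mu :
  measurable_fun [set: X] (Lambda_density eps mu).
Proof.
apply: (measurable_fun_fubini_tonelli_F (m2 := mu)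
  (fun yx : X * X => (smoothing_kernel eps yx.1 yx.2)%:E)).
- by apply/measurable_EFinP; exact: measurable_smoothing_kernel.
- by move=> yx; rewrite lee_fin smoothing_kernel_ge0.
Qed.

Definition Lambda eps mu : set X -> \bar R :=
  fun A => (\int[@lebesgue_mx R N d]_(y in A) Lambda_density eps mu y)%E.

Section Lambda_measure.
Context (eps : R) (mu : probability X R).

Let Lambda0 : Lambda eps mu set0 = 0%E.
Proof. exact: integral_set0. Qed.

Let Lambda_ge0 A : (0 <= Lambda eps mu A)%E.
Proof. by apply: integral_ge0 => y _; exact: Lambda_density_ge0. Qed.

Let Lambda_sigma_additive : semi_sigma_additive (Lambda eps mu).
Proof.
apply: semi_sigma_additive_nng_induced; first exact: measurable_Lambda_density.
exact: Lambda_density_ge0.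
Qed.

HB.instance Definition _ := isMeasure.Build _ _ _ (Lambda eps mu)
  Lambda0 Lambda_ge0 Lambda_sigma_additive.

End Lambda_measure.

Definition product_rows (nu : 'I_N -> probability 'rV[R]_d R) :
    {measure set X -> \bar R} :=
  image_measure (tuple_product nu) (@mx_of_rows R N d).

Definition convolution eps (nu : probability 'rV[R]_d R) (v : 'rV[R]_d) : R :=
  \int[nu]_w eta eps (v - w).

Definition is_Theta eps mu nu := forall psi, Cb psi ->
  (\int[nu]_x (psi x)%:E =
   \int[Lambda eps mu]_y \int[product_rows (marginal ^~ mu)]_x
     (psi x * \prod_k (eta eps (row k y - row k x) /
                       convolution eps (marginal k mu) (row k y)))%:E)%E.

(* For eps > 0 there is exactly one such measure: duality with C_b determines
   it, and the inner kernel in [is_Theta] has total mass 1 for every y. *)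
Definition Theta eps mu : probability X R := get (is_Theta eps mu).

End theta.

(* Main.v *)
Require Import Defs.
From HB Require Import structures.
From mathcomp Require Import all_boot all_order all_algebra.
From mathcomp Require Import all_classical all_reals all_analysis.
From mathcomp Require Import measurable_realfun ring lra.

Set Implicit Arguments.
Unset Strict Implicit.
Unset Printing Implicit Defensive.

Import Order.TTheory GRing.Theory Num.Theory.
Import numFieldNormedType.Exports.

Local Open Scope classical_set_scope.
Local Open Scope ring_scope.

(** Let mu_1, ..., mu_N be the marginals of mu, r_j the density of mu_j and
    u_j = r_j^(1/p).

    Shape of Theta. Integrating out the smoothing variable y shows that
    Theta^eps[mu] has the density H(x) r_1(x_1) ... r_N(x_N), where H(x) is the
    integral over y of Lambda^eps[mu](y) prod_k eta(y_k - x_k) / (mu_k * eta)(y_k)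
    ([Hfun], [Theta_density]). Its p-th root is W = h u_1 ... u_N with
    h = H^(1/p), and the product rule gives the weak derivatives
    V_ki = h (d_i u_k) prod_(j <> k) u_j + (d_ki h) prod_j u_j
    ([weak_partial_Wfun]); the factors u_j being only Sobolev, the rule is
    obtained by freezing all rows but the k-th and using Fubini.

    The factor H. It is a Gaussian times the Laplace transform of a positive
    weight. Comparing Lambda^eps[mu](y) with each of the (mu_k * eta)(y_k), and
    bounding the latter from below by a slightly narrower Gaussian, shows that
    the weight decays like a Gaussian, with constants that depend on mu only
    through a lower bound of some Gaussian masses of its marginals
    ([tweight_gaussbound]). Hence H is smooth and positive, and weak convergence
    of mu^n gives H^n -> H and DH^n -> DH pointwise by dominated convergence
    ([cvg_Hfun], [cvg_derive_Hfun]).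

    Control of the norms. First, the mass formula [theta_mass]: in the density of
    Theta^eps[mu] the factor r_k may be replaced by any g >= 0, and the integral
    is that of g; this remains true if H is translated in the row k. It gives the
    integral of |h g prod_(j <> k) u_j|^p, which is that of |g|^p. Secondly, by
    convexity of the exponential, H(x) exp(D_v H(x) / H(x)) <= C H(x + v)
    ([Hfun_tilt]), so |d_ki h|^p <= C (H(x + e_ki) + H(x - e_ki)), and the mass
    formula applies again. In all, |V_ki|^p is at most an explicit function
    ([Vdom]) whose integral is 2^p (int |d_i u_k|^p + C').

    Passage to the limit. These integrals converge because d_i u_k^n -> d_i u_k in
    L^p, so dominated convergence with converging bounds ([pratt]) gives
    W^n -> W and V_ki^n -> V_ki in L^p once the functions converge almost
    everywhere. They do along subsequences for which the L^p distances are
    summable, and it suffices to find such a subsequence in every subsequence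
    ([cvg0_subseq]).

    Theta and the weak derivatives are given as arbitrary objects satisfying a
    specification, so uniqueness is needed as well: bounded continuous functions
    determine a measure ([Cb_determines]) and weak derivatives are unique up to
    null sets ([weak_partial_unique]). Both follow by approximating the
    indicator function of an open box by smooth bumps. *)

(** * Open boxes determine measures *)

Section boxes.
Context {R : realType} {m n : nat}.
Local Notation M := 'M[R]_(m, n).

Definition obox (a b : M) : set M := [set x | forall i j, a i j < x i j < b i j].

Lemma open_obox a b : open (obox a b).
Proof.
rewrite openE => x abx; rewrite /interior.
change (nbhs x (fun y : M => forall i j, a i j < y i j < b i j)).
apply: (@filter_forall _ _ (fun i (y : M) => forall j, a i j < y i j < b i j) (nbhs x)) => i.
apply: (@filter_forall _ _ (fun j (y : M) => a i j < y i j < b i j) (nbhs x)) => j.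
apply: (@coord_continuous R m n i j x [set t | a i j < t < b i j]).
apply: open_nbhs_nbhs; split; last exact: (abx i j).
have -> : [set t | a i j < t < b i j] = [set` `]a i j, b i j[].
  by apply/seteqP; split => t /=; rewrite in_itv.
exact: interval_open.
Qed.

Lemma measurable_obox a b : measurable (obox a b).
Proof. by apply: sub_sigma_algebra; exact: open_obox. Qed.

Lemma setI_closed_obox : setI_closed [set obox ab.1 ab.2 | ab in [set: M * M]].
Proof.
move=> _ _ [[a b] _ <-] [[c e] _ <-]; exists (\matrix_(i, j) Num.max (a i j) (c i j),
  \matrix_(i, j) Num.min (b i j) (e i j)) => //=.
apply/seteqP; split => [x h|x [h1 h2] i j].
  split=> i j; have := h i j; rewrite !mxE gt_max lt_min;
  by move=> /andP[/andP[h1 h2] /andP[h3 h4]]; rewrite ?h1 ?h2 ?h3 ?h4.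
rewrite !mxE gt_max lt_min.
by have /andP[-> ->] := h1 i j; have /andP[-> ->] := h2 i j.
Qed.

Lemma obox_cover : \bigcup_k obox (const_mx (- k.+1%:R)) (const_mx k.+1%:R) = [set: M].
Proof.
apply/seteqP; split => // x _.
exists (Num.truncn (\sum_i \sum_j `|x i j|)) => // i j.
rewrite !mxE -ltr_norml (le_lt_trans _ (truncnS_gt _))//.
rewrite (bigD1 i)//= (bigD1 j)//= -addrA lerDl addr_ge0// ?sumr_ge0// => k _.
by rewrite sumr_ge0.
Qed.

(** An open set of matrices is a preimage under the identity, which is measurable
for the sigma-algebra of the boxes since its entries are: a strip a < x i j < b
is a countable union of boxes. *)
Lemma measurable_obox_generated :
  @measurable _ M = <<s [set obox ab.1 ab.2 | ab in [set: M * M]] >>.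
Proof.
set G := [set _ | _ in _].
apply/seteqP; split; last first.
  apply: smallest_sub; first exact: sigma_algebra_measurable.
  by move=> _ [[a b] _ <-]; exact: measurable_obox.
apply: smallest_sub; first exact: smallest_sigma_algebra.
move=> U oU.
suff mid : measurable_fun [set: g_sigma_algebraType G] (idfun : g_sigma_algebraType G -> M).
  have mU : @measurable _ M U by exact: sub_sigma_algebra.
  have := mid measurableT U mU.
  by rewrite setTI preimage_id.
apply: measurable_fun_mxP => i j.
apply: (measurability _ (RGenOpens.measurableE R)).
move=> _ [_ [a [b ->] <-]]; rewrite setTI.
have -> : (fun x : M => idfun x i j) @^-1` [set` `]a, b[] =
  \bigcup_k obox (\matrix_(i', j') if (i' == i) && (j' == j) then a else - k.+1%:R)
    (\matrix_(i', j') if (i' == i) && (j' == j) then b else k.+1%:R).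
  apply/seteqP; split => [x|x [k _]] /=.
    rewrite in_itv/= => abx.
    have : [set: M] x by []; rewrite -obox_cover => -[k _ xk].
    exists k => // i' j'; rewrite !mxE; case: ifPn => [/andP[/eqP -> /eqP ->]//|_].
    by have := xk i' j'; rewrite !mxE.
  by move=> /(_ i j); rewrite !mxE !eqxx in_itv.
apply: bigcupT_measurable => k.
by apply: sub_sigma_algebra; eexists (_, _).
Qed.

(** Boxes are stable under intersection and countably many of them cover the space,
so the monotone class theorem applies. *)
Lemma obox_measure_unique (m1 m2 : {measure set M -> \bar R}) :
  (forall a b, m1 (obox a b) = m2 (obox a b)) ->
  (forall a b, (m1 (obox a b) < +oo)%E) ->
  forall A, measurable A -> m1 A = m2 A.
Proof.
move=> m12 moo; apply: (@measure_unique _ R M [set obox ab.1 ab.2 | ab in [set: M * M]]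
  (fun k => obox (const_mx (- k.+1%:R)) (const_mx k.+1%:R))) => //.
- exact: measurable_obox_generated.
- exact: setI_closed_obox.
- by move=> k; eexists (_, _).
- exact: obox_cover.
- by move=> _ [ab _ <-].
Qed.

End boxes.

Section tuple_product_box.
Context d (T : measurableType d) (R : realType).

Lemma measurable_tuple_box k (A : 'I_k -> set T) :
  (forall i, measurable (A i)) -> measurable [set t : k.-tuple T | forall i, A i (tnth t i)].
Proof.
move=> mA.
have -> : [set t : k.-tuple T | forall i, A i (tnth t i)] =
    \bigcap_(i in [set: 'I_k]) ((fun t => tnth t i) @^-1` A i).
  by apply/seteqP; split => [t h i _|t h i]; [exact: h|exact: (h i)].
apply: fin_bigcap_measurable => // i _.
by rewrite -[X in measurable X]setTI; exact: measurable_tnth.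
Qed.

Lemma tuple_product_box k (mu : 'I_k -> {sigma_finite_measure set T -> \bar R})
    (A : 'I_k -> set T) :
  (forall i, measurable (A i)) ->
  tuple_product mu [set t : k.-tuple T | forall i, A i (tnth t i)] =
  (\prod_i mu i (A i))%E.
Proof.
elim: k mu A => [|k ih] mu A mA /=.
  rewrite big_ord0 diracE mem_set//=.
  by case.
rewrite big_ord_recl -ih// -product_measure1E//; last first.
  by apply: (measurable_tuple_box (A := fun i => A (lift ord0 i))) => i.
rewrite /product_cons /image_measure /pushforward; congr product_measure1.
apply/seteqP; split => [[x t] /= h|[x t] /= [h0 h] i].
  by split=> [|i]; [have := h ord0|have := h (lift ord0 i); rewrite (tnthS _ t)].
by case: (unliftP ord0 i) => [j ->|->//]; rewrite (tnthS _ t).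
Qed.

End tuple_product_box.

Section lebesgue_box.
Context (R : realType) (m n : nat).
Local Notation M := 'M[R]_(m, n).

Lemma lebesgue_mx_obox (a b : M) : @lebesgue_mx R m n (obox a b) =
  (\prod_i \prod_j Num.max 0 (b i j - a i j))%:E.
Proof.
rewrite /lebesgue_mx /image_measure /pushforward.
rewrite (_ : mx_of_entries @^-1` obox a b = [set t | forall k,
   [set` `](mxvec a 0 k), (mxvec b 0 k)[] (tnth t k)]); last first.
  apply/seteqP; split => [t /= h k|t /= h i j].
    by case/mxvec_indexP: k => i j; rewrite in_itv/= !mxvecE; have := h i j; rewrite mxE.
  by have := h (mxvec_index i j); rewrite in_itv/= !mxvecE mxE.
etransitivity.
  by apply: (@tuple_product_box _ (measurableTypeR R) R _ (fun=> lebesgue_measure)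
    (fun k => [set` `](mxvec a 0 k), (mxvec b 0 k)[])).
rewrite pair_bigA -prodEFin (reindex (fun ij : 'I_m * 'I_n => mxvec_index ij.1 ij.2))/=; last first.
  have [g c1 c2] := @curry_mxvec_bij m n.
  by exists g => [[i j] /= h|k h]; [exact: (c1 (i, j))|rewrite -[RHS]c2//; case: (g k)].
apply: eq_bigr => -[i j] _ /=; rewrite !mxvecE lebesgue_measure_itv/= lte_fin.
case: ltP => h; first by rewrite -EFinB max_r// subr_ge0 ltW.
by rewrite max_l// subr_le0.
Qed.

Lemma lebesgue_mx_obox_lty (a b : M) : (@lebesgue_mx R m n (obox a b) < +oo)%E.
Proof. by rewrite lebesgue_mx_obox ltry. Qed.

End lebesgue_box.

(** * Smooth functions and bumps *)

Section matrix_topology_facts.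
Context {R : realType} {m n : nat}.
Local Notation M := 'M[R]_(m, n).

Lemma cvg_mxP (T : Type) (F : set_system T) {FF : Filter F} (f : T -> M) (l : M) :
  (forall i j, f x i j @[x --> F] --> l i j) -> f x @[x --> F] --> l.
Proof.
move=> fl; apply/cvg_ballP => e e0.
suff : F (fun x => forall i j, ball (l i j) e (f x i j)).
  by apply: filterS => x h; split.
apply: (@filter_forall _ _ (fun i x => forall j, ball (l i j) e (f x i j)) F) => i.
apply: (@filter_forall _ _ (fun j x => ball (l i j) e (f x i j)) F) => j.
by have /cvg_ballP := fl i j; exact.
Qed.

(** A closed box is the image of a product of segments by [vec_mx]. *)
Lemma compact_cbox (a b : M) : compact [set x : M | forall i j, a i j <= x i j <= b i j].
Proof.
have -> : [set x : M | forall i j, a i j <= x i j <= b i j] =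
    vec_mx @` [set v : 'rV[R]_(m * n) | forall k, `[mxvec a 0 k, mxvec b 0 k]%classic (v 0 k)].
  apply/seteqP; split => [x h|_ [v h <-] i j] /=.
    exists (mxvec x); last by rewrite mxvecK.
    by move=> k; case/mxvec_indexP: k => i j; rewrite in_itv/= !mxvecE; exact: h.
  by move: (h (mxvec_index i j)); rewrite /= in_itv/= !mxvecE mxE.
apply: continuous_compact.
  apply: continuous_subspaceT => v.
  apply: (@cvg_mxP _ (nbhs v) (nbhs_filter v) vec_mx) => i j.
  rewrite mxE; apply: cvg_trans; last exact: (@coord_continuous R 1 (m * n) 0 (mxvec_index i j) v).
  by under eq_fun do rewrite mxE.
apply: (@rV_compact R _ (fun k => `[mxvec a 0 k, mxvec b 0 k]%classic)) => k.
exact: segment_compact.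
Qed.

Lemma compact_closure_sub (A B : set M) :
  A `<=` B -> compact B -> compact (closure A).
Proof.
have hT : hausdorff_space M by exact: (@norm_hausdorff _ M).
move=> AB cB; apply: (subclosed_compact _ cB); first exact: closed_closure.
apply: (subset_trans (closure_subset AB)).
have /closure_id <- // : closed B by exact: compact_closed.
Qed.

End matrix_topology_facts.

Section bump1.
Context {R : realType}.
Implicit Types (s : R) (k : nat).

(** For k = 0 this is the standard smooth function that vanishes on the negative
half-line; the powers of 1/s make the family stable under derivation. *)
Definition expinv k s : R := if 0 < s then s ^- k * expR (- s^-1) else 0.

(** The quadratic bound at 0, which makes the derivative at 0 vanish: exp(1/s)
dominates (1/s)^(k+2). *)
Lemma expinv_le k s : 0 < s -> expinv k s <= (k.+2%:R ^+ k.+2) * s ^+ 2.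
Proof.
move=> s0; rewrite /expinv s0.
have h : (s^-1 / k.+2%:R) ^+ k.+2 <= expR (s^-1).
  rewrite [in leRHS](_ : s^-1 = k.+2%:R * (s^-1 / k.+2%:R)); last first.
    by rewrite mulrC divfK.
  rewrite expRM_natl.
  apply: lerXn2r; rewrite ?nnegrE ?expR_ge0 ?divr_ge0 ?invr_ge0 ?(ltW s0)//.
  by rewrite (le_trans _ (expR_ge1Dx _))// lerDr.
rewrite expRN ler_pdivrMr ?expR_gt0//.
have -> : s ^- k = k.+2%:R ^+ k.+2 * s ^+ 2 * (s^-1 / k.+2%:R) ^+ k.+2.
  have s1 : s != 0 by rewrite gt_eqF.
  have : (k.+2%:R : R) != 0 by [].
  move: (k.+2%:R : R) => c c0.
  by rewrite exprMn !exprVn -addn2 !exprD; field; rewrite s1 c0 !expf_neq0.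
by rewrite ler_wpM2l// mulr_ge0// ?exprn_ge0// ltW.
Qed.

Lemma expinv_ge0 k s : 0 <= expinv k s.
Proof.
by rewrite /expinv; case: ltP => // s0; rewrite mulr_ge0 ?expR_ge0// invr_ge0 exprn_ge0// ltW.
Qed.

Lemma expinv_le0 k s : s <= 0 -> expinv k s = 0.
Proof. by move=> s0; rewrite /expinv ltNge s0. Qed.

Lemma is_derive_expinv k s :
  is_derive s 1 (expinv k) (expinv k.+2 s - k%:R * expinv k.+1 s).
Proof.
have [s0|s0|s0] := ltgtP s 0.
- apply: (@near_eq_is_derive _ _ _ (cst 0)).
    near=> t; rewrite /expinv ltNge (_ : t <= 0)//.
    by apply: ltW; near: t; exact: lt_nbhsl.
  by rewrite {1 2}/expinv !ltNge !ltW//= mulr0 subr0; exact: is_derive_cst.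
- apply: (@near_eq_is_derive _ _ _ (fun t : R^o => (t ^- k * expR (- t^-1) : R^o))).
    near=> t; rewrite /expinv (_ : 0 < t)//.
    by near: t; apply: lt_nbhsr.
  have sn : s != 0 by rewrite gt_eqF.
  have d1 : is_derive s 1 (fun t : R => t ^- k) (- k%:R * s ^- k.+1).
    have sk : s ^+ k != 0 by rewrite expf_neq0.
    have dk := @exprn_derivable _ k s 1.
    apply: DeriveDef; first exact: (@derivableV _ _ (@GRing.exp R ^~ k) s 1 sk dk).
    rewrite (@deriveV _ _ (@GRing.exp R ^~ k) s 1 sk dk) exp_derive /GRing.scale/= mulr1.
    case: k sk dk => [|k] sk dk; first by rewrite !mulr0n mul0r mulr0 oppr0 mul0r.
    by rewrite /= -mulr_natl !exprS; field; rewrite sn expf_neq0.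
  have d2 : is_derive s 1 (fun t : R => expR (- t^-1)) (s ^- 2 * expR (- s^-1)).
    have dV : is_derive s 1 (fun t : R => - t^-1) (s ^- 2).
      have dV0 := @derivableV R _ (@id R) s 1 sn (@derivable_id R R s 1).
      apply: DeriveDef; first exact: (derivableN dV0).
      rewrite (deriveN dV0) (@deriveV _ _ id s 1 sn (@derivable_id R R s 1)).
      by rewrite derive_id /GRing.scale/= mulr1 opprK.
    have := @is_derive1_comp R expR (fun t => - t^-1) s _ _ (is_derive_expR _) dV.
    by rewrite mulrC => h; exact: h.
  have h := is_deriveM d1 d2.
  suff -> : expinv k.+2 s - k%:R * expinv k.+1 s =
    s ^- k *: (s ^- 2 * expR (- s^-1)) + expR (- s^-1) *: (- k%:R * s ^- k.+1).
    exact: h.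
  rewrite /expinv s0 /GRing.scale/= !exprS; field.
  by rewrite sn expf_neq0.
- rewrite s0 /expinv ltxx mulr0 subr0.
  have cv : h^-1 *: ((expinv k \o shift 0) (h *: 1) - expinv k 0) @[h --> 0^'] --> (0 : R).
    apply/cvgrPdist_lt => e e0; near=> h.
    rewrite sub0r normrN /= addr0 {2}/expinv ltxx subr0 /GRing.scale/= mulr1.
    have [h0|h0] := ltP 0 h; last first.
      by rewrite (@expinv_le0 k h h0) mulr0 normr0.
    rewrite ger0_norm ?mulr_ge0 ?expinv_ge0 ?invr_ge0 ?ltW//.
    rewrite mulrC ltr_pdivrMr//.
    apply: (le_lt_trans (expinv_le k h0)); rewrite expr2 mulrA ltr_pM2r// -ltr_pdivlMl ?exprn_gt0//.
    rewrite -[ltLHS]ger0_norm ?ltW//.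
    near: h; apply: dnbhs0_lt; by rewrite mulr_gt0// invr_gt0 exprn_gt0.
  apply: DeriveDef; first by apply/cvg_ex; exists 0; exact: cv.
  exact: (cvg_lim _ cv).
Unshelve. all: by end_near. Qed.

End bump1.

Section smooth_algebra.
Context {R : realType} {m n : nat}.
Local Notation M := 'M[R]_(m, n).
Implicit Types f g : M -> R.

(** The closure of the smooth functions under the operations below. It is stable
under partial derivatives ([smooth_alg_partial]), hence consists of smooth
functions; iterated derivatives of products and compositions are never written
out. *)
Inductive smooth_alg : (M -> R) -> Prop :=
| smooth_alg_smooth f : smooth f -> smooth_alg f
| smooth_alg_cst c : smooth_alg (fun=> c)
| smooth_alg_coord i j : smooth_alg (fun x => x i j)
| smooth_alg_add f g : smooth_alg f -> smooth_alg g -> smooth_alg (fun x => f x + g x)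
| smooth_alg_mul f g : smooth_alg f -> smooth_alg g -> smooth_alg (fun x => f x * g x)
| smooth_alg_exp f : smooth_alg f -> smooth_alg (fun x => expR (f x))
| smooth_alg_pow a f : smooth_alg f -> (forall x, 0 < f x) -> smooth_alg (fun x => f x `^ a)
| smooth_alg_expinv k f : smooth_alg f -> smooth_alg (fun x => expinv k (f x)).

Lemma derive_comp1 (h : R -> R) f (x v : M) (dh : R) :
  differentiable f x -> is_derive (f x) 1 h dh ->
  differentiable (h \o f) x /\ 'D_v (h \o f) x = dh * 'D_v f x.
Proof.
move=> df [dh1 dhE].
have dhf : differentiable h (f x) by exact/derivable1_diffP.
have dc : differentiable (h \o f) x by exact: differentiable_comp.
split => //; rewrite !deriveE// diff_comp//= diff1E//= derive1E dhE.
by rewrite mulrC.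
Qed.

Lemma smooth_alg_partial f : smooth_alg f ->
  (forall x, differentiable f x) /\ (forall ij, smooth_alg (partial ij f)).
Proof.
elim=> {f} [f sf|c|i j|f g _ [df pf] _ [dg pg]|f g sf [df pf] sg [dg pg]
  |f sf [df pf]|a f sf [df pf] f0|k f sf [df pf]].
- split=> [x|ij]; first exact: (sf [::]).
  apply: smooth_alg_smooth => s x.
  by have := sf (rcons s ij) x; rewrite foldr_rcons.
- split=> [x|ij]; first exact: differentiable_cst.
  rewrite (_ : partial _ _ = fun=> 0); first exact: smooth_alg_cst.
  by apply/funext => x; rewrite /partial derive_cst.
- split=> [x|ij]; first exact: differentiable_coord.
  rewrite (_ : partial _ _ = fun=> (delta_mx ij.1 ij.2 : M) i j); first exact: smooth_alg_cst.
  apply/funext => x; rewrite /partial.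
  apply/cvg_lim => //; apply: (@cvg_trans _ (cst ((delta_mx ij.1 ij.2 : M) i j) @ 0^')); last exact: cvg_cst.
  apply: near_eq_cvg; near=> h; rewrite /= !mxE addrK scalerA mulVf ?scale1r//.
  by near: h; exact: nbhs_dnbhs_neq.
- split=> [x|ij]; first exact: differentiableD.
  rewrite (_ : partial _ _ = fun x => partial ij f x + partial ij g x).
    exact: smooth_alg_add.
  by apply/funext => x; rewrite /partial deriveD//; exact: diff_derivable.
- split=> [x|ij]; first exact: differentiableM.
  rewrite (_ : partial _ _ = fun x => f x * partial ij g x + g x * partial ij f x).
    by apply: smooth_alg_add; exact: smooth_alg_mul.
  by apply/funext => x; rewrite /partial deriveM//; exact: diff_derivable.
- split=> [x|ij]; first by have [] := derive_comp1 0 (df x) (is_derive_expR _).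
  rewrite (_ : partial _ _ = fun x => expR (f x) * partial ij f x).
    by apply: smooth_alg_mul => //; exact: smooth_alg_exp.
  by apply/funext => x; rewrite /partial; have [] := derive_comp1 (delta_mx ij.1 ij.2) (df x) (is_derive_expR _).
- have D v x := @derive_comp1 (@powR R ^~ a) f x v _ (df x) (@is_derive1_powR R a _ (f0 x)).
  split=> [x|ij]; first by have [] := D 0 x.
  rewrite (_ : partial _ _ = fun x => a * f x `^ (a - 1) * partial ij f x).
    apply: smooth_alg_mul => //; apply: smooth_alg_mul; first exact: smooth_alg_cst.
    exact: smooth_alg_pow.
  by apply/funext => x; rewrite /partial; have [] := D (delta_mx ij.1 ij.2) x.
- have D v x := @derive_comp1 (expinv k) f x v _ (df x) (is_derive_expinv k (f x)).
  split=> [x|ij]; first by have [] := D 0 x.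
  rewrite (_ : partial _ _ = fun x => (expinv k.+2 (f x) + - k%:R * expinv k.+1 (f x)) * partial ij f x).
    apply: smooth_alg_mul => //; apply: smooth_alg_add; first exact: smooth_alg_expinv.
    by apply: smooth_alg_mul; [exact: smooth_alg_cst|exact: smooth_alg_expinv].
  by apply/funext => x; rewrite /partial mulNr; have [] := D (delta_mx ij.1 ij.2) x.
Unshelve. all: by end_near. Qed.

Lemma smooth_algP f : smooth_alg f -> smooth f.
Proof.
move=> sf s; suff /smooth_alg_partial[] : smooth_alg (foldr partial f s) by [].
by elim: s => //= ij s ih; have [_] := smooth_alg_partial ih; exact.
Qed.

Lemma smooth_alg_prod (I : finType) (F : I -> M -> R) :
  (forall i, smooth_alg (F i)) -> smooth_alg (fun x => \prod_i F i x).
Proof.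
move=> sF; rewrite /index_enum; elim: (Finite.enum I) => [|i s ih].
  by under eq_fun do rewrite big_nil; exact: smooth_alg_cst.
by under eq_fun do rewrite big_cons; exact: smooth_alg_mul.
Qed.

(** A test function supported in the closed box, increasing with k to the indicator
function of the open one. *)
Definition smooth_bump (a b : M) k (x : M) : R := \prod_ij
  (expinv 0 (k.+1%:R * (x ij.1 ij.2 - a ij.1 ij.2)) *
   expinv 0 (k.+1%:R * (b ij.1 ij.2 - x ij.1 ij.2))).

Lemma expinv0_ub (s : R) : 0 <= expinv 0 s <= 1.
Proof.
rewrite expinv_ge0/= /expinv; case: ltP => // s0.
by rewrite expr0 invr1 mul1r expR_le1 oppr_le0 invr_ge0 ltW.
Qed.

Lemma bump_ub a b k x : 0 <= smooth_bump a b k x <= 1.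
Proof.
have h ij : 0 <= expinv 0 (k.+1%:R * (x ij.1 ij.2 - a ij.1 ij.2)) *
   expinv 0 (k.+1%:R * (b ij.1 ij.2 - x ij.1 ij.2)) <= 1.
  have /andP[u1 u2] := expinv0_ub (k.+1%:R * (x ij.1 ij.2 - a ij.1 ij.2)).
  have /andP[v1 v2] := expinv0_ub (k.+1%:R * (b ij.1 ij.2 - x ij.1 ij.2)).
  by rewrite mulr_ge0//= mulr_ile1.
apply/andP; split; first by apply: prodr_ge0 => ij _; have /andP[] := h ij.
by apply: prodr_ile1 => ij _; exact: h.
Qed.

Lemma bump_eq0 a b k x : ~ obox a b x -> smooth_bump a b k x = 0.
Proof.
move=> nx; apply/eqP; rewrite prodf_seq_eq0; apply/hasP.
have [i [j ij]] : exists i j, ~~ (a i j < x i j < b i j).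
  by apply: contra_notP nx => /forallNP nx i j; move/forallNP : (nx i) => /(_ j) /negP; rewrite negbK.
exists (i, j); rewrite ?mem_index_enum//= mulf_eq0.
move: ij; rewrite negb_and -!leNgt => /orP[h|h]; apply/orP; [left|right];
  by rewrite expinv_le0// pmulr_rle0// subr_le0.
Qed.

Lemma test_function_bump a b k : test_function (smooth_bump a b k).
Proof.
split.
  apply: smooth_algP; apply: smooth_alg_prod => -[i j]; apply: smooth_alg_mul;
    apply: smooth_alg_expinv; apply: smooth_alg_mul; (try exact: smooth_alg_cst);
    apply: smooth_alg_add; (try exact: smooth_alg_coord); (try exact: smooth_alg_cst).
  rewrite (_ : (fun x : M => _) = fun x => -1 * x i j).
    by apply: smooth_alg_mul; [exact: smooth_alg_cst|exact: smooth_alg_coord].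
  by apply/funext => x; rewrite mulN1r.
suff h : [set x : M | smooth_bump a b k x != 0] `<=` [set x : M | forall i j, a i j <= x i j <= b i j].
  exact: (compact_closure_sub h (@compact_cbox R m n a b)).
move=> x /= bx i j; apply: contrapT => nx; move/eqP: bx; apply; apply: bump_eq0.
by move=> /(_ i j) /andP[h1 h2]; apply: nx; rewrite !ltW.
Qed.

Lemma cvg_bump a b x : smooth_bump a b k x @[k --> \oo] --> (\1_(obox a b) x : R).
Proof.
have [bx|bx] := pselect (obox a b x); last first.
  rewrite indicE memNset//; under eq_fun do rewrite bump_eq0//.
  exact: cvg_cst.
rewrite indicE mem_set//.
rewrite (_ : true%:R = \prod_(ij : 'I_m * 'I_n) (1 : R)); last by rewrite big1.
have c1 (s : R) : 0 < s -> expinv 0 (k.+1%:R * s) @[k --> \oo] --> (1 : R).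
  move=> s0; have -> : (fun k => expinv 0 (k.+1%:R * s)) = fun k => expR (- (s^-1 * k.+1%:R^-1)).
    by apply/funext => k; rewrite /expinv mulr_gt0// expr0 invr1 mul1r invfM mulrC.
  rewrite -[X in _ --> X]expR0; apply: continuous_cvg; first exact: continuous_expR.
  rewrite -[X in _ --> X]oppr0; apply: cvgN; rewrite -[X in _ --> X](mulr0 s^-1).
  by apply: cvgM; [exact: cvg_cst|exact: cvg_harmonic].
apply: cvg_big => [|ij _]; first exact: mul_continuous.
rewrite -[X in _ --> X](mulr1 1); have /andP[h1 h2] := bx ij.1 ij.2.
by apply: cvgM; apply: c1; rewrite subr_gt0.
Qed.

End smooth_algebra.

(** * Densities, L^p functions, uniqueness of weak derivatives *)

Section density_measure.
Context d (T : measurableType d) (R : realType).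
Variables (mu : {measure set T -> \bar R}) (f : T -> R).
Hypotheses (mf : measurable_fun [set: T] f) (f0 : forall x, 0 <= f x).

Definition density_measure of measurable_fun [set: T] f & (forall x, 0 <= f x) :
  set T -> \bar R := fun A => (\int[mu]_(x in A) (f x)%:E)%E.

Local Notation nu := (density_measure mf f0).

Let nu0 : nu set0 = 0%E. Proof. exact: integral_set0. Qed.

Let nu_ge0 A : (0 <= nu A)%E.
Proof. by apply: integral_ge0 => x _; rewrite lee_fin. Qed.

Let nu_sigma_additive : semi_sigma_additive nu.
Proof.
apply: semi_sigma_additive_nng_induced => [|x]; last by rewrite lee_fin.
exact/measurable_EFinP.
Qed.

HB.instance Definition _ := isMeasure.Build _ _ _ nu nu0 nu_ge0 nu_sigma_additive.

End density_measure.

Section integral_density.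
Context d (T : measurableType d) (R : realType).
Variables (mu nu : {measure set T -> \bar R}) (f : T -> R).
Hypotheses (mf : measurable_fun [set: T] f) (f0 : forall x, 0 <= f x).
Hypothesis nuE : forall A, measurable A -> nu A = (\int[mu]_(x in A) (f x)%:E)%E.

Import HBNNSimple.

(** For simple functions this is the definition of the measure; monotone convergence
does the rest. *)
Lemma ge0_integral_density (g : T -> \bar R) :
  measurable_fun [set: T] g -> (forall x, 0 <= g x)%E ->
  (\int[nu]_x g x = \int[mu]_x (g x * (f x)%:E))%E.
Proof.
move=> mg g0; pose h := nnsfun_approx measurableT mg.
have hnd x a b : (a <= b)%N -> (h a x <= h b x).
  by move=> ab; exact/lefP/nd_nnsfun_approx.
have hg x : (h n x)%:E @[n --> \oo] --> g x by exact: cvg_nnsfun_approx.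
have mh n : measurable_fun [set: T] (EFin \o h n) by apply/measurable_EFinP.
have mfE : measurable_fun [set: T] (EFin \o f) by exact/measurable_EFinP.
have step n : (\int[nu]_x (h n x)%:E = \int[mu]_x ((h n x)%:E * (f x)%:E))%E.
  have fE x : (h n x)%:E = (\sum_(y \in range (h n)) (y * \1_(h n @^-1` [set y]) x)%:E)%E.
    by rewrite fsumEFin// fimfunE.
  have mind r : measurable_fun [set: T] (fun x => (r * \1_(h n @^-1` [set r]) x)%:E).
    by apply/measurable_EFinP; apply: measurable_funM => //; exact: measurable_indic.
  under eq_integral do rewrite fE.
  under [RHS]eq_integral => x _.
    rewrite fE ge0_mule_fsuml; last by move=> y; exact: nnfun_muleindic_ge0.
    over.
  rewrite !ge0_integral_fsum//; last 3 first.
  - by move=> y; apply: emeasurable_funM.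
  - move=> y x _; rewrite mule_ge0//; last by rewrite lee_fin.
    by rewrite EFinM; exact: nnfun_muleindic_ge0.
  - by move=> y x _; rewrite EFinM; exact: nnfun_muleindic_ge0.
  apply: eq_fsbigr => r /[!inE] -[t _ <-].
  have mA : measurable (h n @^-1` [set h n t]) by [].
  under eq_integral do rewrite EFinM.
  have m1 : measurable_fun [set: T] (fun x => (\1_(h n @^-1` [set h n t]) x)%:E : \bar R).
    by apply/measurable_EFinP; exact: measurable_indic.
  have p1 x : (0 <= (\1_(h n @^-1` [set h n t]) x)%:E :> \bar R)%E.
    by rewrite lee_fin indicE.
  have p0 x : (0 <= (f x)%:E)%E by rewrite lee_fin.
  have ph : (0 <= (h n t)%:E)%E by rewrite lee_fin.
  rewrite ge0_integralZl//.
  under [RHS]eq_integral do rewrite EFinM -muleA.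
  rewrite ge0_integralZl//; try solve [exact: emeasurable_funM|by move=> x _; exact: mule_ge0].
  rewrite integral_indic// setIT nuE// integral_mkcond; congr (_ * _)%E.
  apply: eq_integral => x _; rewrite /patch indicE.
  by case: (x \in _); rewrite ?mul1e ?mul0e.
transitivity (limn (fun n => \int[nu]_x (h n x)%:E)%E).
  rewrite -monotone_convergence//.
  - by apply: eq_integral => x _; apply/esym/cvg_lim => //; exact: hg.
  - by move=> n x _; rewrite lee_fin.
  - by move=> x _ a b ab; rewrite lee_fin; exact: hnd.
under eq_fun do rewrite step.
rewrite -monotone_convergence//.
- apply: eq_integral => x _; apply/cvg_lim => //.
  by apply: cvgeZr => //; exact: hg.
- by move=> n; apply: emeasurable_funM; [exact: mh|exact: mfE].
- by move=> n x _; rewrite mule_ge0// lee_fin.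
- by move=> x _ a b ab; apply: lee_wpmul2r; rewrite lee_fin//; exact: hnd.
Qed.

End integral_density.

Section Lp_facts.
Context d (T : measurableType d) (R : realType).
Variables (mu : {measure set T -> \bar R}) (p : R).
Hypothesis p1 : 1 <= p.

Let p0 : 0 < p. Proof. exact: lt_le_trans p1. Qed.

Lemma Lnorm_powR (g : T -> R) :
  ('N[mu]_p%:E[EFin \o g] `^ p = \int[mu]_x (`|g x| `^ p)%:E)%E.
Proof. by rewrite powR_Lnorm ?gt_eqF//; apply: eq_integral. Qed.

Lemma Lfun_finP (g : T -> R) : g \in Lfun mu p%:E <->
  measurable_fun [set: T] g /\ (\int[mu]_x (`|g x| `^ p)%:E < +oo)%E.
Proof.
split.
  move=> /andP[mg fg]; rewrite inE/= in mg; rewrite inE/= in fg; split; first exact: mg.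
  by rewrite -Lnorm_powR poweR_lty.
move=> [mg fg]; apply/andP; split; rewrite inE//=.
rewrite /finite_norm; apply: (@lty_poweRy _ _ p); first by rewrite gt_eqF.
by rewrite Lnorm_powR.
Qed.

Lemma le_1powR (x : R) : 0 <= x -> x <= 1 + x `^ p.
Proof.
move=> x0; have [x1|x1] := leP x 1; first by rewrite (le_trans x1)// lerDl powR_ge0.
by rewrite -[leLHS]powRr1// (le_trans (ler_powR _ p1)) ?lerDr// ltW.
Qed.

Lemma measurable_abs_powR (g : T -> R) : measurable_fun [set: T] g ->
  measurable_fun [set: T] (fun x => (`|g x| `^ p)%:E).
Proof.
move=> mg; apply/measurable_EFinP.
apply: (@measurableT_comp _ _ _ _ _ _ (@powR R ^~ p)) => //.
exact: measurableT_comp.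
Qed.

Lemma Lfun_local_integrable (g : T -> R) (A : set T) :
  g \in Lfun mu p%:E -> measurable A -> (mu A < +oo)%E ->
  mu.-integrable A (EFin \o g).
Proof.
move=> /Lfun_finP[mg fg] mA Aoo; apply/integrableP; split.
  by apply: measurable_funTS; exact/measurable_EFinP.
apply: (@le_lt_trans _ _ (\int[mu]_(x in A) (1%:E + (`|g x| `^ p)%:E)))%E.
  apply: ge0_le_integral => //=.
  - by apply: measurable_funTS; apply/measurable_EFinP; exact: measurableT_comp.
  - by apply: emeasurable_funD => //; apply: measurable_funTS; exact: measurable_abs_powR.
  - by move=> x _; rewrite -EFinD lee_fin le_1powR.
rewrite ge0_integralD//=; try solve [by move=> x _; rewrite lee_fin powR_ge0
  | by apply: measurable_funTS; exact: measurable_abs_powR].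
apply: lte_add_pinfty; first by rewrite integral_cst// mul1e.
apply: le_lt_trans fg.
apply: ge0_subset_integral => //; first exact: measurable_abs_powR.
Qed.

End Lp_facts.

Section bump_determines.
Context {R : realType} {m n : nat}.
Local Notation M := 'M[R]_(m, n).

Lemma measurable_continuous (f : M -> R) : continuous f -> measurable_fun [set: M] f.
Proof.
move=> cf; apply: (measurability _ (RGenOpens.measurableE R)).
move=> _ [_ [a [b ->] <-]]; rewrite setTI; apply: sub_sigma_algebra.
by apply: open_comp => //; exact: interval_open.
Qed.

Lemma smooth_continuous (f : M -> R) : smooth f -> continuous f.
Proof. by move=> sf x; apply: differentiable_continuous; exact: (sf [::]). Qed.

Lemma measurable_bump (a b : M) k : measurable_fun [set: M] (smooth_bump a b k).
Proof.
by apply: measurable_continuous; apply: smooth_continuous; have [] := test_function_bump a b k.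
Qed.

Lemma cvg_integral_bump (mu : {measure set M -> \bar R}) (g : M -> R) a b :
  measurable_fun [set: M] g -> mu.-integrable (obox a b) (EFin \o g) ->
  (\int[mu]_x (g x * smooth_bump a b k x)%:E)%E @[k --> \oo] -->
  (\int[mu]_(x in obox a b) (g x)%:E)%E.
Proof.
move=> mg ig; have mo := measurable_obox a b.
have E k : (\int[mu]_x (g x * smooth_bump a b k x)%:E = \int[mu]_(x in obox a b) (g x * smooth_bump a b k x)%:E)%E.
  rewrite [RHS]integral_mkcond; apply: eq_integral => x _; rewrite /patch.
  case: ifPn => // nx; rewrite bump_eq0 ?mulr0//.
  by move=> h; move: nx; rewrite mem_set.
under eq_fun do rewrite E.
have mE k : measurable_fun (obox a b) (fun x => (g x * smooth_bump a b k x)%:E).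
  apply/measurable_EFinP; apply: measurable_funTS.
  by apply: measurable_funM => //; exact: measurable_bump.
have [] // := @dominated_convergence _ M R mu (obox a b) mo
  (fun k x => (g x * smooth_bump a b k x)%:E) (EFin \o g) (fun x => `|(g x)%:E|%E) mE.
- by apply: measurable_funTS; exact/measurable_EFinP.
- apply: aeW => x bx; apply: cvg_EFin; first by near=> k.
  rewrite -[X in _ --> X]mulr1; apply: cvgM; first exact: cvg_cst.
  by have := @cvg_bump R m n a b x; rewrite indicE mem_set.
- exact: integrable_abse.
- apply: aeW => x k bx; rewrite lee_fin normrM ler_piMr//.
  by have /andP[? ?] := bump_ub a b k x; rewrite ger0_norm.
Unshelve. all: by end_near. Qed.

(** Test with bumps: in the limit the two measures agree on open boxes. *)
Lemma Cb_determines (mu nu : probability M R) :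
  (forall psi, Cb psi -> \int[mu]_x (psi x)%:E = \int[nu]_x (psi x)%:E)%E ->
  forall A, measurable A -> mu A = nu A.
Proof.
move=> H; apply: obox_measure_unique => a b; last first.
  by rewrite (le_lt_trans (probability_le1 mu _))// ?ltry//; exact: measurable_obox.
have key (P : probability M R) : (\int[P]_x (1 * smooth_bump a b k x)%:E)%E @[k --> \oo] --> P (obox a b).
  have <- : (\int[P]_(x in obox a b) (cst 1%E x) = P (obox a b))%E.
    by rewrite integral_cst ?mul1e//; exact: measurable_obox.
  apply: (@cvg_integral_bump P (cst 1)) => //.
  apply: (integrableS measurableT) => //; first exact: measurable_obox.
  exact: finite_measure_integrable_cst.
have := key mu; under eq_fun.
  move=> k; rewrite (H (fun x => 1 * smooth_bump a b k x)); last first.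
    split; last by exists 1 => x; have /andP[? ?] := bump_ub a b k x; rewrite mul1r ger0_norm.
    under eq_fun do rewrite mul1r.
    by apply: smooth_continuous; have [] := test_function_bump a b k.
  over.
by move=> h; apply: (cvg_unique _ h (key nu)).
Qed.

Local Notation leb := (@lebesgue_mx R m n).

(** The positive and negative parts of g, cut off by a bounded box, are densities of
finite measures that agree on boxes, hence on all Borel sets. *)
Lemma ae_eq0_of_obox (g : M -> R) : measurable_fun [set: M] g ->
  (forall a b, leb.-integrable (obox a b) (EFin \o g)) ->
  (forall a b, \int[leb]_(x in obox a b) (g x)%:E = 0)%E ->
  {ae leb, forall x, g x = 0}.
Proof.
move=> mg ig g0.
pose B k : set M := obox (const_mx (- k.+1%:R)) (const_mx k.+1%:R).
have mB k : measurable (B k) by exact: measurable_obox.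
have key k : ae_eq leb (B k) (EFin \o g) (cst 0%E).
  apply: integral_ae_eq => //; first exact: ig.
  move=> A AB mA; rewrite integral0.
  pose gp (x : M) := Num.max (g x) 0 * \1_(B k) x; pose gn (x : M) := Num.max (- g x) 0 * \1_(B k) x.
  have mgp : measurable_fun [set: M] gp.
    by apply: measurable_funM; [exact: measurable_maxr|exact: measurable_indic].
  have mgn : measurable_fun [set: M] gn.
    apply: measurable_funM; last exact: measurable_indic.
    by apply: measurable_maxr => //; exact: measurableT_comp.
  have gp0 x : 0 <= gp x by rewrite mulr_ge0// le_max lexx orbT.
  have gn0 x : 0 <= gn x by rewrite mulr_ge0// le_max lexx orbT.
  have fpE C : measurable C -> density_measure leb mgp gp0 C = (\int[leb]_(x in C `&` B k) (EFin \o g)^\+ x)%E.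
    move=> mC; rewrite /density_measure [RHS]integral_mkcondr; apply: eq_integral => x _.
    rewrite /patch /gp indicE; case: (x \in _); rewrite ?mulr1 ?mulr0//.
    by rewrite funeposE EFin_max.
  have fnE C : measurable C -> density_measure leb mgn gn0 C = (\int[leb]_(x in C `&` B k) (EFin \o g)^\- x)%E.
    move=> mC; rewrite /density_measure [RHS]integral_mkcondr; apply: eq_integral => x _.
    rewrite /patch /gn indicE; case: (x \in _); rewrite ?mulr1 ?mulr0//.
    by rewrite funenegE EFin_max.
  have fin C : measurable C -> leb.-integrable (C `&` B k) (EFin \o g).
    move=> mC; have mCB := measurableI _ _ mC (mB k).
    apply: (integrableS (mB k) mCB _ (ig _ _)); exact: subIsetr.
  have E C : measurable C -> density_measure leb mgp gp0 C = density_measure leb mgn gn0 C ->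
      (\int[leb]_(x in C `&` B k) (g x)%:E = 0)%E.
    move=> mC; rewrite fpE// fnE// => EE; rewrite integralE/= EE subee//.
    by apply: integrable_fin_num; [exact: measurableI|apply: integrable_funeneg => //; [exact: measurableI|exact: fin]].
  rewrite -(setIidl AB); apply: E => //.
  apply: (@obox_measure_unique _ _ _ (density_measure leb mgp gp0) (density_measure leb mgn gn0)) => //= a b; last first.
    rewrite fpE; last exact: measurable_obox.
    have := fin _ (measurable_obox a b).
    move=> /(integrable_funepos (measurableI _ _ (measurable_obox a b) (mB k))).
    move=> /integrable_fin_num => /(_ (measurableI _ _ (measurable_obox a b) (mB k))).
    by rewrite fin_numElt => /andP[].
  have [c [e ce]] : exists c e, obox a b `&` B k = obox c e.
    have [[c e] _ ce] : [set obox ab.1 ab.2 | ab in [set: M * M]] (obox a b `&` B k).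
      apply: setI_closed_obox; first by exists (a, b).
      by exists (const_mx (- k.+1%:R), const_mx k.+1%:R).
    by exists c, e.
  have := g0 c e; rewrite -ce integralE/= -fpE; last exact: measurable_obox.
  rewrite -fnE; last exact: measurable_obox.
  set u := density_measure _ _ _ _; set v := density_measure _ _ _ _.
  have ufin : u \is a fin_num.
    rewrite /u fpE; last exact: measurable_obox.
    apply: integrable_fin_num; first by apply: measurableI => //; exact: measurable_obox.
    apply: integrable_funepos; first by apply: measurableI => //; exact: measurable_obox.
    by apply: fin; exact: measurable_obox.
  have vfin : v \is a fin_num.
    rewrite /v fnE; last exact: measurable_obox.
    apply: integrable_fin_num; first by apply: measurableI => //; exact: measurable_obox.
    apply: integrable_funeneg; first by apply: measurableI => //; exact: measurable_obox.
    by apply: fin; exact: measurable_obox.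
  move: ufin vfin; move: u v => [u||] [v||]// _ _.
  by rewrite -EFinB => -[h]; congr EFin; apply/eqP; rewrite -subr_eq0 h.
have : {ae leb, forall x k, B k x -> (EFin \o g) x = 0%E}.
  by apply/ae_foralln => k; exact: key.
apply: filterS => x h.
have : [set: M] x by []; rewrite -obox_cover => -[k _ xk].
by have /= [] := h k xk.
Qed.

(** Testing against bumps shows that g1 and g2 have the same integral on every box. *)
Lemma weak_partial_unique p ij (f g1 g2 : M -> R) : 1 <= p ->
  g1 \in Lfun leb p%:E -> g2 \in Lfun leb p%:E ->
  weak_partial ij f g1 -> weak_partial ij f g2 -> {ae leb, forall x, g1 x = g2 x}.
Proof.
move=> p1 G1 G2 w1 w2.
have [mg1 _] := (Lfun_finP leb p1 g1).1 G1.
have [mg2 _] := (Lfun_finP leb p1 g2).1 G2.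
have ig1 a b := Lfun_local_integrable p1 G1 (measurable_obox a b) (lebesgue_mx_obox_lty a b).
have ig2 a b := Lfun_local_integrable p1 G2 (measurable_obox a b) (lebesgue_mx_obox_lty a b).
suff : {ae leb, forall x, g1 x - g2 x = 0}.
  by apply: filterS => x /eqP; rewrite subr_eq0 => /eqP.
apply: ae_eq0_of_obox; first exact: measurable_funB.
  move=> a b; rewrite (_ : EFin \o _ = (EFin \o g1) \- (EFin \o g2))%E.
    by apply: integrableB => //; exact: measurable_obox.
  by apply/funext => x; rewrite /= EFinB.
move=> a b; under eq_integral do rewrite EFinB.
rewrite integralB//; try solve [exact: measurable_obox|exact: ig1|exact: ig2].
have h1 := cvg_integral_bump mg1 (ig1 a b).
have h2 := cvg_integral_bump mg2 (ig2 a b).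
have E : (\int[leb]_(x in obox a b) (g1 x)%:E = \int[leb]_(x in obox a b) (g2 x)%:E)%E.
  rewrite -(cvg_lim _ h1)// -(cvg_lim _ h2)//; congr (limn _); apply/funext => k.
  have := w1 _ (test_function_bump a b k); rewrite w2; last exact: test_function_bump.
  by move/oppe_inj.
rewrite E subee//; apply: integrable_fin_num; [exact: measurable_obox|exact: ig2].
Unshelve. all: by end_near. Qed.

End bump_determines.

(** * Lebesgue measure on matrices *)

Section tuple_product_integral.
Context d (T : measurableType d) (R : realType).
Local Open Scope ereal_scope.

Lemma emeasurable_prod d' (T' : measurableType d') (I : Type) (s : seq I) (f : I -> T' -> \bar R) :
  (forall i, measurable_fun [set: T'] (f i)) ->
  measurable_fun [set: T'] (fun x => \prod_(i <- s) f i x).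
Proof.
move=> mf; elim: s => [|i s ih]; first by under eq_fun do rewrite big_nil; exact: measurable_cst.
by under eq_fun do rewrite big_cons; exact: emeasurable_funM.
Qed.

Lemma integral_tuple_product k (mu : 'I_k -> {sigma_finite_measure set T -> \bar R})
    (a : 'I_k -> T -> \bar R) :
  (forall i, measurable_fun [set: T] (a i)) -> (forall i x, 0 <= a i x) ->
  \int[tuple_product mu]_t (\prod_i a i (tnth t i)) = \prod_i \int[mu i]_x a i x.
Proof.
elim: k mu a => [|k ih] mu a ma a0 /=.
  rewrite big_ord0; under eq_integral do rewrite big_ord0.
  by rewrite integral_cst// mul1e; exact: diracT.
have mp : measurable_fun [set: k.+1.-tuple T] (fun t => \prod_i a i (tnth t i)).
  apply: emeasurable_prod => i; apply: measurableT_comp => //; exact: measurable_tnth.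
have p0 (t : k.+1.-tuple T) : 0 <= \prod_i a i (tnth t i) by apply: prode_ge0.
have mp' : measurable_fun [set: k.-tuple T] (fun t => \prod_i a (lift ord0 i) (tnth t i)).
  apply: emeasurable_prod => i; apply: measurableT_comp => //; exact: measurable_tnth.
have p0' (t : k.-tuple T) : 0 <= \prod_i a (lift ord0 i) (tnth t i) by apply: prode_ge0.
rewrite /product_cons /image_measure ge0_integral_pushforward//; try exact: measurable_cons_pair.
rewrite preimage_setT fubini_tonelli1//; try solve [by move=> x; exact: p0
  | by apply: measurableT_comp => //; exact: measurable_cons_pair].
rewrite /fubini_F big_ord_recl -ih//.
rewrite -ge0_integralZr//; last by apply: integral_ge0.
apply: eq_integral => x _; rewrite -ge0_integralZl//.
apply: eq_integral => t _; rewrite /= big_ord_recl; congr (_ * _).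
by apply: eq_bigr => i _; rewrite (tnthS _ t).
Qed.

End tuple_product_integral.

Section lebesgue_structure.
Context {R : realType}.
Local Notation leb m n := (@lebesgue_mx R m n).

(** Tonelli for functions that are products over the entries. *)
Lemma lebesgue_prod_entries m n (b : 'I_m -> 'I_n -> R -> \bar R) :
  (forall i j, measurable_fun [set: R] (b i j)) -> (forall i j x, 0 <= b i j x)%E ->
  (\int[leb m n]_x (\prod_i \prod_j b i j (x i j)) = \prod_i \prod_j \int[lebesgue_measure]_t b i j t)%E.
Proof.
move=> mb b0; rewrite /lebesgue_mx /image_measure ge0_integral_pushforward//; last 2 first.
- do 2 (apply: emeasurable_prod => ?); apply: measurableT_comp => //; exact: measurable_mx_coord.
- by move=> x _; do 2 (apply: prode_ge0 => ? _).
rewrite preimage_setT.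
pose c (k : 'I_(m * n)) : R -> \bar R :=
  let ij := enum_val (cast_ord (esym (mxvec_cast m n)) k) in b ij.1 ij.2.
have cE i j : c (mxvec_index i j) = b i j.
  by rewrite /c /mxvec_index cast_ordK enum_rankK.
transitivity (\int[tuple_product (fun=> lebesgue_measure)]_t \prod_k c k (tnth t k))%E.
  apply: eq_integral => t _ /=.
  rewrite pair_bigA/= [RHS](reindex (fun ij : 'I_m * 'I_n => mxvec_index ij.1 ij.2))/=; last first.
    have [g c1 c2] := @curry_mxvec_bij m n.
    by exists g => [[i j] /= h|k h]; [exact: (c1 (i, j))|rewrite -[RHS]c2//; case: (g k)].
  by apply: eq_bigr => -[i j] _ /=; rewrite cE mxE.
rewrite (@integral_tuple_product _ (measurableTypeR R) R _ (fun=> lebesgue_measure) c); last 2 first.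
- by move=> k; exact: mb.
- by move=> k x; exact: b0.
rewrite [RHS]pair_bigA/= (reindex (fun ij : 'I_m * 'I_n => mxvec_index ij.1 ij.2))/=; last first.
  have [g c1 c2] := @curry_mxvec_bij m n.
  by exists g => [[i j] /= h|k h]; [exact: (c1 (i, j))|rewrite -[RHS]c2//; case: (g k)].
by apply: eq_bigr => -[i j] _ /=; rewrite cE.
Qed.

Lemma lebesgue_translation m n (w : 'M[R]_(m, n)) (f : 'M[R]_(m, n) -> \bar R) :
  measurable_fun [set: 'M[R]_(m, n)] f -> (forall x, 0 <= f x)%E ->
  (\int[leb m n]_x f (x - w)%R = \int[leb m n]_x f x)%E.
Proof.
move=> mf f0; pose tr (x : 'M[R]_(m, n)) := x - w.
have mtr : measurable_fun [set: 'M[R]_(m, n)] tr.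
  apply: measurable_fun_mxP => i j; under eq_fun do rewrite !mxE.
  by apply: measurable_funB => //; exact: measurable_mx_coord.
pose tr_mixin := isMeasurableFun.Build _ _ _ _ _ mtr.
pose tr_pack : {mfun 'M[R]_(m, n) >-> 'M[R]_(m, n)} := HB.pack tr tr_mixin.
transitivity (\int[image_measure (leb m n) tr_pack]_x f x)%E.
  by rewrite /image_measure ge0_integral_pushforward.
apply: eq_measure_integral => A mA _.
apply: (@obox_measure_unique _ _ _ (image_measure (leb m n) tr_pack)) => // a b; last first.
  rewrite /image_measure /pushforward /=.
  rewrite [X in leb m n X](_ : _ = obox (a + w) (b + w)) ?lebesgue_mx_obox_lty//.
  by apply/seteqP; split => x h i j; have := h i j; rewrite !mxE ltrBrDr ltrBlDr.
rewrite /image_measure /pushforward /=.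
rewrite [X in leb m n X](_ : _ = obox (a + w) (b + w)).
  rewrite !lebesgue_mx_obox; congr EFin; apply: eq_bigr => i _; apply: eq_bigr => j _.
  by rewrite !mxE; congr (Num.max 0 _); ring.
by apply/seteqP; split => x h i j; have := h i j; rewrite !mxE ltrBrDr ltrBlDr.
Qed.

Lemma obox_rows N d (a b : 'M[R]_(N, d)) :
  obox a b = [set x | forall k, obox (row k a) (row k b) (row k x)].
Proof.
apply/seteqP; split => x h; first by move=> k i j; rewrite !mxE; exact: h.
by move=> i j; have := h i 0 j; rewrite !mxE.
Qed.

(** Tonelli for functions that are products over the rows; the product of the
Lebesgue measures of the rows agrees with that of the whole space on boxes. *)
Lemma lebesgue_prod_rows N d (a : 'I_N -> 'rV[R]_d -> \bar R) :
  (forall i, measurable_fun [set: 'rV[R]_d] (a i)) -> (forall i x, 0 <= a i x)%E ->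
  (\int[leb N d]_x (\prod_i a i (row i x)) = \prod_i \int[leb 1 d]_v a i v)%E.
Proof.
move=> ma a0.
rewrite -(@integral_tuple_product _ 'rV[R]_d R _ (fun=> leb 1 d))//.
transitivity (\int[image_measure (tuple_product (fun _ : 'I_N => leb 1 d)) (@mx_of_rows R N d)]_x
   (\prod_i a i (row i x)))%E; last first.
  rewrite /image_measure ge0_integral_pushforward//; last 2 first.
  - apply: emeasurable_prod => i; apply: measurableT_comp => //; exact: measurable_row.
  - by move=> x _; apply: prode_ge0.
  rewrite preimage_setT; apply: eq_integral => t _ /=; apply: eq_bigr => i _; congr (a i _).
  by apply/rowP => j; rewrite !mxE.
apply: eq_measure_integral => A mA _.
apply: (@obox_measure_unique _ _ _ (leb N d)) => // u v; last exact: lebesgue_mx_obox_lty.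
rewrite /image_measure /pushforward /=.
rewrite (_ : mx_of_rows @^-1` obox u v = [set t | forall i, obox (row i u) (row i v) (tnth t i)]).
  rewrite (@tuple_product_box _ 'rV[R]_d R _ (fun=> leb 1 d)
    (fun i => obox (row i u) (row i v))); last by move=> i; exact: measurable_obox.
  rewrite lebesgue_mx_obox -prodEFin; apply: eq_bigr => i _.
  apply: esym; etransitivity; first exact: lebesgue_mx_obox.
  congr EFin; rewrite big_ord1.
  by apply: eq_bigr => j _; rewrite !mxE.
apply/seteqP; split => t /= h i; last by move=> j; have := h i 0 j; rewrite !mxE.
by move=> k j; rewrite ord1; have := h i j; rewrite !mxE.
Qed.

Definition insert_row N d (k : 'I_N.+1) (v : 'rV[R]_d) (x : 'M[R]_(N, d)) : 'M[R]_(N.+1, d) :=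
  \matrix_(i, j) if unlift k i is Some i' then x i' j else v 0 j.

Lemma row_insert_row N d (k : 'I_N.+1) (v : 'rV[R]_d) (x : 'M[R]_(N, d)) :
  row k (insert_row k v x) = v.
Proof. by apply/rowP => j; rewrite !mxE unlift_none. Qed.

Lemma row_insert_row_lift N d (k : 'I_N.+1) (v : 'rV[R]_d) (x : 'M[R]_(N, d)) i :
  row (lift k i) (insert_row k v x) = row i x.
Proof. by apply/rowP => j; rewrite !mxE liftK. Qed.

Definition insert_row_pair N d (k : 'I_N.+1) (vx : 'rV[R]_d * 'M[R]_(N, d)) :=
  insert_row k vx.1 vx.2.

Lemma measurable_insert_row N d (k : 'I_N.+1) :
  measurable_fun [set: 'rV[R]_d * 'M[R]_(N, d)] (@insert_row_pair N d k).
Proof.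
apply: measurable_fun_mxP => i j; under eq_fun do rewrite mxE.
case: unliftP => [i' _|_].
  exact: (measurableT_comp (measurable_mx_coord i' j) measurable_snd).
exact: (measurableT_comp (measurable_mx_coord 0 j) measurable_fst).
Qed.

HB.instance Definition _ N d (k : 'I_N.+1) :=
  isMeasurableFun.Build _ _ _ _ (@insert_row_pair N d k) (@measurable_insert_row N d k).

Lemma lebesgue_insert_row N d (k : 'I_N.+1) A : measurable A ->
  leb N.+1 d A = image_measure (leb 1 d \x leb N d)%E (@insert_row_pair N d k) A.
Proof.
move=> mA; apply: obox_measure_unique => // a b; last exact: lebesgue_mx_obox_lty.
transitivity ((leb 1 d \x leb N d)%E (@insert_row_pair N d k @^-1` obox a b)); last by [].
rewrite (_ : _ @^-1` _ = obox (row k a) (row k b) `*`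
   obox (\matrix_(i, j) a (lift k i) j) (\matrix_(i, j) b (lift k i) j)).
  rewrite [RHS]product_measure1E; [|exact: measurable_obox|exact: measurable_obox].
  etransitivity; first exact: lebesgue_mx_obox.
  apply: esym; etransitivity.
    by apply: congr2; [exact: lebesgue_mx_obox|exact: lebesgue_mx_obox].
  rewrite -EFinM; congr EFin; rewrite [RHS](bigD1_ord k)//= big_ord1.
  congr (_ * _); first by apply: eq_bigr => j _; rewrite !mxE.
  by apply: eq_bigr => i _; apply: eq_bigr => j _; rewrite !mxE.
apply/seteqP; split => [[v x] /= h|[v x] [/= h1 h2] i j].
  split=> i j; first by have := h k j; rewrite ord1 !mxE unlift_none.
  by have := h (lift k i) j; rewrite !mxE liftK.
rewrite mxE; case: (unliftP k i) => [i' ->|->].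
  by have := h2 i' j; rewrite !mxE.
by have := h1 0 j; rewrite !mxE.
Qed.

(** Fubini, with the row k as the inner variable: the form in which partial
derivatives in the row k are integrated by parts. *)
Lemma lebesgue_integral_insert_row N d (k : 'I_N.+1) (f : 'M[R]_(N.+1, d) -> \bar R) :
  (leb N.+1 d).-integrable [set: 'M[R]_(N.+1, d)] f ->
  (\int[leb N.+1 d]_x f x = \int[leb N d]_x \int[leb 1 d]_v f (insert_row k v x))%E.
Proof.
move=> fi; have mf : measurable_fun setT f by exact: measurable_int fi.
have mfi : measurable_fun setT (f \o @insert_row_pair N d k).
  by apply: measurableT_comp => //; exact: measurable_insert_row.
have fi' : (leb 1 d \x leb N d)%E.-integrable [set: 'rV[R]_d * 'M[R]_(N, d)]
    (f \o @insert_row_pair N d k).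
  apply/integrableP; split => //.
  have /integrableP[_] := fi; rewrite (eq_measure_integral
    (image_measure (leb 1 d \x leb N d)%E (@insert_row_pair N d k))); last first.
    by move=> A mA _; exact: lebesgue_insert_row.
  rewrite /image_measure ge0_integral_pushforward//;
    try solve [exact: measurable_insert_row | exact: measurableT_comp].
rewrite (eq_measure_integral
    (image_measure (leb 1 d \x leb N d)%E (@insert_row_pair N d k))); last first.
  by move=> A mA _; exact: lebesgue_insert_row.
rewrite /image_measure integral_pushforward//; try exact: measurable_insert_row.
by rewrite preimage_setT -integral21_prod_meas1.
Qed.

End lebesgue_structure.

Section gaussian.
Context {R : realType}.
Local Notation eta := Defs.eta.
Local Notation leb m n := (@lebesgue_mx R m n).

Lemma eta_normal_pdf d (eps : R) (v : 'rV[R]_d) : 0 < eps ->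
  eta eps v = \prod_j normal_pdf 0 (Num.sqrt eps) (v 0 j).
Proof.
move=> e0; have se : Num.sqrt eps != 0 by rewrite gt_eqF// sqrtr_gt0.
under eq_bigr do rewrite normal_pdfE//.
rewrite big_split/= prodr_const card_ord /eta; congr (_ * _).
  rewrite /normal_peak sqr_sqrtr; last exact: ltW.
  have pe : 0 < 2 * pi * eps by rewrite !mulr_gt0// pi_gt0.
  rewrite -(mulr_natr (_ * pi)) [_ * 2](_ : _ = 2 * pi * eps); last by ring.
  rewrite -powR12_sqrt ?ltW// -powRN -powR_mulrn ?powR_ge0// -powRrM.
  by congr (_ `^ _); rewrite mulNr [in RHS]mulrC.
rewrite /normal_fun -expR_sum; congr expR; rewrite -sumrN mulr_suml -?sumrN.
apply: eq_bigr => j _; rewrite subr0 sqr_sqrtr ?ltW//.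
by rewrite -(mulr_natl eps 2).
Qed.

(** [eta] is a product of one-dimensional normal densities. *)
Lemma integral_eta d (eps : R) : 0 < eps -> (\int[leb 1 d]_v (eta eps v)%:E = 1)%E.
Proof.
move=> e0.
have := @lebesgue_prod_entries R 1 d (fun _ _ t => (normal_pdf 0 (Num.sqrt eps) t)%:E).
rewrite big_ord1 (eq_bigr (fun=> 1%E)); last by move=> j _; exact: integral_normal_pdf.
rewrite big1// => <-//; first last.
- by move=> _ _ x; rewrite lee_fin normal_pdf_ge0.
- by move=> _ _; apply/measurable_EFinP; exact: measurable_normal_pdf.
by apply: eq_integral => v _; rewrite big_ord1 prodEFin eta_normal_pdf.
Qed.

Definition sqnorm m n (x : 'M[R]_(m, n)) : R := \sum_i \sum_j x i j ^+ 2.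

Lemma measurable_sqnorm m n : measurable_fun [set: 'M[R]_(m, n)] (@sqnorm m n).
Proof.
apply: measurable_sum => i; apply: measurable_sum => j; apply: measurable_funX.
exact: measurable_mx_coord.
Qed.

Lemma sqnorm_ge0 m n (x : 'M[R]_(m, n)) : 0 <= sqnorm x.
Proof. by apply: sumr_ge0 => i _; apply: sumr_ge0 => j _; rewrite sqr_ge0. Qed.

Lemma etaE d (eps : R) (v : 'rV[R]_d) :
  eta eps v = eta eps (0 : 'rV[R]_d) * expR (- sqnorm v / (2 * eps)).
Proof.
rewrite /eta /sqnorm big_ord1; congr (_ * _).
by rewrite big1 ?oppr0 ?mul0r ?expR0 ?mulr1// => i _; rewrite mxE expr0n.
Qed.

Lemma eta0_gt0 d (eps : R) : 0 < eps -> 0 < eta eps (0 : 'rV[R]_d).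
Proof. by move=> e0; rewrite mulr_gt0 ?expR_gt0// powR_gt0// !mulr_gt0// pi_gt0. Qed.

Lemma eta_gt0 d (eps : R) (v : 'rV[R]_d) : 0 < eps -> 0 < eta eps v.
Proof. by move=> e0; rewrite etaE mulr_gt0 ?eta0_gt0 ?expR_gt0. Qed.

Lemma eta_le0 d (eps : R) (v : 'rV[R]_d) : 0 < eps -> eta eps v <= eta eps (0 : 'rV[R]_d).
Proof.
move=> e0; rewrite etaE ler_piMr// ?eta_ge0// -expR0 ler_expR mulNr oppr_le0.
by rewrite divr_ge0 ?sqnorm_ge0// mulr_ge0// ltW.
Qed.

Lemma sqnorm_rows N d (x : 'M[R]_(N, d)) : sqnorm x = \sum_k sqnorm (row k x).
Proof.
apply: eq_bigr => k _; rewrite /sqnorm big_ord1.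
by apply: eq_bigr => j _; rewrite mxE.
Qed.

Lemma integral_gaussian N d (a : R) : 0 < a ->
  (\int[leb N d]_x (expR (- a * sqnorm x))%:E < +oo)%E.
Proof.
move=> a0; pose e := (2 * a)^-1; have e0 : 0 < e by rewrite invr_gt0 mulr_gt0.
pose c := eta e (0 : 'rV[R]_d).
have c0 : 0 < c by exact: eta0_gt0.
have E (x : 'M[R]_(N, d)) : (expR (- a * sqnorm x))%:E = (\prod_(k < N) (c^-1 * eta e (row k x))%:E)%E.
  rewrite prodEFin sqnorm_rows mulr_sumr expR_sum; congr EFin; apply: eq_bigr => k _.
  rewrite etaE -/c mulKf ?gt_eqF//; congr expR; rewrite /e; field; exact: lt0r_neq0.
under eq_integral do rewrite E.
rewrite (@lebesgue_prod_rows R N d (fun _ v => (c^-1 * eta e v)%:E)); last 2 first.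
- by move=> _; apply/measurable_EFinP; apply: measurable_funM => //; exact: measurable_eta.
- by move=> _ v; rewrite lee_fin mulr_ge0 ?eta_ge0// invr_ge0 ltW.
rewrite (eq_bigr (fun=> (c^-1)%:E)); last first.
  move=> k _; under eq_integral do rewrite EFinM.
  rewrite ge0_integralZl//; try solve [by apply/measurable_EFinP; exact: measurable_eta
    | by move=> v _; rewrite lee_fin eta_ge0 | by rewrite lee_fin invr_ge0 ltW
    | by rewrite integral_eta// mule1].
by rewrite prodEFin ltry.
Qed.

End gaussian.

(** * Laplace transforms of weights with Gaussian decay *)

Section frechet.
Context {R : realType} {m n : nat}.
Local Notation M := 'M[R]_(m, n).

Lemma coord_le_norm (x : M) i j : `|x i j| <= `|x|.
Proof.
rewrite [leRHS]mx_normrE.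
by apply: (le_trans _ (@le_bigmax _ _ _ 0 (fun ij => `|x ij.1 ij.2|) (i, j))).
Qed.

(** A quadratic remainder is stronger than Frechet differentiability; it is what
differentiation under the integral sign produces. *)
Lemma differentiable_quadratic (f : M -> R) (df : {linear M -> R}) x (K B : R) :
  (forall h, `|df h| <= B * `|h|) ->
  (forall h : M, `|h| <= 1 -> `|f (h + x) - f x - df h| <= K * `|h| ^+ 2) ->
  differentiable f x /\ forall v, 'D_v f x = df v.
Proof.
move=> dfB fK.
have dfc : continuous df.
  apply/linear_bounded_continuous/linear_boundedP; near=> r; move=> y.
  have Br : B <= r by near: r; apply: nbhs_pinfty_ge; exact: num_real.
  by rewrite (le_trans (dfB y))// ler_wpM2r.
have H : (f : M -> R^o) \o shift x = cst (f x : R^o) + (df : M -> R^o) +o_ (0 : M) id.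
  apply/eqaddoP => e e0.
  have N1 : \forall h \near (0 : M), `|h| <= 1 by exact: nbhs0_le.
  have N2 : \forall h \near (0 : M), K * `|h| <= e.
    have [K0|K0] := leP K 0.
      by apply: filterS N1 => h _; rewrite (le_trans _ (ltW e0))// mulr_le0_ge0.
    have eK : 0 < K^-1 * e by rewrite mulr_gt0// invr_gt0.
    have : \forall h \near (0 : M), `|h| <= K^-1 * e by exact: nbhs0_le.
    by apply: filterS => h; rewrite ler_pdivlMl.
  have : \forall h \near (0 : M), `|f (h + x) - f x - df h| <= e * `|h|.
    apply: filterS2 N1 N2 => h h1 h2.
    by apply: (le_trans (fK h h1)); rewrite expr2 mulrA ler_wpM2r.
  by apply: filterS => h; rewrite /= !fctE opprD addrA.
have dE := @diff_unique R M R^o f df x dfc H.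
have df' : differentiable f x by apply/diff_locallyP; rewrite dE.
by split => // v; rewrite deriveE// dE.
Unshelve. all: by end_near. Qed.

End frechet.

Section integral_gt0.
Context d (T : measurableType d) (R : realType) (mu : {measure set T -> \bar R}).

Lemma integral_gt0 (f : T -> R) : measurable_fun [set: T] f -> (forall x, 0 < f x) ->
  mu [set: T] != 0%E -> (0 < \int[mu]_x (f x)%:E)%E.
Proof.
move=> mf f0 muT; rewrite lt0e integral_ge0 ?andbT; last first.
  by move=> x _; rewrite lee_fin ltW.
apply: contra_neq muT => E.
have mfE : measurable_fun [set: T] (EFin \o f) by exact/measurable_EFinP.
have /(ae_eq_integral_abs mu measurableT mfE)[A [mA A0 h]] :
    (\int[mu]_x `|(EFin \o f) x| = 0)%E.
  by rewrite -[RHS]E; apply: eq_integral => x _; rewrite gee0_abs// lee_fin ltW.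
suff AT : A = [set: T] by rewrite -AT.
apply/seteqP; split=> // x _; apply: h => /= /(_ I) /eqP.
by rewrite eqe gt_eqF.
Qed.

End integral_gt0.

Section laplace.
Context {R : realType} {N d : nat}.
Local Notation M := 'M[R]_(N, d).
Local Notation leb := (@lebesgue_mx R N d).

Definition l1norm (y : M) : R := \sum_i \sum_j `|y i j|.
Definition dotp (x y : M) : R := \sum_i \sum_j x i j * y i j.

Lemma l1norm_ge0 y : 0 <= l1norm y.
Proof. by apply: sumr_ge0 => i _; apply: sumr_ge0. Qed.

Lemma dotp_le x y : `|dotp x y| <= `|x| * l1norm y.
Proof.
rewrite /dotp /l1norm mulr_sumr (le_trans (ler_norm_sum _ _ _))// ler_sum// => i _.
rewrite mulr_sumr (le_trans (ler_norm_sum _ _ _))// ler_sum// => j _.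
by rewrite normrM ler_wpM2r// coord_le_norm.
Qed.

Lemma dotpDl x x' y : dotp (x + x') y = dotp x y + dotp x' y.
Proof.
rewrite /dotp -big_split; apply: eq_bigr => i _ /=; rewrite -big_split.
by apply: eq_bigr => j _; rewrite mxE mulrDl.
Qed.

Lemma dotpZl c x y : dotp (c *: x) y = c * dotp x y.
Proof.
rewrite /dotp mulr_sumr; apply: eq_bigr => i _; rewrite mulr_sumr.
by apply: eq_bigr => j _; rewrite mxE mulrA.
Qed.

Lemma measurable_dotp x : measurable_fun [set: M] (dotp x).
Proof.
apply: measurable_sum => i; apply: measurable_sum => j; apply: measurable_funM => //.
exact: measurable_mx_coord.
Qed.

Lemma measurable_l1norm : measurable_fun [set: M] l1norm.
Proof.
apply: measurable_sum => i; apply: measurable_sum => j.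
by apply: measurableT_comp => //; exact: measurable_mx_coord.
Qed.

(** Completing the square in each entry: a t^2 / 2 - r t + r^2 / (2 a) is a square. *)
Lemma gaussian_absorb (a r : R) : 0 < a -> exists K, 0 <= K /\ forall y : M,
  expR (r * l1norm y) * expR (- a * sqnorm y) <= K * expR (- (a / 2) * sqnorm y).
Proof.
move=> a0; exists (expR (\sum_(i < N) \sum_(j < d) r ^+ 2 / (2 * a))).
split=> [|y]; first exact: expR_ge0.
rewrite -!expRD ler_expR /l1norm /sqnorm !mulr_sumr -!big_split/=; apply: ler_sum => i _.
rewrite !mulr_sumr -!big_split/=; apply: ler_sum => j _.
rewrite -(real_normK (num_real (y i j))); move: `|y i j| => t.
rewrite -subr_ge0 (_ : _ - _ = (a * t - r) ^+ 2 / (2 * a)); last first.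
  by field; exact: lt0r_neq0.
by rewrite divr_ge0 ?sqr_ge0// mulr_ge0// ltW.
Qed.

Lemma integrable_gaussian_dom (f : M -> R) (a r C : R) : 0 < a -> 0 <= C ->
  measurable_fun [set: M] f ->
  (forall y, `|f y| <= C * (expR (r * l1norm y) * expR (- a * sqnorm y))) ->
  leb.-integrable [set: M] (EFin \o f).
Proof.
move=> a0 C0 mf fC; have [K [K0 hK]] := gaussian_absorb r a0.
have a20 : 0 < a / 2 by rewrite divr_gt0.
have mg : measurable_fun [set: M] (fun y => expR (- (a / 2) * sqnorm y)).
  apply: measurableT_comp => //; apply: measurable_funM => //; exact: measurable_sqnorm.
apply: (@le_integrable _ _ _ _ _ measurableT _ (fun y => ((C * K) * expR (- (a / 2) * sqnorm y))%:E)).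
- exact/measurable_EFinP.
- move=> y _ /=; rewrite lee_fin (le_trans (fC y))// (ger0_norm (mulr_ge0 _ _)) ?expR_ge0 ?mulr_ge0//.
  by rewrite -mulrA ler_wpM2l.
apply/integrableP; split; first by apply/measurable_EFinP; apply: measurable_funM.
under eq_integral do rewrite gee0_abs ?lee_fin ?mulr_ge0 ?expR_ge0// EFinM.
rewrite ge0_integralZl//; try solve [exact/measurable_EFinP
  | by move=> x _; rewrite lee_fin expR_ge0 | by rewrite lee_fin mulr_ge0].
rewrite lte_mul_pinfty// ?lee_fin ?mulr_ge0//; exact: integral_gaussian.
Qed.

(** At most exponential growth: the factors that may multiply a weight with Gaussian
decay without destroying integrability. *)
Definition expgrowth (q : M -> R) := measurable_fun [set: M] q /\
  exists C r, 0 <= C /\ forall y, `|q y| <= C * expR (r * l1norm y).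

Lemma expgrowth_cst c : expgrowth (fun=> c).
Proof. by split=> //; exists `|c|, 0; split=> // y; rewrite mul0r expR0 mulr1. Qed.

Lemma expgrowthM q1 q2 : expgrowth q1 -> expgrowth q2 -> expgrowth (fun y => q1 y * q2 y).
Proof.
move=> [m1 [C1 [r1 [C10 h1]]]] [m2 [C2 [r2 [C20 h2]]]]; split; first exact: measurable_funM.
exists (C1 * C2), (r1 + r2); split=> [|y]; first exact: mulr_ge0.
by rewrite normrM mulrDl expRD mulrACA ler_pM.
Qed.

Lemma expgrowth_norm q : expgrowth q -> expgrowth (fun y => `|q y|).
Proof.
move=> [mq [C [r [C0 h]]]]; split; first exact: measurableT_comp.
by exists C, r; split=> // y; rewrite normr_id.
Qed.

Lemma expgrowth_dotp x : expgrowth (dotp x).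
Proof.
split; first exact: measurable_dotp.
exists `|x|, 1; split=> // y; rewrite (le_trans (dotp_le x y))// ler_wpM2l// mul1r.
by rewrite (le_trans _ (expR_ge1Dx _))// lerDr.
Qed.

Lemma expgrowth_exp (r : R) : expgrowth (fun y => expR (r * l1norm y)).
Proof.
split; last by exists 1, r; split=> // y; rewrite mul1r ger0_norm ?expR_ge0.
by apply: measurableT_comp => //; apply: measurable_funM => //; exact: measurable_l1norm.
Qed.

Lemma expgrowth_expdotp (b : R) x : expgrowth (fun y => expR (b * dotp x y)).
Proof.
split; first by apply: measurableT_comp => //; apply: measurable_funM => //; exact: measurable_dotp.
exists 1, (`|b| * `|x|); split => // y; rewrite mul1r ger0_norm ?expR_ge0// ler_expR.
by rewrite (le_trans (ler_norm _))// normrM -mulrA ler_wpM2l// dotp_le.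
Qed.

Definition gaussbound (a C : R) (w : M -> R) := [/\ measurable_fun [set: M] w,
  (forall y, 0 <= w y) & forall y, w y <= C * expR (- a * sqnorm y)].

Lemma integrable_growth_weight a C w q : 0 < a -> 0 <= C -> gaussbound a C w -> expgrowth q ->
  leb.-integrable [set: M] (EFin \o (fun y => q y * w y)).
Proof.
move=> a0 C0 [mw w0 wC] [mq [D [r [D0 h]]]].
apply: (@integrable_gaussian_dom _ a r (D * C)) => //; first exact: mulr_ge0.
  exact: measurable_funM.
by move=> y; rewrite normrM mulrACA ler_pM// (ger0_norm (w0 y)).
Qed.

(** Taylor remainder of order two, in the form that gives the quadratic remainder of
a Laplace transform. *)
Lemma expR_remainder (u : R) : `|expR u - 1 - u| <= u ^+ 2 * expR `|u|.
Proof.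
have h1 : 1 + u <= expR u by exact: expR_ge1Dx.
rewrite ger0_norm; last by rewrite -addrA -opprD subr_ge0.
have h2 : expR u * (1 - u) <= 1.
  by rewrite -[leRHS](expRxMexpNx_1 u) ler_wpM2l ?expR_ge0// expR_ge1Dx.
have e0 := expR_gt0 u.
have [u0|u0] := leP 0 u.
  rewrite ger0_norm//; nra.
have h3 : 1 <= expR `|u| by rewrite -expR0 ler_expR.
nra.
Qed.

Variables (b : R).

(** The Laplace transform of the weight w with an additional factor q, which collects
the polynomial factors produced by derivatives. *)
Definition laplace (w q : M -> R) (x : M) : R := \int[leb]_y (q y * expR (b * dotp x y) * w y).

Lemma integrable_laplace a C w q x : 0 < a -> 0 <= C -> gaussbound a C w -> expgrowth q ->
  leb.-integrable [set: M] (EFin \o (fun y => q y * expR (b * dotp x y) * w y)).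
Proof.
move=> a0 C0 gw gq; apply: (integrable_growth_weight a0 C0 gw).
by apply: expgrowthM => //; exact: expgrowth_expdotp.
Qed.

Section fixed_weight.
Variables (a C : R) (w : M -> R).
Hypotheses (a0 : 0 < a) (C0 : 0 <= C) (gw : gaussbound a C w).
Let w0 : forall y, 0 <= w y. Proof. by have [] := gw. Qed.

Let il q x (gq : expgrowth q) := integrable_laplace x a0 C0 gw gq.

(** Differentiation under the integral sign: the remainder of exp(b <h, y>) is
quadratic in h, with a coefficient of exponential growth in y. *)
Lemma laplace_partial q (gq : expgrowth q) x :
  differentiable (laplace w q) x /\
  forall v, 'D_v (laplace w q) x = laplace w (fun y => b * dotp v y * q y) x.
Proof.
have gbd h : expgrowth (fun y => b * dotp h y * q y).
  by do 2 apply: expgrowthM => //; [exact: expgrowth_cst|exact: expgrowth_dotp].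
pose df h := laplace w (fun y => b * dotp h y * q y) x.
have df_lin : linear df.
  move=> c h1 h2; rewrite /df /laplace /GRing.scale/=.
  rewrite -RintegralZl//; last exact: il.
  rewrite -RintegralD//; [|exact: (integrableZl measurableT c (il _ (gbd h1)))|exact: il].
  by apply: eq_Rintegral => y _; rewrite dotpDl dotpZl; ring.
pose df_mixin := GRing.isLinear.Build _ _ _ _ _ df_lin.
pose dfL : {linear M -> R} := HB.pack df df_mixin.
(* The coefficient of the square of `|h| in the remainder: expR (2 * l1norm y) absorbs
     the square of l1norm y, and expR (`|b| * l1norm y) absorbs expR `|u|, as `|h| <= 1. *)
pose qK y := b ^+ 2 * `|q y| * expR ((2 + `|b|) * l1norm y).
have gK : expgrowth qK.
  apply: expgrowthM; last exact: expgrowth_exp.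
  by apply: expgrowthM; [exact: expgrowth_cst|exact: expgrowth_norm].
pose qB y := `|b| * `|q y| * expR (1 * l1norm y).
have gB : expgrowth qB.
  apply: expgrowthM; last exact: expgrowth_exp.
  by apply: expgrowthM; [exact: expgrowth_cst|exact: expgrowth_norm].
have l1e (y : M) : l1norm y <= expR (1 * l1norm y).
  by rewrite mul1r (le_trans _ (expR_ge1Dx _))// lerDr.
apply: (@differentiable_quadratic _ _ _ (laplace w q) dfL x (laplace w qK x) (laplace w qB x)).
- move=> h; rewrite /= /df /laplace mulrC -RintegralZl//; last exact: il.
  apply: (le_trans (le_normr_Rintegral measurableT (il _ (gbd h)))).
  apply: le_Rintegral => //; [exact: (integrable_abse (il _ (gbd h)))|exact: (integrableZl measurableT `|h| (il _ gB))|].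
  move=> y _; rewrite !normrM (ger0_norm (expR_ge0 _)) (ger0_norm (w0 y)) /qB.
  have -> : `|h| * (`|b| * `|q y| * expR (1 * l1norm y) * expR (b * dotp x y) * w y) =
     `|b| * (`|h| * expR (1 * l1norm y)) * `|q y| * expR (b * dotp x y) * w y by ring.
  do 2 (apply: ler_wpM2r; first by rewrite ?expR_ge0 ?w0).
  apply: ler_wpM2r => //; apply: ler_wpM2l => //.
  by rewrite (le_trans (dotp_le h y))// ler_wpM2l.
- move=> h h1; rewrite /= /df /laplace.
  have i1 := il (h + x) gq. have i2 := il x gq. have i3 := il x (gbd h).
  have i12 : leb.-integrable [set: M] (EFin \o (fun y => q y * expR (b * dotp (h + x) y) * w y -
      q y * expR (b * dotp x y) * w y)) by exact: (integrableB measurableT i1 i2).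
  rewrite -RintegralB// -RintegralB// [leRHS]mulrC -RintegralZl//; last exact: il.
  have i123 := integrableB measurableT i12 i3.
  apply: (le_trans (le_normr_Rintegral measurableT i123)).
  apply: le_Rintegral => //; [exact: (integrable_abse i123)|exact: (integrableZl measurableT (`|h| ^+ 2) (il _ gK))|].
  move=> y _; rewrite dotpDl mulrDr expRD.
  set u := b * dotp h y; set s := expR (b * dotp x y).
  have -> : q y * (expR u * s) * w y - q y * s * w y - u * q y * s * w y =
     (expR u - 1 - u) * (q y * s * w y) by ring.
  rewrite normrM !normrM (ger0_norm (expR_ge0 _)) (ger0_norm (w0 y)) /qK.
  have -> : `|h| ^+ 2 * (b ^+ 2 * `|q y| * expR ((2 + `|b|) * l1norm y) * s * w y) =
     (`|h| ^+ 2 * b ^+ 2 * expR ((2 + `|b|) * l1norm y)) * (`|q y| * s * w y) by ring.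
  apply: ler_wpM2r; first by rewrite !mulr_ge0 ?expR_ge0.
  apply: (le_trans (expR_remainder u)).
  have ub : `|u| <= `|b| * (`|h| * l1norm y) by rewrite normrM ler_wpM2l// dotp_le.
  have u2 : u ^+ 2 <= `|h| ^+ 2 * b ^+ 2 * expR (2 * l1norm y).
    rewrite -(real_normK (num_real u)) -(real_normK (num_real b)).
    have -> : `|h| ^+ 2 * `|b| ^+ 2 * expR (2 * l1norm y) = (`|b| * (`|h| * expR (l1norm y))) ^+ 2.
      by rewrite expRM_natl; ring.
    rewrite lerXn2r ?nnegrE ?mulr_ge0 ?expR_ge0//.
    by rewrite (le_trans ub)// ler_wpM2l// ler_wpM2l// -[X in _ <= expR X]mul1r.
  rewrite mulrDl expRD mulrA ler_pM ?sqr_ge0 ?expR_ge0// ler_expR (le_trans ub)//.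
  by rewrite ler_wpM2l// ler_piMl// l1norm_ge0.
Qed.

(** Derivatives of Laplace transforms are Laplace transforms with another factor of
exponential growth. *)
Lemma smooth_laplace q : expgrowth q -> smooth (laplace w q).
Proof.
move=> gq s; suff [q' gq' ->] : exists2 q', expgrowth q' & foldr partial (laplace w q) s = laplace w q'.
  by move=> x; have [] := laplace_partial gq' x.
elim: s => [|ij s [q' gq' E]]; first by exists q.
exists (fun y => b * dotp (delta_mx ij.1 ij.2) y * q' y).
  by do 2 apply: expgrowthM => //; [exact: expgrowth_cst|exact: expgrowth_dotp].
by rewrite /= E; apply/funext => x; rewrite /partial; have [_ ->] := laplace_partial gq' x.
Qed.

Lemma laplace_gt0 x : (forall y, 0 < w y) -> 0 < laplace w (cst 1) x.
Proof.
move=> wp; rewrite lt_neqAle Rintegral_ge0 ?andbT; last first.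
  by move=> y _; rewrite !mulr_ge0 ?expR_ge0// ltW.
apply/eqP => /esym E.
have i1 := il x (expgrowth_cst 1).
have lebT : leb [set: M] != 0%E.
  apply/eqP => l0; have : (leb (obox (const_mx 0%R) (const_mx 1%R)) <= leb [set: M])%E.
    by apply: le_measure; rewrite ?inE//; exact: measurable_obox.
  rewrite l0 lebesgue_mx_obox big1 ?lee_fin ?ler10// => i _; rewrite big1// => j _.
  by rewrite !mxE subr0 max_r.
have : (0 < \int[leb]_y (1 * expR (b * dotp x y) * w y)%:E)%E.
  apply: integral_gt0 => //; first by apply/measurable_EFinP; exact: measurable_int i1.
  by move=> y; rewrite !mulr_gt0// expR_gt0.
rewrite -[X in (_ < X)%E]fineK; last by apply: (integrable_fin_num measurableT i1).
by rewrite -/(Rintegral leb setT _) -/(laplace w (cst 1) x) E lte_fin ltxx.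
Qed.

(** Jensen's inequality for the exponential and the probability measure of density
proportional to exp(b <x, y>) w(y). The proof integrates the tangent line
inequality exp(t) >= exp(s) (1 + t - s) at the mean value s of t = b <v, y>. *)
Lemma laplace_tilt x v : 0 < laplace w (cst 1) x ->
  laplace w (cst 1) x * expR (laplace w (fun y => b * dotp v y) x / laplace w (cst 1) x)
    <= laplace w (cst 1) (x + v).
Proof.
move=> L0; set L := laplace w (cst 1) x; set L1 := laplace w _ x; set s := L1 / L.
have g1 : expgrowth (fun y => b * dotp v y).
  by apply: expgrowthM; [exact: expgrowth_cst|exact: expgrowth_dotp].
have i0 := il x (expgrowth_cst 1). have i1 := il x g1.
have iA : leb.-integrable [set: M] (EFin \o (fun y => (1 - s) * (1 * expR (b * dotp x y) * w y))).
  exact: (integrableZl measurableT (1 - s) i0).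
have E : L * expR s = \int[leb]_y (expR s * ((1 - s) * (1 * expR (b * dotp x y) * w y) + b * dotp v y * expR (b * dotp x y) * w y)).
  rewrite RintegralZl//; last exact: (integrableD measurableT iA i1).
  rewrite RintegralD// RintegralZl// -/(laplace w (cst 1) x) -/L -/(laplace w (fun y => b * dotp v y) x) -/L1.
  rewrite mulrC; congr (_ * _); rewrite /s; field; exact: lt0r_neq0.
rewrite E; apply: le_Rintegral => //.
- exact: (integrableZl measurableT (expR s) (integrableD measurableT iA i1)).
- by apply: il; exact: expgrowth_cst.
move=> y _; rewrite (dotpDl x v y) [b * (dotp x y + _)]mulrDr expRD /cst.
rewrite (_ : expR s * _ = (expR s * (1 + (b * dotp v y - s))) * (1 * expR (b * dotp x y) * w y)); last by ring.
rewrite (_ : 1 * (_ * _) * _ = expR (b * dotp v y) * (1 * expR (b * dotp x y) * w y)); last by ring.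
apply: ler_wpM2r; first by rewrite !mulr_ge0// expR_ge0.
rewrite -[X in _ <= expR X](subrKC s) expRD ler_wpM2l ?expR_ge0//.
exact: expR_ge1Dx.
Qed.

End fixed_weight.

(** Dominated convergence; the common Gaussian bound of the weights passes to the
limit. *)
Lemma cvg_laplace a C (w_ : nat -> M -> R) (w q : M -> R) x : 0 < a -> 0 <= C ->
  (forall n, gaussbound a C (w_ n)) -> measurable_fun [set: M] w ->
  (forall y, w_ n y @[n --> \oo] --> w y) -> expgrowth q ->
  laplace (w_ n) q x @[n --> \oo] --> laplace w q x.
Proof.
move=> a0 C0 gw mw ww gq; apply: fine_cvg.
have gq' := expgrowthM gq (expgrowth_expdotp b x).
have gg : gaussbound a C (fun y => C * expR (- a * sqnorm y)).
  split=> [||//]; last by move=> y; rewrite mulr_ge0// expR_ge0.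
  apply: measurable_funM => //; apply: measurableT_comp => //; apply: measurable_funM => //.
  exact: measurable_sqnorm.
have w0 y : 0 <= w y.
  rewrite -(cvg_lim _ (ww y))//; apply: limr_ge; first exact: cvgP (ww y).
  by apply: nearW => n; have [] := gw n.
have wC y : w y <= C * expR (- a * sqnorm y).
  rewrite -(cvg_lim _ (ww y))//; apply: limr_le; first exact: cvgP (ww y).
  by apply: nearW => n; have [] := gw n.
have gw' : gaussbound a C w by [].
have i1 := integrable_laplace x a0 C0 gw' gq.
have i2 := integrable_growth_weight a0 C0 gg (expgrowth_norm gq').
rewrite fineK; last by apply: (integrable_fin_num measurableT i1).
have mi n := integrable_laplace x a0 C0 (gw n) gq.
have [] // := @dominated_convergence _ M R leb setT measurableT
  (fun n y => (q y * expR (b * dotp x y) * w_ n y)%:E)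
  (fun y => (q y * expR (b * dotp x y) * w y)%:E) _ (fun n => measurable_int _ (mi n))
  (measurable_int _ i1) _ i2.
- apply: aeW => y _; apply: cvg_EFin; first by near=> k.
  by apply: cvgM; [exact: cvg_cst|exact: ww].
- apply: aeW => y n _; rewrite lee_fin normrM ler_wpM2l//.
  by have [_ wn0 wnC] := gw n; rewrite ger0_norm.
Unshelve. all: by end_near. Qed.

End laplace.

(** * Roots of densities *)

Section density_facts.
Context {R : realType} {m n : nat}.
Local Notation M := 'M[R]_(m, n).
Local Notation leb := (@lebesgue_mx R m n).
Variable (p : R).
Hypothesis p1 : 1 <= p.
Let p0 : 0 < p. Proof. exact: lt_le_trans p1. Qed.
Implicit Types mu : probability M R.

Lemma measurable_density mu : mu `<< leb -> measurable_fun [set: M] (density mu).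
Proof.
move=> mul; apply: measurableT_comp; first exact: fine_measurable.
by apply: measurable_int; exact: Radon_Nikodym_integrable.
Qed.

Lemma measurable_powR_comp (f : M -> R) r : measurable_fun [set: M] f ->
  measurable_fun [set: M] (fun x => f x `^ r).
Proof. by move=> mf; exact: (@measurableT_comp _ _ _ _ _ _ (@powR R ^~ r)). Qed.

Lemma measurable_root_density mu : mu `<< leb -> measurable_fun [set: M] (root_density p mu).
Proof. by move=> mul; apply: measurable_powR_comp; exact: measurable_density. Qed.

Lemma root_density_ge0 mu x : 0 <= root_density p mu x.
Proof. exact: powR_ge0. Qed.

Lemma powR_invK (t : R) : 0 <= t -> (t `^ p^-1) `^ p = t.
Proof. by move=> t0; rewrite -powRrM mulVf ?gt_eqF// powRr1. Qed.

Lemma powR_Kinv (t : R) : 0 <= t -> (t `^ p) `^ p^-1 = t.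
Proof. by move=> t0; rewrite -powRrM divff ?gt_eqF// powRr1. Qed.

(** The Radon-Nikodym derivative may be negative on a null set; its p-th root
followed by the p-th power is the derivative itself almost everywhere. *)
Lemma root_density_spec mu : mu `<< leb -> forall A, measurable A ->
  mu A = (\int[leb]_(x in A) (root_density p mu x `^ p)%:E)%E.
Proof.
move=> mul A mA; rewrite (Radon_Nikodym_SigmaFinite.f_integral mul mA).
apply: ae_eq_integral => //.
- apply: measurable_funTS.
  exact: (measurable_int _ (Radon_Nikodym_SigmaFinite.f_integrable mul)).
- apply: measurable_funTS; apply/measurable_EFinP; apply: measurable_powR_comp.
  exact: measurable_root_density.
have := ae_eq_Radon_Nikodym_SigmaFinite mul mA.
apply: filterS => x h Ax; have {}h := h Ax.
have f0 := Radon_Nikodym_SigmaFinite.f_ge0 mul x.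
rewrite /root_density /density -h powR_invK ?fine_ge0// fineK//.
exact: Radon_Nikodym_SigmaFinite.f_fin_num.
Qed.

(** Densities are unique up to null sets. *)
Lemma root_density_unique mu (t : M -> R) : measurable_fun [set: M] t -> (forall x, 0 <= t x) ->
  (forall A, measurable A -> mu A = (\int[leb]_(x in A) (t x)%:E)%E) ->
  mu `<< leb /\ {ae leb, forall x, root_density p mu x = t x `^ p^-1}.
Proof.
move=> mt t0 muE.
have mul : mu `<< leb.
  apply/null_content_dominatesP => A mA lA; rewrite muE//.
  by apply: null_set_integral => //; apply/measurable_EFinP; exact: measurable_funTS.
split => //.
have it : leb.-integrable [set: M] (EFin \o t).
  apply/integrableP; split; first exact/measurable_EFinP.
  under eq_integral do rewrite /= ger0_norm//.
  by rewrite -muE// probability_setT ltry.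
have : ae_eq leb setT (Radon_Nikodym (charge_of_finite_measure mu) leb) (EFin \o t).
  apply: integral_ae_eq => //;
    try solve [exact: Radon_Nikodym_integrable | exact: measurable_int it].
  by move=> A _ mA; rewrite -Radon_Nikodym_integral//; exact: muE.
by apply: filterS => x /(_ I) h; rewrite /root_density /density h.
Qed.

End density_facts.

Section product_rows_density.
Context {R : realType} {N d : nat}.
Local Notation X := 'M[R]_(N, d).
Variables (nu : 'I_N -> probability 'rV[R]_d R) (r : 'I_N -> 'rV[R]_d -> R).
Hypotheses (mr : forall j, measurable_fun [set: 'rV[R]_d] (r j)) (r0 : forall j v, 0 <= r j v).
Hypothesis nuE : forall j A, measurable A -> nu j A = (\int[@lebesgue_mx R 1 d]_(v in A) (r j v)%:E)%E.

Lemma measurable_prod_rows (f : 'I_N -> 'rV[R]_d -> R) :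
  (forall j, measurable_fun [set: 'rV[R]_d] (f j)) ->
  measurable_fun [set: X] (fun x => \prod_j f j (row j x)).
Proof.
move=> mf; rewrite /index_enum; elim: (Finite.enum _) => [|i s ih].
  by under eq_fun do rewrite big_nil; exact: measurable_cst.
under eq_fun do rewrite big_cons; apply: measurable_funM => //.
by apply: measurableT_comp => //; exact: measurable_row.
Qed.

Lemma product_rowsE A : measurable A ->
  product_rows nu A = (\int[@lebesgue_mx R N d]_(x in A) (\prod_j r j (row j x))%:E)%E.
Proof.
pose q (x : X) := \prod_j r j (row j x).
have mq : measurable_fun [set: X] q by exact: measurable_prod_rows.
have q0 x : 0 <= q x by apply: prodr_ge0.
move=> mA; apply: (@obox_measure_unique _ _ _ (product_rows nu) (density_measure (@lebesgue_mx R N d) mq q0)) => // a b.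
  rewrite /product_rows /image_measure /pushforward /=.
  rewrite (_ : mx_of_rows @^-1` obox a b = [set t | forall i, obox (row i a) (row i b) (tnth t i)]); last first.
    apply/seteqP; split => t /= h i; last by move=> j; have := h i 0 j; rewrite !mxE.
    by move=> k j; rewrite ord1; have := h i j; rewrite !mxE.
  rewrite (@tuple_product_box _ 'rV[R]_d R _ nu
    (fun i => obox (row i a) (row i b))); last by move=> i; exact: measurable_obox.
  rewrite /density_measure integral_mkcond.
  transitivity (\int[@lebesgue_mx R N d]_x \prod_i (r i (row i x) * \1_(obox (row i a) (row i b)) (row i x))%:E)%E; last first.
    apply: eq_integral => x _; rewrite prodEFin big_split/= /patch.
    case: ifPn => [xab|xab].
      rewrite [X in _ * X]big1 ?mulr1// => i _; rewrite indicE mem_set//.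
      by move: xab; rewrite inE obox_rows; exact.
    congr EFin; have [i /negP xi] : exists i, ~~ (row i x \in obox (row i a) (row i b)).
      apply: contrapT => h; move/negP: xab; apply; rewrite inE obox_rows => i.
      by apply/set_mem; apply: contrapT => /negP xi; apply: h; exists i.
    by rewrite [X in _ * X](bigD1 i)//= indicE (negbTE (introN idP xi)) mul0r mulr0.
  rewrite (@lebesgue_prod_rows R N d (fun i v => (r i v * \1_(obox (row i a) (row i b)) v)%:E)).
  - apply: eq_bigr => i _; etransitivity; first exact: (nuE i (measurable_obox _ _)).
    rewrite integral_mkcond; apply: eq_integral => v _; rewrite /patch indicE.
    by case: ifPn; rewrite ?mulr1 ?mulr0.
  - move=> i; apply/measurable_EFinP; apply: measurable_funM => //.
    by apply: measurable_indic; exact: measurable_obox.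
  - by move=> i v; rewrite lee_fin mulr_ge0.
rewrite /product_rows /image_measure /pushforward /=.
rewrite (_ : mx_of_rows @^-1` obox a b = [set t | forall i, obox (row i a) (row i b) (tnth t i)]); last first.
  apply/seteqP; split => t /= h i; last by move=> j; have := h i 0 j; rewrite !mxE.
  by move=> k j; rewrite ord1; have := h i j; rewrite !mxE.
rewrite (@tuple_product_box _ 'rV[R]_d R _ nu
    (fun i => obox (row i a) (row i b))); last by move=> i; exact: measurable_obox.
have nf i : nu i (obox (row i a) (row i b)) \is a fin_num.
  by apply: fin_num_measure; exact: measurable_obox.
have : (\prod_i nu i (obox (row i a) (row i b)))%E \is a fin_num.
  by apply: prode_fin_num => i _; exact: nf.
by rewrite fin_numElt => /andP[].
Qed.

End product_rows_density.

(** * Gaussian decay of the weight *)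

Section smooth_sum.
Context {R : realType} {m n : nat}.
Local Notation M := 'M[R]_(m, n).

Lemma smooth_alg_sum (I : finType) (F : I -> M -> R) :
  (forall i, smooth_alg (F i)) -> smooth_alg (fun x => \sum_i F i x).
Proof.
move=> sF; rewrite /index_enum; elim: (Finite.enum I) => [|i s ih].
  by under eq_fun do rewrite big_nil; exact: smooth_alg_cst.
by under eq_fun do rewrite big_cons; exact: smooth_alg_add.
Qed.

Lemma smooth_alg_sqnorm (y : M) : smooth_alg (fun x => sqnorm (y - x)).
Proof.
apply: smooth_alg_sum => i; apply: smooth_alg_sum => j.
have -> : (fun x : M => (y - x) i j ^+ 2) = fun x => (y i j + -1 * x i j) * (y i j + -1 * x i j).
  by apply/funext => x; rewrite !mxE expr2 mulN1r.
have h : smooth_alg (fun x : M => y i j + -1 * x i j).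
  apply: smooth_alg_add; first exact: smooth_alg_cst.
  by apply: smooth_alg_mul; [exact: smooth_alg_cst|exact: smooth_alg_coord].
exact: smooth_alg_mul.
Qed.

Lemma smooth_alg_gauss (y : M) (a : R) : smooth_alg (fun x => expR (a * sqnorm (y - x))).
Proof.
apply: smooth_alg_exp; apply: smooth_alg_mul; [exact: smooth_alg_cst|exact: smooth_alg_sqnorm].
Qed.

Lemma sqnormN (x : M) : sqnorm (- x) = sqnorm x.
Proof. by apply: eq_bigr => i _; apply: eq_bigr => j _; rewrite mxE sqrrN. Qed.

Lemma sqnormB (y x : M) : sqnorm (y - x) = sqnorm y + sqnorm x - 2 * dotp x y.
Proof.
rewrite /sqnorm /dotp mulr_sumr -big_split/= -sumrB; apply: eq_bigr => i _.
rewrite mulr_sumr -big_split/= -sumrB; apply: eq_bigr => j _; rewrite !mxE/=; ring.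
Qed.

(** Young's inequality 2 |y| |x| <= |y|^2 / k + k |x|^2. *)
Lemma sqnormB_le (y x : M) (k : R) : 0 < k ->
  sqnorm (y - x) <= (1 + k^-1) * sqnorm y + (1 + k) * sqnorm x.
Proof.
move=> k0; rewrite /sqnorm !mulr_sumr -big_split; apply: ler_sum => i _ /=.
rewrite !mulr_sumr -big_split; apply: ler_sum => j _ /=; rewrite !mxE -subr_ge0.
rewrite (_ : _ - _ = (y i j + k * x i j) ^+ 2 / k); last by field; exact: lt0r_neq0.
by rewrite divr_ge0 ?sqr_ge0// ltW.
Qed.

End smooth_sum.

(** The arithmetic of [tweight_gaussbound]: L stands for Lambda(y), P for the product
of the convolutions, E, F and G for the exponentials of - |y|^2 / (2 eps),
- |y|^2 / (2 eps N^2) and - (1 + 1/N) |y|^2 / (2 eps). The N-th power of the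
weight contains P^-N; one factor P cancels L^N, and the remaining N - 1 are
bounded from below by Gaussians, which leaves F^N because
N = 1/N + (1 + 1/N) (N - 1). *)
Lemma tweight_arith (R : realType) (N : nat) (c z L P E F G : R) : (0 < N)%N ->
  0 < c -> 0 < z -> 0 < L -> 0 < P -> 0 <= E -> 0 <= F -> 0 <= G ->
  (z * c) ^+ N * G <= P -> L ^+ N <= c ^+ (N.-1 * N) * P -> F ^+ N * G ^+ N.-1 = E ^+ N ->
  (c ^+ N * E * L / P) ^+ N <= c ^+ (N * N) * z ^- (N * N.-1) * F ^+ N.
Proof.
move=> N0 c0 z0 L0 P0 E0 F0 G0 hP hL hE.
rewrite [leLHS](_ : _ = c ^+ (N * N) * E ^+ N * L ^+ N / P ^+ N); last first.
  by rewrite !exprMn exprVn -exprM.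
rewrite ler_pdivrMr ?exprn_gt0//.
apply: (@le_trans _ _ (c ^+ (N * N) * E ^+ N * (c ^+ (N.-1 * N) * P))).
  by rewrite ler_wpM2l// mulr_ge0 ?exprn_ge0// ltW.
have -> : P ^+ N = P ^+ N.-1 * P by rewrite -exprSr prednK.
rewrite !mulrA ler_pM2r// -hE.
apply: (@le_trans _ _ (c ^+ (N * N) * z ^- (N * N.-1) * F ^+ N * ((z * c) ^+ N * G) ^+ N.-1)); last first.
  rewrite ler_wpM2l ?mulr_ge0 ?exprn_ge0 ?invr_ge0 ?exprn_ge0 ?(ltW c0) ?(ltW z0)//.
  by rewrite lerXn2r ?nnegrE ?(ltW P0)// mulr_ge0// exprn_ge0// mulr_ge0 ?ltW.
rewrite (exprMn N.-1) -exprM exprMn (mulnC N.-1).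
rewrite [leRHS](_ : _ = c ^+ (N * N) * (F ^+ N * G ^+ N.-1) * c ^+ (N * N.-1) *
  (z ^- (N * N.-1) * z ^+ (N * N.-1))); last by ring.
by rewrite mulVf ?mulr1// expf_neq0// gt_eqF.
Qed.

Section smoothing.
Context {R : realType} {N d : nat}.
Local Notation X := 'M[R]_(N, d).
Local Notation leb := (@lebesgue_mx R N d).
Local Notation eta := Defs.eta.
Variable eps : R.
Hypothesis e0 : 0 < eps.
Implicit Types (mu : probability X R) (nu : probability 'rV[R]_d R).
Local Notation c := (eta eps (0 : 'rV[R]_d)).

Let c0 : 0 < c. Proof. exact: eta0_gt0. Qed.

Lemma smoothing_kernelE (y x : X) :
  smoothing_kernel eps y x = c ^+ N * expR (- (2 * eps)^-1 * sqnorm (y - x)).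
Proof.
rewrite /smoothing_kernel (eq_bigr (fun k => c * expR (- (2 * eps)^-1 * sqnorm (row k (y - x))))).
  by rewrite big_split/= prodr_const card_ord -expR_sum -mulr_sumr -sqnorm_rows.
move=> k _; rewrite etaE -linearB/=; congr (_ * expR _).
by rewrite !mulNr mulrC.
Qed.

(** Expanding the square separates the variables, except for the factor of a Laplace
transform. *)
Lemma smoothing_kernelE' (y x : X) :
  smoothing_kernel eps y x = c ^+ N * expR (- (2 * eps)^-1 * sqnorm y) *
    expR (- (2 * eps)^-1 * sqnorm x) * expR (eps^-1 * dotp x y).
Proof.
rewrite smoothing_kernelE sqnormB -!mulrA -!expRD; congr (_ * expR _).
by field; exact: lt0r_neq0.
Qed.

Lemma smoothing_kernel_gt0 (y x : X) : 0 < smoothing_kernel eps y x.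
Proof. by rewrite smoothing_kernelE mulr_gt0 ?exprn_gt0 ?expR_gt0. Qed.

Lemma smoothing_kernel_le (y x : X) : smoothing_kernel eps y x <= c ^+ N.
Proof.
rewrite smoothing_kernelE ler_piMr ?exprn_ge0 ?(ltW c0)//.
by rewrite -[leRHS]expR0 ler_expR mulNr oppr_le0 mulr_ge0 ?sqnorm_ge0// invr_ge0 mulr_ge0// ltW.
Qed.

Lemma Cb_smoothing_kernel (y : X) : Cb (smoothing_kernel eps y).
Proof.
split.
  have -> : smoothing_kernel eps y = (fun x => c ^+ N * expR (- (2 * eps)^-1 * sqnorm (y - x))).
    by apply/funext => x; exact: smoothing_kernelE.
  apply: smooth_continuous; apply: smooth_algP; apply: smooth_alg_mul.
    exact: smooth_alg_cst.
  exact: smooth_alg_gauss.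
by exists (c ^+ N) => x; rewrite ger0_norm ?smoothing_kernel_ge0// smoothing_kernel_le.
Qed.

Lemma integrable_bounded d' (T : measurableType d') (P : probability T R) (f : T -> R) C :
  measurable_fun [set: T] f -> (forall x, `|f x| <= C) -> P.-integrable [set: T] (EFin \o f).
Proof.
move=> mf fC; apply: (@le_integrable _ _ _ _ _ measurableT _ (cst C%:E)).
- exact/measurable_EFinP.
- by move=> x _ /=; rewrite lee_fin (le_trans (fC x))// ler_norm.
- exact: finite_measure_integrable_cst.
Qed.

Lemma probability_integral_gt0 d' (T : measurableType d') (P : probability T R) (f : T -> R) :
  measurable_fun [set: T] f -> (forall x, 0 < f x) -> (0 < \int[P]_x (f x)%:E)%E.
Proof.
move=> mf f0; apply: integral_gt0 => //; apply/eqP => h.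
have : 1%:E = 0%:E :> \bar R := etrans (esym (probability_setT P)) h.
by move=> [] /eqP; rewrite oner_eq0.
Qed.

(** The density of Lambda^eps[mu] as a real function. *)
Definition Lam mu (y : X) : R := \int[mu]_x smoothing_kernel eps y x.

Lemma integrable_smoothing_kernel mu y :
  mu.-integrable [set: X] (EFin \o smoothing_kernel eps y).
Proof.
have [cs [C hC]] := Cb_smoothing_kernel y.
by apply: (@integrable_bounded _ _ _ _ C) => //; exact: measurable_continuous.
Qed.

Lemma Lambda_densityE mu y : Lambda_density eps mu y = (Lam mu y)%:E.
Proof.
by rewrite /Lam /Rintegral fineK//; apply: integrable_fin_num => //; exact: integrable_smoothing_kernel.
Qed.

Lemma measurable_Lam mu : measurable_fun [set: X] (Lam mu).
Proof.
apply: measurableT_comp; first exact: fine_measurable.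
exact: measurable_Lambda_density.
Qed.

Lemma Lam_gt0 mu y : 0 < Lam mu y.
Proof.
have [cs _] := Cb_smoothing_kernel y.
have := probability_integral_gt0 mu (measurable_continuous cs) (smoothing_kernel_gt0 y).
by rewrite -/(Lambda_density eps mu y) Lambda_densityE lte_fin.
Qed.

Lemma Cb_eta (v : 'rV[R]_d) : Cb (fun w => eta eps (v - w)).
Proof.
split.
  have -> : (fun w => eta eps (v - w)) = (fun w => c * expR (- (2 * eps)^-1 * sqnorm (v - w))).
    by apply/funext => w; rewrite etaE !mulNr [X in expR (- X)]mulrC.
  apply: smooth_continuous; apply: smooth_algP; apply: smooth_alg_mul.
    exact: smooth_alg_cst.
  exact: smooth_alg_gauss.
by exists c => w; rewrite ger0_norm ?eta_ge0// eta_le0.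
Qed.

Lemma integrable_eta nu (v : 'rV[R]_d) : nu.-integrable [set: _] (EFin \o (fun w => eta eps (v - w))).
Proof.
have [cs [C hC]] := Cb_eta v.
by apply: (@integrable_bounded _ _ _ _ C) => //; exact: measurable_continuous.
Qed.

Lemma convolutionE nu (v : 'rV[R]_d) :
  (\int[nu]_w (eta eps (v - w))%:E = (convolution eps nu v)%:E)%E.
Proof.
rewrite /convolution /Rintegral fineK//; apply: integrable_fin_num => //; exact: integrable_eta.
Qed.

Lemma convolution_gt0 nu (v : 'rV[R]_d) : 0 < convolution eps nu v.
Proof.
have [cs _] := Cb_eta v.
have := probability_integral_gt0 nu (measurable_continuous cs) (fun w => eta_gt0 (v - w) e0).
by rewrite convolutionE lte_fin.
Qed.

Lemma measurable_etaB : measurable_fun [set: 'rV[R]_d * 'rV[R]_d] (fun vw => eta eps (vw.1 - vw.2)).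
Proof.
apply: measurableT_comp; first exact: measurable_eta.
apply: measurable_fun_mxP => i j; under eq_fun do rewrite !mxE.
apply: measurable_funB.
- exact: (measurableT_comp (measurable_mx_coord i j) measurable_fst).
- exact: (measurableT_comp (measurable_mx_coord i j) measurable_snd).
Qed.

Lemma measurable_convolution nu : measurable_fun [set: 'rV[R]_d] (convolution eps nu).
Proof.
apply: measurableT_comp; first exact: fine_measurable.
apply: (measurable_fun_fubini_tonelli_F (m2 := nu)
  (fun vw : 'rV[R]_d * 'rV[R]_d => (eta eps (vw.1 - vw.2))%:E)).
- by apply/measurable_EFinP; exact: measurable_etaB.
- by move=> yx; rewrite lee_fin eta_ge0.
Qed.

Lemma integral_marginal mu k (f : 'rV[R]_d -> \bar R) : measurable_fun [set: _] f ->
  (forall v, 0 <= f v)%E -> (\int[marginal k mu]_v f v = \int[mu]_x f (row k x))%E.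
Proof. by move=> mf f0; exact: (ge0_integral_distribution _ mf f0). Qed.

(** All factors eta but the k-th are at most eta(0). *)
Lemma Lam_le mu y k : Lam mu y <= c ^+ N.-1 * convolution eps (marginal k mu) (row k y).
Proof.
rewrite -lee_fin -Lambda_densityE EFinM -convolutionE integral_marginal; last 2 first.
- have [cs _] := Cb_eta (row k y); apply/measurable_EFinP; exact: measurable_continuous.
- by move=> v; rewrite lee_fin eta_ge0.
have mk : measurable_fun [set: X] (fun x => (eta eps (row k y - row k x))%:E).
  apply/measurable_EFinP.
  have [cs _] := Cb_eta (row k y).
  by apply: (measurableT_comp (measurable_continuous cs)); exact: measurable_row.
rewrite -ge0_integralZl//; try solve [by move=> x _; rewrite lee_fin eta_ge0
  | by rewrite lee_fin exprn_ge0// ltW].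
apply: ge0_le_integral => //.
- by move=> x _; rewrite lee_fin smoothing_kernel_ge0.
- have [cs _] := Cb_smoothing_kernel y; apply/measurable_EFinP; exact: measurable_continuous.
- exact: emeasurable_funM.
move=> x _; rewrite -EFinM lee_fin /smoothing_kernel (bigD1 k)//= mulrC ler_wpM2r ?eta_ge0//.
have -> : c ^+ N.-1 = \prod_(i < N | i != k) c.
  by rewrite prodr_const; congr (_ ^+ _); rewrite cardC1 card_ord.
by apply: ler_prod => i _; rewrite eta_ge0 eta_le0.
Qed.

(** The part of the lower bound in [convolution_ge] that depends on the measure.
Being the integral of a bounded continuous function it is continuous under weak
convergence, which makes the bound uniform along a sequence. *)
Definition gaussmass nu : R := \int[nu]_w expR (- ((1 + N%:R) / (2 * eps)) * sqnorm w).

Lemma Cb_gaussmass : Cb (fun w : 'rV[R]_d => expR (- ((1 + N%:R) / (2 * eps)) * sqnorm w)).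
Proof.
split.
  have -> : (fun w : 'rV[R]_d => expR (- ((1 + N%:R) / (2 * eps)) * sqnorm w)) =
    (fun w => expR (- ((1 + N%:R) / (2 * eps)) * sqnorm (0 - w))).
    by apply/funext => w; rewrite sub0r sqnormN.
  by apply: smooth_continuous; apply: smooth_algP; exact: smooth_alg_gauss.
exists 1 => w; rewrite ger0_norm ?expR_ge0// -[leRHS]expR0 ler_expR mulNr oppr_le0.
by rewrite mulr_ge0 ?sqnorm_ge0// divr_ge0 ?addr_ge0// mulr_ge0// ltW.
Qed.

Lemma integrable_gaussmass nu : nu.-integrable [set: _]
  (EFin \o (fun w : 'rV[R]_d => expR (- ((1 + N%:R) / (2 * eps)) * sqnorm w))).
Proof.
have [cs [C hC]] := Cb_gaussmass.
by apply: (@integrable_bounded _ _ _ _ C) => //; exact: measurable_continuous.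
Qed.

Lemma gaussmass_gt0 nu : 0 < gaussmass nu.
Proof.
have [cs _] := Cb_gaussmass.
have := probability_integral_gt0 nu (measurable_continuous cs) (fun w => expR_gt0 _).
rewrite -[X in (_ < X)%E]fineK ?lte_fin//.
by apply: integrable_fin_num => //; exact: integrable_gaussmass.
Qed.

(** Young's inequality with parameter N: the loss 1/N in the Gaussian is small enough
for the N - 1 convolutions left in [tweight_arith]. *)
Lemma convolution_ge nu (v : 'rV[R]_d) : (0 < N)%N ->
  c * expR (- ((1 + N%:R^-1) / (2 * eps)) * sqnorm v) * gaussmass nu <= convolution eps nu v.
Proof.
move=> N0; rewrite /gaussmass -RintegralZl//; last exact: integrable_gaussmass.
apply: le_Rintegral => //.
- exact: (integrableZl measurableT (c * expR (- ((1 + N%:R^-1) / (2 * eps)) * sqnorm v)) (integrable_gaussmass nu)).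
- exact: integrable_eta.
move=> w _; rewrite [leRHS]etaE -mulrA -expRD ler_pM2l// ler_expR.
have := @sqnormB_le R 1 d v w N%:R _; rewrite ltr0n => /(_ N0) h.
have e20 : 0 < 2 * eps by rewrite mulr_gt0.
rewrite (_ : _ + _ = - ((1 + N%:R^-1) * sqnorm v + (1 + N%:R) * sqnorm w) / (2 * eps)).
  by rewrite ler_pM2r ?invr_gt0// lerN2.
by field; rewrite pnatr_eq0 -lt0n N0 lt0r_neq0.
Qed.

Definition Pprod mu (y : X) : R := \prod_k convolution eps (marginal k mu) (row k y).

Lemma Pprod_gt0 mu y : 0 < Pprod mu y.
Proof. by apply: prodr_gt0 => k _; exact: convolution_gt0. Qed.

Lemma measurable_Pprod mu : measurable_fun [set: X] (Pprod mu).
Proof. by apply: (measurable_prod_rows (f := fun k => convolution eps (marginal k mu))) => k; exact: measurable_convolution. Qed.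

(** The part of the integrand of H that does not depend on x: H is a Gaussian times the
Laplace transform of this weight. *)
Definition tweight mu (y : X) : R :=
  c ^+ N * expR (- (2 * eps)^-1 * sqnorm y) * Lam mu y / Pprod mu y.

Lemma tweight_gt0 mu y : 0 < tweight mu y.
Proof. by rewrite divr_gt0 ?Pprod_gt0// !mulr_gt0 ?exprn_gt0 ?expR_gt0 ?Lam_gt0. Qed.

Lemma measurable_tweight mu : measurable_fun [set: X] (tweight mu).
Proof.
apply: measurable_funM; last first.
  have -> : (fun y => (Pprod mu y)^-1) = (fun y => Pprod mu y `^ (-1)).
    by apply/funext => y; rewrite powR_inv1// ltW// Pprod_gt0.
  apply: (@measurableT_comp _ _ _ _ _ _ (@powR R ^~ (-1))) => //.
  exact: measurable_Pprod.
apply: measurable_funM; last exact: measurable_Lam.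
apply: measurable_funM => //; apply: measurableT_comp => //; apply: measurable_funM => //.
exact: measurable_sqnorm.
Qed.

(** It is enough to bound the N-th power, because multiplying the inequalities
[Lam_le] for all k bounds the N-th power of Lambda by the product of the
convolutions. *)
Lemma tweight_gaussbound mu z : (0 < N)%N -> 0 < z -> (forall k, z <= gaussmass (marginal k mu)) ->
  gaussbound (2 * eps * N%:R ^+ 2)^-1 (1 + c ^+ (N * N) * z ^- (N * N.-1)) (tweight mu).
Proof.
move=> N0 z0 zZ; split; [exact: measurable_tweight|by move=> y; rewrite ltW// tweight_gt0|].
move=> y; set C1 := _ * z ^- _; set a := (2 * eps * N%:R ^+ 2)^-1.
have NR : (N%:R : R) != 0 by rewrite pnatr_eq0 -lt0n.
have en : eps != 0 by rewrite gt_eqF.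
have C10 : 0 < C1 by rewrite mulr_gt0 ?exprn_gt0// invr_gt0 exprn_gt0.
have hP : forall k, z * c * expR (- ((1 + N%:R^-1) / (2 * eps)) * sqnorm (row k y)) <=
    convolution eps (marginal k mu) (row k y).
  move=> k; apply: le_trans (convolution_ge _ _ N0).
  rewrite [leLHS](_ : _ = c * expR (- ((1 + N%:R^-1) / (2 * eps)) * sqnorm (row k y)) * z); last by ring.
  by rewrite ler_wpM2l// mulr_ge0 ?expR_ge0// ltW.
have hPp : (z * c) ^+ N * expR (- ((1 + N%:R^-1) / (2 * eps)) * sqnorm y) <= Pprod mu y.
  rewrite sqnorm_rows mulr_sumr expR_sum.
  have -> : (z * c) ^+ N = \prod_(k < N) (z * c) by rewrite prodr_const card_ord.
  rewrite -big_split/=; apply: ler_prod => k _; rewrite hP andbT.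
  by apply: mulr_ge0; [apply: mulr_ge0; exact: ltW|exact: expR_ge0].
have hL : Lam mu y ^+ N <= c ^+ (N.-1 * N) * Pprod mu y.
  have -> : Lam mu y ^+ N = \prod_(k < N) Lam mu y by rewrite prodr_const card_ord.
  have -> : c ^+ (N.-1 * N) = \prod_(k < N) c ^+ N.-1 by rewrite prodr_const card_ord exprM.
  rewrite -big_split/=; apply: ler_prod => k _.
  by rewrite (ltW (Lam_gt0 _ _)) Lam_le.
have P0 := Pprod_gt0 mu y.
set E := expR (- (2 * eps)^-1 * sqnorm y).
have key : tweight mu y ^+ N <= C1 * expR (- a * sqnorm y) ^+ N.
  apply: (tweight_arith N0 c0 z0 (Lam_gt0 mu y) P0 (expR_ge0 _) (expR_ge0 _) (expR_ge0 _) hPp hL).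
  rewrite /E -!expRM_natl -expRD; congr expR.
  rewrite /a -[N.-1]subn1 natrB//; field.
  by rewrite NR en.
(* Replacing C1 by the N-th power of 1 + C1 avoids extracting an N-th root of it. *)
have C11 : C1 <= (1 + C1) ^+ N.
  rewrite (le_trans (_ : C1 <= 1 + C1)) ?lerDr//.
  by rewrite -[leLHS]expr1 ler_weXn2l// lerDl ltW.
rewrite -(@ler_pXn2r _ N)// ?nnegrE ?(ltW (tweight_gt0 _ _))//; last first.
  by rewrite mulr_ge0 ?expR_ge0// addr_ge0// ltW.
by rewrite [leRHS]exprMn (le_trans key)// ler_wpM2r// exprn_ge0// expR_ge0.
Qed.

End smoothing.

(** * The factor H and the mass formula *)

Section sections.
Context d1 d2 d3 (T1 : measurableType d1) (T2 : measurableType d2) (U : measurableType d3).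
Variable f : T1 * T2 -> U.
Hypothesis mf : measurable_fun [set: T1 * T2] f.

Lemma measurable_xsec x : measurable_fun [set: T2] (fun y => f (x, y)).
Proof. by apply: (measurableT_comp mf); exact: measurable_pair1. Qed.

Lemma measurable_ysec y : measurable_fun [set: T1] (fun x => f (x, y)).
Proof. by apply: (measurableT_comp mf); exact: measurable_pair2. Qed.

End sections.

Section theta_mass.
Context {R : realType} {N d : nat}.
Local Notation X := 'M[R]_(N, d).
Local Notation V := 'rV[R]_d.
Local Notation leb m n := (@lebesgue_mx R m n).
Local Notation eta := Defs.eta.
Variable eps : R.
Hypothesis e0 : 0 < eps.
Hypothesis N0 : (0 < N)%N.
Implicit Types (mu : probability X R).

Lemma dotpC (x y : X) : dotp x y = dotp y x.
Proof. by apply: eq_bigr => i _; apply: eq_bigr => j _; rewrite mulrC. Qed.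

Lemma dotpNl (x y : X) : dotp (- x) y = - dotp x y.
Proof. by rewrite -scaleN1r dotpZl mulN1r. Qed.

Lemma measurable_eta_sub d' (T : measurableType d') (f g : T -> V) :
  measurable_fun [set: T] f -> measurable_fun [set: T] g ->
  measurable_fun [set: T] (fun t => eta eps (f t - g t)).
Proof.
move=> mf mg; apply: measurableT_comp; first exact: measurable_eta.
apply: measurable_fun_mxP => i j; under eq_fun do rewrite !mxE.
by apply: measurable_funB; [exact: (measurableT_comp (measurable_mx_coord i j) mf)
  |exact: (measurableT_comp (measurable_mx_coord i j) mg)].
Qed.

Lemma measurable_row_comp d' (T : measurableType d') (f : T -> X) j :
  measurable_fun [set: T] f -> measurable_fun [set: T] (fun t => row j (f t) : V).
Proof. by move=> mf; exact: (measurableT_comp (measurable_row j) mf). Qed.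

Lemma measurable_prod_fun d' (T : measurableType d') (f : 'I_N -> T -> R) :
  (forall j, measurable_fun [set: T] (f j)) ->
  measurable_fun [set: T] (fun x => \prod_j f j x).
Proof.
move=> mf; rewrite /index_enum; elim: (Finite.enum _) => [|i s ih].
  by under eq_fun do rewrite big_nil; exact: measurable_cst.
by under eq_fun do rewrite big_cons; apply: measurable_funM.
Qed.

Lemma measurable_convolution_inv nu :
  measurable_fun [set: V] (fun v => (convolution eps nu v)^-1).
Proof.
have -> : (fun v => (convolution eps nu v)^-1) = (fun v => convolution eps nu v `^ (-1)).
  by apply/funext => y; rewrite powR_inv1// ltW// convolution_gt0.
apply: (@measurableT_comp _ _ _ _ _ _ (@powR R ^~ (-1))) => //.
exact: measurable_convolution.
Qed.

Lemma integral_eta_translate (w : V) : (\int[leb 1 d]_v (eta eps (v - w))%:E = 1)%E.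
Proof.
rewrite -(@integral_eta R d eps e0).
apply: (@lebesgue_translation R 1 d w (fun v => (eta eps v)%:E)).
  by apply/measurable_EFinP; exact: measurable_eta.
by move=> x; rewrite lee_fin eta_ge0.
Qed.

(** The k-th marginal of Lambda^eps[mu] is mu_k * eta. *)
Lemma Lam_marginal mu k (b : V -> \bar R) : measurable_fun [set: V] b -> (forall v, 0 <= b v)%E ->
  (\int[leb N d]_y ((Lam eps mu y)%:E * b (row k y)) =
   \int[leb 1 d]_v ((convolution eps (marginal k mu) v)%:E * b v))%E.
Proof.
move=> mb b0.
have msk : measurable_fun [set: X * X] (fun yx => (smoothing_kernel eps yx.1 yx.2)%:E).
  by apply/measurable_EFinP; exact: measurable_smoothing_kernel.
have mbr : measurable_fun [set: X] (fun y => b (row k y)).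
  by apply: measurableT_comp => //; exact: measurable_row.
transitivity (\int[leb N d]_y \int[mu]_x ((smoothing_kernel eps y x)%:E * b (row k y)))%E.
  apply: eq_integral => y _; rewrite -Lambda_densityE// /Lambda_density -ge0_integralZr//.
  - exact: (measurable_xsec msk y).
  - by move=> x _; rewrite lee_fin smoothing_kernel_ge0.
rewrite (fubini_tonelli (fun yx : X * X => (smoothing_kernel eps yx.1 yx.2)%:E * b (row k yx.1))%E); last 2 first.
- apply: emeasurable_funM => //; apply: (measurableT_comp mbr); exact: measurable_fst.
- by move=> yx; rewrite mule_ge0// lee_fin smoothing_kernel_ge0.
transitivity (\int[mu]_x \int[leb 1 d]_v ((eta eps (v - row k x))%:E * b v))%E.
  apply: eq_integral => x _ /=.
  pose a j (v : V) : \bar R := ((eta eps (v - row j x))%:E * (if j == k then b v else 1))%E.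
  transitivity (\int[leb N d]_y \prod_j a j (row j y))%E.
    apply: eq_integral => y _; rewrite /smoothing_kernel -prodEFin big_split/=.
    by rewrite -big_mkcond big_pred1_eq.
  rewrite lebesgue_prod_rows.
  - rewrite (bigD1 k)//= big1 ?mule1.
      by apply: eq_integral => v _; rewrite /a eqxx.
    move=> j jk; under eq_integral do rewrite /a (negbTE jk) mule1.
    exact: integral_eta_translate.
  - move=> j; rewrite /a; apply: emeasurable_funM; last by case: (j == k).
    by apply/measurable_EFinP; apply: measurable_eta_sub.
  - move=> j v; rewrite mule_ge0 ?lee_fin ?eta_ge0//; case: ifP => // _; exact: lee01.
rewrite (fubini_tonelli (fun xv : X * V => (eta eps (xv.2 - row k xv.1))%:E * b xv.2)%E); last 2 first.
- apply: emeasurable_funM; last by apply: (measurableT_comp mb); exact: measurable_snd.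
  apply/measurable_EFinP; apply: measurable_eta_sub => //.
  by apply: measurable_row_comp; exact: measurable_fst.
- by move=> xv; rewrite mule_ge0// lee_fin eta_ge0.
apply: eq_integral => v _ /=.
have mk : measurable_fun [set: V] (fun w => (eta eps (v - w))%:E).
  by apply/measurable_EFinP; apply: measurable_eta_sub.
rewrite ge0_integralZr//; try solve [by move=> x _; rewrite lee_fin eta_ge0
  | by apply/measurable_EFinP; apply: measurable_eta_sub => //; exact: measurable_row].
congr (_ * _)%E; rewrite -convolutionE// integral_marginal// => w.
by rewrite lee_fin eta_ge0.
Qed.

(** The conditional density of x given y, with respect to the product of the
marginals. *)
Definition theta_kernel mu (y x : X) : R :=
  \prod_k (eta eps (row k y - row k x) / convolution eps (marginal k mu) (row k y)).

Lemma theta_kernel_ge0 mu y x : 0 <= theta_kernel mu y x.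
Proof.
apply: prodr_ge0 => k _; rewrite mulr_ge0 ?eta_ge0// invr_ge0 ltW//.
exact: convolution_gt0.
Qed.

Lemma measurable_theta_kernel mu : measurable_fun [set: X * X] (fun yx => theta_kernel mu yx.1 yx.2).
Proof.
apply: measurable_prod_fun => k; apply: measurable_funM.
  by apply: measurable_eta_sub; apply: measurable_row_comp.
apply: (measurableT_comp (measurable_convolution_inv _)).
by apply: measurable_row_comp.
Qed.

(** The factor H in the density H(x) prod_j r_j(x_j) of Theta; see [HfunE] for its
expression as an integral of [theta_kernel]. *)
Definition Hfun mu (x : X) : R :=
  expR (- (2 * eps)^-1 * sqnorm x) * laplace eps^-1 (tweight eps mu) (cst 1) x.

(** A minimum of finitely many positive numbers is positive. *)
Lemma ex_common_lb (I : finType) (P : I -> R -> Prop) :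
  (forall i z z', 0 < z' -> z' <= z -> P i z -> P i z') ->
  (forall i, exists2 z, 0 < z & P i z) -> exists2 z, 0 < z & forall i, P i z.
Proof.
move=> dn ex.
have /choice[f fP] : forall i, exists z, 0 < z /\ P i z.
  by move=> i; have [z z0 Pz] := ex i; exists z.
exists (\big[Num.min/1]_i f i).
  by apply/bigmin_gtP; split => // i _; have [] := fP i.
move=> i; have [_] := fP i; apply: dn; last exact: bigmin_le.
by apply/bigmin_gtP; split => // j _; have [] := fP j.
Qed.

Lemma tweight_gaussbound1 mu : exists2 C, 0 <= C & gaussbound (2 * eps * N%:R ^+ 2)^-1 C (tweight eps mu).
Proof.
have [||z z0 hz] := @ex_common_lb 'I_N (fun k z => z <= @gaussmass R N d eps (marginal k mu)).
- by move=> i z z' _ h; apply: le_trans.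
- by move=> k; exists (@gaussmass R N d eps (marginal k mu)) => //; exact: gaussmass_gt0.
eexists; last exact: (tweight_gaussbound e0 N0 z0 hz).
by rewrite addr_ge0// mulr_ge0 ?exprn_ge0 ?eta_ge0// invr_ge0 exprn_ge0// ltW.
Qed.

Let a0 : 0 < (2 * eps * N%:R ^+ 2)^-1.
Proof.
rewrite invr_gt0; apply: mulr_gt0; first exact: mulr_gt0.
by rewrite exprn_gt0// ltr0n.
Qed.

Lemma Lam_theta_kernelE mu y x : Lam eps mu y * theta_kernel mu y x =
  expR (- (2 * eps)^-1 * sqnorm x) * (cst 1 y * expR (eps^-1 * dotp x y) * tweight eps mu y).
Proof.
rewrite /theta_kernel big_split/= -/(smoothing_kernel eps y x) smoothing_kernelE'//.
rewrite /tweight /cst -/(Pprod _ _ _) prodfV -/(Pprod eps mu y); ring.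
Qed.

Lemma HfunE mu x : (\int[leb N d]_y (Lam eps mu y * theta_kernel mu y x)%:E = (Hfun mu x)%:E)%E.
Proof.
have [C C0 hC] := tweight_gaussbound1 mu.
have il := integrable_laplace eps^-1 x a0 C0 hC (expgrowth_cst 1).
rewrite /Hfun /laplace -RintegralZl// /Rintegral fineK.
  by apply: eq_integral => y _; rewrite Lam_theta_kernelE.
apply: integrable_fin_num => //.
exact: (integrableZl measurableT (expR (- (2 * eps)^-1 * sqnorm x)) il).
Qed.

Lemma Hfun_gt0 mu x : 0 < Hfun mu x.
Proof.
have [C C0 hC] := tweight_gaussbound1 mu.
rewrite mulr_gt0 ?expR_gt0//; apply: (laplace_gt0 eps^-1 a0 C0 hC).
by move=> y; exact: tweight_gt0.
Qed.

Lemma smooth_alg_Hfun mu : smooth_alg (Hfun mu).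
Proof.
have [C C0 hC] := tweight_gaussbound1 mu.
apply: smooth_alg_mul.
  have -> : (fun x : X => expR (- (2 * eps)^-1 * sqnorm x)) =
      (fun x => expR (- (2 * eps)^-1 * sqnorm (0 - x))).
    by apply/funext => x; rewrite sub0r sqnormN.
  exact: smooth_alg_gauss.
apply: smooth_alg_smooth; exact: (smooth_laplace eps^-1 a0 C0 hC (expgrowth_cst 1)).
Qed.

Lemma measurable_Hfun mu : measurable_fun [set: X] (Hfun mu).
Proof. by apply: measurable_continuous; apply: smooth_continuous; apply: smooth_algP; exact: smooth_alg_Hfun. Qed.

Lemma derive_Hfun mu x v : 'D_v (Hfun mu) x = expR (- (2 * eps)^-1 * sqnorm x) *
  (laplace eps^-1 (tweight eps mu) (fun y => eps^-1 * dotp v y) x -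
   eps^-1 * dotp v x * laplace eps^-1 (tweight eps mu) (cst 1) x).
Proof.
have [C C0 hC] := tweight_gaussbound1 mu.
set L := laplace _ _ (cst 1) x; set L1 := laplace _ _ (fun y => _) x.
pose G (x : X) : R := expR (- (2 * eps)^-1 * sqnorm x).
have dG : differentiable G x /\ 'D_v G x = G x * (- eps^-1 * dotp v x).
  pose dq (h : X) : R := - (2 * eps)^-1 * (2 * dotp h x).
  have dql : linear dq.
    by move=> c h1 h2; rewrite /dq dotpDl dotpZl /GRing.scale/=; ring.
  pose dq_mixin := GRing.isLinear.Build _ _ _ _ _ dql.
  pose dqL : {linear X -> R} := HB.pack dq dq_mixin.
  have sqC (h : X) : sqnorm (h + x) = sqnorm h + sqnorm x + 2 * dotp h x.
    have -> : h + x = x - (- h) by rewrite opprK addrC.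
    rewrite sqnormB sqnormN.
    rewrite ?(dotpC x (- h)) dotpNl; ring.
  have [dq1 dq2] : differentiable (fun x : X => - (2 * eps)^-1 * sqnorm x) x /\
      forall v, 'D_v (fun x : X => - (2 * eps)^-1 * sqnorm x) x = dqL v.
    apply: (@differentiable_quadratic _ _ _ _ dqL x ((2 * eps)^-1 * \sum_(i < N) \sum_(j < d) 1) (`|- (2 * eps)^-1| * (2 * l1norm x))).
    - move=> h; rewrite /= /dq normrM -mulrA ler_wpM2l// normrM (ger0_norm (ler0n _ 2)) -mulrA ler_wpM2l//.
      by rewrite mulrC dotp_le.
    - move=> h _; rewrite /= /dq sqC.
      rewrite (_ : _ - _ = - (2 * eps)^-1 * sqnorm h); last by ring.
      have e20 : 0 < 2 * eps by rewrite mulr_gt0.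
      have i0 : 0 <= (2 * eps)^-1 by rewrite invr_ge0 ltW.
      rewrite normrM normrN (ger0_norm i0) (ger0_norm (sqnorm_ge0 h)) -mulrA ler_wpM2l//.
      rewrite /sqnorm mulr_suml ler_sum// => i _; rewrite mulr_suml ler_sum// => j _.
      by rewrite mul1r -(real_normK (num_real (h i j))) lerXn2r ?nnegrE// coord_le_norm.
  have [dE1 dE2] := derive_comp1 v dq1 (is_derive_expR _).
  split; first exact: dE1.
  rewrite dE2 dq2 /= /dq /G; congr (_ * _); field; exact: lt0r_neq0.
have [dL1 dL2] := laplace_partial eps^-1 a0 C0 hC (expgrowth_cst 1) x.
rewrite -/(G x).
rewrite /Hfun -/G.
have -> : 'D_v (fun x => G x * laplace eps^-1 (tweight eps mu) (cst 1) x) x =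
   G x *: 'D_v (laplace eps^-1 (tweight eps mu) (cst 1)) x + laplace eps^-1 (tweight eps mu) (cst 1) x *: 'D_v G x.
  by apply: (@deriveM _ _ G (laplace eps^-1 (tweight eps mu) (cst 1)) x v);
    apply: diff_derivable => //; have [] := dG.
have [_ ->] := dG; rewrite dL2 -/L /GRing.scale/=.
have -> : laplace eps^-1 (tweight eps mu) (fun y => eps^-1 * dotp v y * cst 1 y) x = L1.
  by rewrite /L1; congr (laplace _ _ _ _); apply/funext => y; rewrite /cst mulr1.
ring.
Qed.

(** By [laplace_tilt]; the linear terms in v coming from the Gaussian factor cancel,
and its quadratic term is the constant. *)
Lemma Hfun_tilt mu x v : Hfun mu x * expR ('D_v (Hfun mu) x / Hfun mu x) <=
  expR ((2 * eps)^-1 * sqnorm v) * Hfun mu (x + v).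
Proof.
have [C C0 hC] := tweight_gaussbound1 mu.
have L0 : 0 < laplace eps^-1 (tweight eps mu) (cst 1) x.
  by apply: (laplace_gt0 eps^-1 a0 C0 hC) => y; exact: tweight_gt0.
have := laplace_tilt a0 C0 hC v L0.
set L := laplace _ _ (cst 1) x; set L1 := laplace _ _ (fun y => _) x.
pose G (x : X) : R := expR (- (2 * eps)^-1 * sqnorm x).
move=> tilt; rewrite derive_Hfun -/(G x) -/L -/L1.
have G0 : 0 < G x by exact: expR_gt0.
have -> : G x * (L1 - eps^-1 * dotp v x * L) / Hfun mu x = L1 / L - eps^-1 * dotp v x.
  rewrite /Hfun -/(G x) -/L; field; by rewrite !lt0r_neq0.
rewrite {1}/Hfun -/(G x) -/L expRD.
rewrite [leLHS](_ : _ = G x * expR (- (eps^-1 * dotp v x)) * (L * expR (L1 / L))); last by ring.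
rewrite /Hfun.
have -> : expR ((2 * eps)^-1 * sqnorm v) * (expR (- (2 * eps)^-1 * sqnorm (x + v)) *
    laplace eps^-1 (tweight eps mu) (cst 1) (x + v)) =
  G x * expR (- (eps^-1 * dotp v x)) * laplace eps^-1 (tweight eps mu) (cst 1) (x + v).
  rewrite mulrA /G -!expRD; congr (expR _ * _).
  have -> : x + v = x - (- v) by rewrite opprK.
  rewrite sqnormB sqnormN.
  rewrite ?(dotpC x (- v)) dotpNl.
  field; exact: lt0r_neq0.
by rewrite ler_wpM2l// mulr_ge0 ?expR_ge0.
Qed.

Section mass.
Variables (mu : probability X R) (r : 'I_N -> V -> R).
Hypotheses (mr : forall j, measurable_fun [set: V] (r j)) (r0 : forall j v, 0 <= r j v).
Hypothesis muE : forall j A, measurable A -> marginal j mu A = (\int[leb 1 d]_(v in A) (r j v)%:E)%E.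

Lemma convolution_density j (v : V) :
  (\int[leb 1 d]_w (eta eps (v - w) * r j w)%:E = (convolution eps (marginal j mu) v)%:E)%E.
Proof.
rewrite -convolutionE// (ge0_integral_density (mr j) (r0 j) (muE j))//.
  by apply/measurable_EFinP; apply: measurable_eta_sub.
by move=> w; rewrite lee_fin eta_ge0.
Qed.

(** For fixed y the integrals over the rows j <> k cancel the j-th convolutions. What
remains beside Lambda depends on y only through its k-th row, so by
[Lam_marginal] integration over y brings the k-th convolution, which cancels as
well, and eta(v - (w + row k W)) has integral 1 in v. *)
Lemma theta_mass k (g : V -> R) (W : X) : measurable_fun [set: V] g -> (forall v, 0 <= g v) ->
  (forall j, j != k -> row j W = 0) ->
  (\int[leb N d]_x (Hfun mu (x + W) * (g (row k x) * \prod_(j | j != k) r j (row j x)))%:E =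
   \int[leb 1 d]_v (g v)%:E)%E.
Proof.
move=> mg g0 W0.
pose gg j := if j == k then g else r j.
have mgg j : measurable_fun [set: V] (gg j) by rewrite /gg; case: ifP.
have gg0 j v : 0 <= gg j v by rewrite /gg; case: ifP.
have ggE x : g (row k x) * \prod_(j | j != k) r j (row j x) = \prod_j gg j (row j x).
  rewrite [RHS](bigD1 k)//= /gg eqxx; congr (_ * _); apply: eq_bigr => j jk.
  by rewrite (negbTE jk).
have c0 j v : 0 < convolution eps (marginal j mu) v by exact: convolution_gt0.
pose F (xy : X * X) : R := Lam eps mu xy.2 * \prod_j
  (eta eps (row j xy.2 - row j (xy.1 + W)) / convolution eps (marginal j mu) (row j xy.2) * gg j (row j xy.1)).
have mF : measurable_fun [set: X * X] F.
  apply: measurable_funM.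
    by apply: (measurableT_comp (measurable_Lam _ _)); exact: measurable_snd.
  apply: measurable_prod_fun => j; apply: measurable_funM; last first.
    by apply: (measurableT_comp (mgg j)); apply: measurable_row_comp; exact: measurable_fst.
  apply: measurable_funM; last first.
    by apply: (measurableT_comp (measurable_convolution_inv _)); apply: measurable_row_comp; exact: measurable_snd.
  apply: measurable_eta_sub; apply: measurable_row_comp; first exact: measurable_snd.
  apply: measurable_fun_mxP => i l; under eq_fun do rewrite mxE.
  by apply: measurable_funD => //; exact: (measurableT_comp (measurable_mx_coord i l) measurable_fst).
have F0 xy : 0 <= F xy.
  rewrite mulr_ge0 ?(ltW (Lam_gt0 _ _ _))// prodr_ge0// => j _.
  by rewrite mulr_ge0// divr_ge0 ?eta_ge0// ltW.
transitivity (\int[leb N d]_x \int[leb N d]_y (F (x, y))%:E)%E.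
  apply: eq_integral => x _; rewrite ggE EFinM -HfunE -ge0_integralZr//.
  - apply: eq_integral => y _; rewrite -EFinM /F/= -mulrA; congr (_ * _)%:E.
    by rewrite /theta_kernel -big_split.
  - apply/measurable_EFinP; apply: measurable_funM; first exact: measurable_Lam.
    exact: (measurable_ysec (measurable_theta_kernel mu) (x + W)).
  - by move=> y _; rewrite lee_fin mulr_ge0 ?theta_kernel_ge0// ltW// Lam_gt0.
  - by rewrite lee_fin prodr_ge0.
rewrite (fubini_tonelli (EFin \o F)); last 2 first.
- exact/measurable_EFinP.
- by move=> xy; rewrite lee_fin.
pose b (v : V) : \bar R := (\int[leb 1 d]_w (eta eps (v - (w + row k W)) / convolution eps (marginal k mu) v * g w)%:E)%E.
have mbF : measurable_fun [set: V * V] (fun vw : V * V =>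
    (eta eps (vw.1 - (vw.2 + row k W)) / convolution eps (marginal k mu) vw.1 * g vw.2)%:E).
  apply/measurable_EFinP; apply: measurable_funM; last first.
    by apply: (measurableT_comp mg); exact: measurable_snd.
  apply: measurable_funM; last first.
    by apply: (measurableT_comp (measurable_convolution_inv _)); exact: measurable_fst.
  apply: measurable_eta_sub; first exact: measurable_fst.
  apply: measurable_fun_mxP => i l; under eq_fun do rewrite mxE.
  by apply: measurable_funD => //; exact: (measurableT_comp (measurable_mx_coord i l) measurable_snd).
have bF0 vw : (0 <= (eta eps (vw.1 - (vw.2 + row k W)) / convolution eps (marginal k mu) vw.1 * g vw.2)%:E)%E.
  by rewrite lee_fin mulr_ge0// divr_ge0 ?eta_ge0// ltW.
have mb : measurable_fun [set: V] b.
  exact: (measurable_fun_fubini_tonelli_F (m2 := leb 1 d) (fun vw : V * V =>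
    (eta eps (vw.1 - (vw.2 + row k W)) / convolution eps (marginal k mu) vw.1 * g vw.2)%:E)).
have b0 v : (0 <= b v)%E by apply: integral_ge0 => w _; exact: (bF0 (v, w)).
transitivity (\int[leb N d]_y ((Lam eps mu y)%:E * b (row k y)))%E.
  apply: eq_integral => y _ /=.
  have mp j : measurable_fun [set: V] (fun w => (eta eps (row j y - (w + row j W)) / convolution eps (marginal j mu) (row j y) * gg j w)%:E).
    apply/measurable_EFinP; apply: measurable_funM => //; apply: measurable_funM => //.
    apply: measurable_eta_sub => //.
    apply: measurable_fun_mxP => i l; under eq_fun do rewrite mxE.
    by apply: measurable_funD => //; exact: measurable_mx_coord.
  have pp j w : (0 <= (eta eps (row j y - (w + row j W)) / convolution eps (marginal j mu) (row j y) * gg j w)%:E)%E.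
    by rewrite lee_fin mulr_ge0// divr_ge0 ?eta_ge0// ltW.
  have := lebesgue_prod_rows mp pp.
  rewrite [X in _ = X -> _](bigD1 k)//= [X in _ = (_ * X)%E -> _]big1 ?mule1; last first.
    move=> j jk; rewrite W0// /gg (negbTE jk).
    transitivity (\int[leb 1 d]_w (((convolution eps (marginal j mu) (row j y))^-1)%:E * (eta eps (row j y - w) * r j w)%:E))%E.
      by apply: eq_integral => w _; rewrite -EFinM addr0; congr EFin; ring.
    rewrite ge0_integralZl//; try solve [by move=> w _; rewrite lee_fin mulr_ge0 ?eta_ge0
      | by rewrite lee_fin invr_ge0 ltW
      | by apply/measurable_EFinP; apply: measurable_funM => //; apply: measurable_eta_sub].
    by rewrite convolution_density -EFinM mulVf// gt_eqF.
  rewrite /gg eqxx -/(b (row k y)) => <-.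
  rewrite -ge0_integralZl//; first last.
  - by rewrite lee_fin ltW// Lam_gt0.
  - by move=> x _; apply: prode_ge0 => j _; exact: pp.
  - by apply: emeasurable_prod => j; apply: (measurableT_comp (mp j)); exact: measurable_row.
  apply: eq_integral => x _; rewrite prodEFin -EFinM /F/=; congr (_ * _)%:E.
  by apply: eq_bigr => j _; rewrite linearD.
rewrite Lam_marginal//.
transitivity (\int[leb 1 d]_v \int[leb 1 d]_w (eta eps (v - (w + row k W)) * g w)%:E)%E.
  apply: eq_integral => v _; rewrite /b -ge0_integralZl//; first last.
  - by rewrite lee_fin ltW.
  - by move=> w _; exact: (bF0 (v, w)).
  - exact: (measurable_xsec mbF v).
  by apply: eq_integral => w _; rewrite -EFinM; congr EFin; field; rewrite gt_eqF.
have mE : measurable_fun [set: V * V] (fun vw : V * V => (eta eps (vw.1 - (vw.2 + row k W)) * g vw.2)%:E).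
  apply/measurable_EFinP; apply: measurable_funM; last first.
    by apply: (measurableT_comp mg); exact: measurable_snd.
  apply: measurable_eta_sub; first exact: measurable_fst.
  apply: measurable_fun_mxP => i l; under eq_fun do rewrite mxE.
  by apply: measurable_funD => //; exact: (measurableT_comp (measurable_mx_coord i l) measurable_snd).
rewrite (fubini_tonelli (fun vw : V * V => (eta eps (vw.1 - (vw.2 + row k W)) * g vw.2)%:E))//; last first.
  by move=> vw; rewrite lee_fin mulr_ge0 ?eta_ge0.
apply: eq_integral => w _ /=; under eq_integral do rewrite EFinM.
rewrite ge0_integralZr//; try solve [by move=> v _; rewrite lee_fin eta_ge0 | by rewrite lee_fin
  | by apply/measurable_EFinP; apply: measurable_eta_sub].
by rewrite integral_eta_translate mul1e.
Qed.

End mass.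

End theta_mass.

(** * The density of Theta *)

Lemma measurable_swapped d1 d2 d3 (T1 : measurableType d1) (T2 : measurableType d2)
    (U : measurableType d3) (f : T1 * T2 -> U) :
  measurable_fun [set: T1 * T2] f -> measurable_fun [set: T2 * T1] (fun yx => f (yx.2, yx.1)).
Proof. by move=> mf; apply: (measurableT_comp mf); exact: measurable_swap. Qed.

Section density_probability.
Context d (T : measurableType d) (R : realType).
Variables (mu : {measure set T -> \bar R}) (f : T -> R).
Hypotheses (mf : measurable_fun [set: T] f) (f0 : forall x, 0 <= f x).
Hypothesis f1 : (\int[mu]_x (f x)%:E = 1)%E.

Definition density_probability of (\int[mu]_x (f x)%:E = 1)%E : set T -> \bar R :=
  density_measure mu mf f0.

HB.instance Definition _ := Measure.on (density_probability f1).

Let setT1 : density_probability f1 [set: T] = 1%E. Proof. exact: f1. Qed.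

HB.instance Definition _ := @Measure_isProbability.Build _ _ R (density_probability f1) setT1.

End density_probability.

Section theta_density.
Context {R : realType} {N d : nat}.
Local Notation X := 'M[R]_(N, d).
Local Notation V := 'rV[R]_d.
Local Notation leb m n := (@lebesgue_mx R m n).
Local Notation eta := Defs.eta.
Variable eps : R.
Hypothesis e0 : 0 < eps.
Hypothesis N0 : (0 < N)%N.
Variables (mu : probability X R) (r : 'I_N -> V -> R).
Hypotheses (mr : forall j, measurable_fun [set: V] (r j)) (r0 : forall j v, 0 <= r j v).
Hypothesis muE : forall j A, measurable A -> marginal j mu A = (\int[leb 1 d]_(v in A) (r j v)%:E)%E.

Definition rprod (x : X) := \prod_j r j (row j x).

Lemma measurable_rprod : measurable_fun [set: X] rprod.
Proof. exact: measurable_prod_rows. Qed.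

Lemma rprod_ge0 x : 0 <= rprod x. Proof. exact: prodr_ge0. Qed.

Definition tdens (x : X) : R := Hfun eps mu x * rprod x.

Lemma measurable_tdens : measurable_fun [set: X] tdens.
Proof. by apply: measurable_funM; [exact: measurable_Hfun|exact: measurable_rprod]. Qed.

Lemma tdens_ge0 x : 0 <= tdens x.
Proof. by rewrite mulr_ge0 ?rprod_ge0// ltW// Hfun_gt0. Qed.

Lemma integral_r j : (\int[leb 1 d]_v (r j v)%:E = 1)%E.
Proof. by rewrite -muE// -(probability_setT (marginal j mu)). Qed.

Lemma integral_tdens : (\int[leb N d]_x (tdens x)%:E = 1)%E.
Proof.
pose k := Ordinal N0.
rewrite -(integral_r k) -(@theta_mass _ _ _ _ e0 N0 mu r mr r0 muE k (r k) 0)//; last first.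
  by move=> j _; rewrite row0.
by apply: eq_integral => x _; rewrite addr0 /tdens /rprod (bigD1 k).
Qed.

Definition theta_prob : probability X R :=
  density_probability measurable_tdens tdens_ge0 integral_tdens.

Lemma prod_rows_rprod A : measurable A ->
  product_rows (marginal ^~ mu) A = (\int[leb N d]_(x in A) (rprod x)%:E)%E.
Proof. by move=> mA; exact: (product_rowsE mr r0 muE). Qed.

Lemma LambdaE A : Lambda eps mu A = (\int[leb N d]_(y in A) (Lam eps mu y)%:E)%E.
Proof. by apply: eq_integral => y _; rewrite Lambda_densityE. Qed.

(** The inner integral of [is_Theta]. *)
Definition theta_inner (psi : X -> R) (y : X) : \bar R :=
  (\int[product_rows (marginal ^~ mu)]_x (psi x * theta_kernel eps mu y x)%:E)%E.

Lemma measurable_psi_kernel (psi : X -> R) : measurable_fun [set: X] psi ->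
  measurable_fun [set: X * X] (fun yx => (psi yx.2 * theta_kernel eps mu yx.1 yx.2)%:E).
Proof.
move=> mpsi; apply/measurable_EFinP; apply: measurable_funM; last exact: measurable_theta_kernel.
by apply: (measurableT_comp mpsi); exact: measurable_snd.
Qed.

Lemma theta_innerE (psi : X -> R) y : measurable_fun [set: X] psi -> (forall x, 0 <= psi x) ->
  theta_inner psi y = (\int[leb N d]_x (psi x * theta_kernel eps mu y x * rprod x)%:E)%E.
Proof.
move=> mpsi psi0; rewrite /theta_inner.
rewrite (ge0_integral_density measurable_rprod rprod_ge0 prod_rows_rprod)//.
- exact: (measurable_xsec (measurable_psi_kernel mpsi) y).
- by move=> x; rewrite lee_fin mulr_ge0 ?theta_kernel_ge0.
Qed.

Lemma theta_inner1 y : theta_inner (cst 1) y = 1%E.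
Proof.
rewrite theta_innerE//.
pose a j (v : V) : \bar R := (eta eps (row j y - v) / convolution eps (marginal j mu) (row j y) * r j v)%:E.
have ma j : measurable_fun [set: V] (a j).
  apply/measurable_EFinP; apply: measurable_funM => //; apply: measurable_funM => //.
  exact: measurable_eta_sub.
have c0 j v : 0 < convolution eps (marginal j mu) v by exact: convolution_gt0.
have a0 j v : (0 <= a j v)%E by rewrite lee_fin mulr_ge0// divr_ge0 ?eta_ge0// ltW.
transitivity (\int[leb N d]_x \prod_j a j (row j x))%E.
  by apply: eq_integral => x _; rewrite prodEFin mul1r /theta_kernel -big_split.
rewrite lebesgue_prod_rows// big1// => j _.
transitivity (\int[leb 1 d]_w (((convolution eps (marginal j mu) (row j y))^-1)%:E * (eta eps (row j y - w) * r j w)%:E))%E.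
  by apply: eq_integral => w _; rewrite -EFinM; congr EFin; ring.
rewrite ge0_integralZl//; try solve [by move=> w _; rewrite lee_fin mulr_ge0 ?eta_ge0
  | by rewrite lee_fin invr_ge0 ltW
  | by apply/measurable_EFinP; apply: measurable_funM => //; apply: measurable_eta_sub].
by rewrite (convolution_density e0 mr r0 muE) -EFinM mulVf// gt_eqF.
Qed.

Lemma measurable_theta_inner (psi : X -> R) : measurable_fun [set: X] psi -> (forall x, 0 <= psi x) ->
  measurable_fun [set: X] (theta_inner psi).
Proof.
move=> mpsi psi0.
have -> : theta_inner psi = fun y => (\int[leb N d]_x (psi x * theta_kernel eps mu y x * rprod x)%:E)%E.
  by apply/funext => y; exact: theta_innerE.
apply: (measurable_fun_fubini_tonelli_F (m2 := leb N d)
  (fun yx : X * X => (psi yx.2 * theta_kernel eps mu yx.1 yx.2 * rprod yx.2)%:E)).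
- apply/measurable_EFinP; apply: measurable_funM.
    by apply/measurable_EFinP; exact: measurable_psi_kernel.
  by apply: (measurableT_comp measurable_rprod); exact: measurable_snd.
- by move=> yx; rewrite lee_fin !mulr_ge0 ?theta_kernel_ge0 ?rprod_ge0.
Qed.

(** Tonelli: integrating first over x gives the definition of Theta, first over y the
factor H. *)
Lemma theta_fubini (psi : X -> R) : measurable_fun [set: X] psi -> (forall x, 0 <= psi x) ->
  (\int[theta_prob]_x (psi x)%:E = \int[Lambda eps mu]_y theta_inner psi y)%E.
Proof.
move=> mpsi psi0.
rewrite (@ge0_integral_density _ _ _ (leb N d) theta_prob _ measurable_tdens tdens_ge0 _ (EFin \o psi))//; try solve [exact/measurable_EFinP | by move=> x; rewrite /= lee_fin].
have ti0 y : (0 <= theta_inner psi y)%E.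
  by apply: integral_ge0 => x _; rewrite lee_fin mulr_ge0 ?theta_kernel_ge0.
rewrite (@ge0_integral_density _ _ _ (leb N d) (Lambda eps mu) _ (measurable_Lam _ mu)
  (fun y => ltW (Lam_gt0 e0 mu y)) (fun A _ => LambdaE A) (theta_inner psi))//; last first.
  exact: measurable_theta_inner.
pose F (xy : X * X) : R := psi xy.1 * rprod xy.1 * (Lam eps mu xy.2 * theta_kernel eps mu xy.2 xy.1).
have mF : measurable_fun [set: X * X] F.
  apply: measurable_funM.
    by apply: measurable_funM; [apply: (measurableT_comp mpsi)|apply: (measurableT_comp measurable_rprod)]; exact: measurable_fst.
  apply: measurable_funM; first by apply: (measurableT_comp (measurable_Lam _ _)); exact: measurable_snd.
  exact: (measurable_swapped (measurable_theta_kernel e0 mu)).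
have F0 xy : 0 <= F xy.
  by rewrite !mulr_ge0 ?theta_kernel_ge0 ?rprod_ge0// ltW// Lam_gt0.
transitivity (\int[leb N d]_x \int[leb N d]_y (F (x, y))%:E)%E.
  apply: eq_integral => x _.
  rewrite [LHS](_ : _ = (psi x * rprod x)%:E * (Hfun eps mu x)%:E)%E; last first.
    by rewrite -!EFinM -mulrA [rprod x * _]mulrC.
  rewrite -(HfunE e0 N0) -ge0_integralZl//.
  - apply/measurable_EFinP; apply: measurable_funM; first exact: measurable_Lam.
    exact: (measurable_ysec (measurable_theta_kernel e0 mu) x).
  - by move=> y _; rewrite lee_fin mulr_ge0 ?theta_kernel_ge0// ltW// Lam_gt0.
  - by rewrite lee_fin mulr_ge0 ?rprod_ge0.
rewrite (fubini_tonelli (EFin \o F)); last 2 first.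
- exact/measurable_EFinP.
- by move=> xy; rewrite lee_fin.
apply: eq_integral => y _; rewrite theta_innerE// -ge0_integralZr//; first last.
- by rewrite lee_fin ltW// Lam_gt0.
- by move=> x _; rewrite lee_fin !mulr_ge0 ?theta_kernel_ge0 ?rprod_ge0.
- apply/measurable_EFinP; apply: measurable_funM; last exact: measurable_rprod.
  by apply/measurable_EFinP; exact: (measurable_xsec (measurable_psi_kernel mpsi) y).
by apply: eq_integral => x _; rewrite /= -EFinM; congr EFin; rewrite /F/=; ring.
Qed.

(** The identity [theta_fubini] for nonnegative functions is extended to bounded ones
by adding a constant, the kernel having total mass 1. *)
Lemma is_Theta_theta_prob : is_Theta eps mu theta_prob.
Proof.
move=> psi [cpsi [C hC]].
have mpsi := measurable_continuous cpsi.
have C0 : 0 <= C by apply: le_trans (hC 0).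
have psiC0 x : 0 <= psi x + C.
  by have := hC x; rewrite ler_norml => /andP[h _]; rewrite -lerBlDr sub0r.
have mpsiC : measurable_fun [set: X] (fun x => psi x + C) by exact: measurable_funD.
have ipsi := integrable_bounded theta_prob mpsi hC.
have icst : theta_prob.-integrable [set: X] (EFin \o cst C) by exact: finite_measure_integrable_cst.
have E1 : (\int[theta_prob]_x (psi x + C)%:E = \int[theta_prob]_x (psi x)%:E + C%:E)%E.
  under eq_integral do rewrite EFinD.
  rewrite integralD//; congr (_ + _)%E.
  by rewrite integral_cst//= -[RHS]mule1; congr (_ * _)%E; exact: probability_setT.
(* The constant added below is integrated against the kernel, which has mass 1. *)
have kint1 y : (\int[product_rows (marginal ^~ mu)]_x (theta_kernel eps mu y x)%:E = 1)%E.
  by rewrite -(theta_inner1 y); apply: eq_integral => x _; rewrite /cst mul1r.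
have kint y : (product_rows (marginal ^~ mu)).-integrable [set: X] (EFin \o (fun x => theta_kernel eps mu y x)).
  apply/integrableP; split.
    by apply/measurable_EFinP; exact: (measurable_xsec (measurable_theta_kernel e0 mu) y).
  under eq_integral do rewrite /= ger0_norm ?theta_kernel_ge0//.
  by rewrite kint1 ltry.
have ikint y : (product_rows (marginal ^~ mu)).-integrable [set: X] (EFin \o (fun x => psi x * theta_kernel eps mu y x)).
  apply: (@le_integrable _ _ _ _ _ measurableT _ (EFin \o (fun x => C * theta_kernel eps mu y x))).
  - exact: (measurable_xsec (measurable_psi_kernel mpsi) y).
  - move=> x _ /=; rewrite lee_fin !normrM (ger0_norm C0) ler_wpM2r//.
  - exact: (integrableZl measurableT C (kint y)).
have E2 y : theta_inner (fun x => psi x + C) y = (theta_inner psi y + C%:E)%E.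
  rewrite /theta_inner; under eq_integral do rewrite mulrDl EFinD.
  rewrite (@integralD _ _ _ _ _ measurableT _ _ (ikint y) (integrableZl measurableT C (kint y))).
  by rewrite (integralZl measurableT (kint y)) kint1 mule1.
have LT : Lambda eps mu [set: X] = 1%E.
  transitivity (\int[Lambda eps mu]_y theta_inner (cst 1%R) y)%E.
    by under eq_integral do rewrite theta_inner1; rewrite integral_cst//= mul1e.
  rewrite -theta_fubini//.
  rewrite (_ : (fun x => (cst 1 x)%:E) = cst 1%E)// integral_cst//= mul1e; exact: probability_setT.
have iin : (Lambda eps mu).-integrable [set: X] (theta_inner (fun x => psi x + C)).
  apply/integrableP; split; first exact: measurable_theta_inner.
  under eq_integral => y _.
    rewrite gee0_abs; last by apply: integral_ge0 => x _; rewrite lee_fin mulr_ge0 ?theta_kernel_ge0.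
    over.
  rewrite -theta_fubini// E1 lte_add_pinfty ?ltry//.
  have := integrable_fin_num measurableT ipsi.
  by rewrite fin_numElt => /andP[].
have icL : (Lambda eps mu).-integrable [set: X] (cst C%:E).
  apply/integrableP; split => //.
  by rewrite integral_cst//= LT mule1 ltry.
have : (\int[Lambda eps mu]_y (theta_inner (fun x => psi x + C)%R y - C%:E) = \int[theta_prob]_x (psi x)%:E)%E.
  rewrite (integralB measurableT iin icL) -theta_fubini// E1 integral_cst// [X in (_ - _ * X)%E](_ : _ = 1%E)//.
  by rewrite mule1 addeK.
move=> <-; apply: eq_integral => y _; rewrite E2 addeK//.
Qed.

(** [theta_prob] satisfies the specification of Theta, which determines a measure. *)
Lemma Theta_density A : measurable A ->
  Theta eps mu A = (\int[leb N d]_(x in A) (tdens x)%:E)%E.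
Proof.
have Th : is_Theta eps mu (Theta eps mu) by apply: getPex; exists theta_prob; exact: is_Theta_theta_prob.
move=> mA; transitivity (theta_prob A); last by [].
apply: Cb_determines => // psi Cpsi.
by rewrite Th// -is_Theta_theta_prob.
Qed.

End theta_density.

(** * Weak derivatives of products over the rows *)

Section local_test.
Context {R : realType} {m n : nat}.
Local Notation M := 'M[R]_(m, n).
Local Notation leb := (@lebesgue_mx R m n).

Definition loc_integrable (a : M -> R) := measurable_fun [set: M] a /\
  forall x y, leb.-integrable (obox x y) (EFin \o a).

Lemma Lfun_loc_integrable p (a : M -> R) : 1 <= p -> a \in Lfun leb p%:E -> loc_integrable a.
Proof.
move=> p1 ap; split; first by have [] := (Lfun_finP leb p1 a).1 ap.
move=> x y; apply: (Lfun_local_integrable p1 ap); [exact: measurable_obox|exact: lebesgue_mx_obox_lty].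
Qed.

(** A continuous function of compact support is bounded and vanishes outside a box. *)
Lemma integrable_loc_test (a b : M -> R) : loc_integrable a -> continuous b ->
  compact (closure [set x | b x != 0]) -> leb.-integrable [set: M] (EFin \o (fun x => a x * b x)).
Proof.
move=> [ma ia] cb cK; set K := closure _ in cK.
have bK x : ~ K x -> b x = 0.
  by move=> nK; apply/eqP; apply: contra_notT nK => bx; exact: subset_closure.
have [B [_ hB]] : bounded_set (b @` K).
  by apply: compact_bounded; apply: continuous_compact => //; exact: continuous_subspaceT.
have [A [_ hA]] := compact_bounded cK.
pose B1 := `|B| + 1; pose A1 := `|A| + 1.
have hB1 x : `|b x| <= B1.
  have [Kx|nK] := pselect (K x); last by rewrite bK// normr0 addr_ge0.
  by apply: (hB B1); [rewrite (le_lt_trans (ler_norm B))// ltrDl|exists x].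
have hA1 x : K x -> obox (const_mx (- (A1 + 1))) (const_mx (A1 + 1)) x.
  move=> Kx i j; rewrite !mxE -ltr_norml (le_lt_trans (coord_le_norm x i j))//.
  by rewrite (@le_lt_trans _ _ A1)// ?ltrDl//; apply: (hA A1) => //; rewrite (le_lt_trans (ler_norm A))// ltrDl.
set box := obox _ _ in hA1.
have ib : leb.-integrable [set: M] ((EFin \o a) \_ box).
  by apply/(integrable_mkcond _ _).1; [exact: measurable_obox|exact: ia].
apply: (@le_integrable _ _ _ _ _ measurableT _ (fun x => B1%:E * ((EFin \o a) \_ box) x)%E).
- by apply/measurable_EFinP; apply: measurable_funM => //; exact: measurable_continuous.
- move=> x _ /=; have [Kx|nK] := pselect (K x); last by rewrite bK// mulr0 /= normr0 abse_ge0.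
  rewrite /patch mem_set/=; last exact: hA1.
  by rewrite lee_fin mulrC !normrM ler_wpM2r// (le_trans (hB1 x))// ler_norm.
- exact: integrableZl.
Qed.

(** Off the closed support the function vanishes in a neighbourhood. *)
Lemma partial_support ij (phi : M -> R) :
  [set x | partial ij phi x != 0] `<=` closure [set x | phi x != 0].
Proof.
move=> x /=; apply: contra_neqP => nx.
have -> : partial ij phi x = partial ij (cst 0) x.
  apply: near_eq_derive; near=> y; apply/eqP.
  have : (~` closure [set x | phi x != 0]) y.
    near: y; apply: open_nbhs_nbhs; split => //; apply/closed_openC/closed_closure.
  by apply: contra_notT => py; exact: subset_closure.
by rewrite /partial derive_cst.
Unshelve. all: by end_near. Qed.

Lemma test_function_continuous phi : @test_function R m n phi -> continuous phi.
Proof. by case=> sp _; exact: smooth_continuous. Qed.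

Lemma partial_test ij phi : test_function phi -> @test_function R m n (partial ij phi).
Proof.
move=> [sp cp]; split; last by apply: (compact_closure_sub (@partial_support ij phi)).
by move=> s x; have := sp (rcons s ij) x; rewrite foldr_rcons.
Qed.

Lemma smooth_partial ij phi : @smooth R m n phi -> smooth (partial ij phi).
Proof. by move=> sp s x; have := sp (rcons s ij) x; rewrite foldr_rcons. Qed.

Lemma testM h phi : smooth h -> test_function phi -> @test_function R m n (fun x => h x * phi x).
Proof.
move=> sh [sp cp]; split.
  by apply: smooth_algP; apply: smooth_alg_mul; exact: smooth_alg_smooth.
apply: (compact_closure_sub _ cp) => x /= hp; apply: subset_closure => /=.
by apply: contra_neq hp => ->; rewrite mulr0.
Qed.

(** If phi is a test function then so is h phi; use it to test f. *)
Lemma weak_partialM p ij (f g h : M -> R) : 1 <= p -> f \in Lfun leb p%:E -> g \in Lfun leb p%:E ->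
  weak_partial ij f g -> smooth h ->
  weak_partial ij (fun x => h x * f x) (fun x => h x * g x + partial ij h x * f x).
Proof.
move=> p1 fp gp wfg sh phi tp; have [sp cp] := tp.
have lf := Lfun_loc_integrable p1 fp; have lg := Lfun_loc_integrable p1 gp.
have integ a b : loc_integrable a -> test_function b ->
    leb.-integrable [set: M] (EFin \o (fun x => a x * b x)).
  by move=> la tb; apply: integrable_loc_test => //; [exact: test_function_continuous|case: tb].
have i1 := integ _ _ lf (testM sh (partial_test ij tp)).
have i2 := integ _ _ lf (testM (smooth_partial ij sh) tp).
have i3 := integ _ _ lg (testM sh tp).
have := wfg _ (testM sh tp).
have E x : (f x * partial ij (fun x => h x * phi x) x) =
   (f x * (h x * partial ij phi x)) + (f x * (partial ij h x * phi x)).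
  rewrite -mulrDr; congr (_ * _); rewrite /partial.
  rewrite (@deriveM _ _ h phi x (delta_mx ij.1 ij.2)) /GRing.scale/=; first by ring.
  - by apply: diff_derivable; exact: (sh [::]).
  - by apply: diff_derivable; exact: (sp [::]).
under eq_integral do rewrite E EFinD.
rewrite (integralD measurableT i1 i2).
under [X in _ -> X = _]eq_integral do rewrite mulrAC mulrC.
have -> : (\int[leb]_x ((h x * g x + partial ij h x * f x) * phi x)%:E =
   \int[leb]_x (g x * (h x * phi x))%:E + \int[leb]_x (f x * (partial ij h x * phi x))%:E)%E.
  rewrite -(integralD measurableT i3 i2); apply: eq_integral => x _ /=.
  by rewrite -EFinD; congr EFin; ring.
have := integrable_fin_num measurableT i1; have := integrable_fin_num measurableT i2.
have := integrable_fin_num measurableT i3.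
rewrite /comp => /fineK <- /fineK <- /fineK <-.
rewrite -!EFinD -!EFinN => -[h1]; congr EFin; lra.
Qed.

Lemma weak_partialB p ij (f1 g1 f2 g2 : M -> R) : 1 <= p ->
  f1 \in Lfun leb p%:E -> g1 \in Lfun leb p%:E -> f2 \in Lfun leb p%:E -> g2 \in Lfun leb p%:E ->
  weak_partial ij f1 g1 -> weak_partial ij f2 g2 -> weak_partial ij (f1 \- f2) (g1 \- g2).
Proof.
move=> p1 f1p g1p f2p g2p w1 w2 phi tp.
have integ a b : a \in Lfun leb p%:E -> test_function b ->
    leb.-integrable [set: M] (EFin \o (fun x => a x * b x)).
  move=> la tb; apply: integrable_loc_test => //; [exact: Lfun_loc_integrable la|exact: test_function_continuous|by case: tb].
have tq := partial_test ij tp.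
have := w1 _ tp; have := w2 _ tp.
have E a b c : a \in Lfun leb p%:E -> b \in Lfun leb p%:E -> test_function c ->
    (\int[leb]_x ((a \- b) x * c x)%:E = \int[leb]_x (a x * c x)%:E - \int[leb]_x (b x * c x)%:E)%E.
  move=> la lb tc; rewrite -(integralB measurableT (integ _ _ la tc) (integ _ _ lb tc)).
  by apply: eq_integral => x _; rewrite /= -EFinB mulrBl.
rewrite !E//.
have := integrable_fin_num measurableT (integ _ _ f1p tq).
have := integrable_fin_num measurableT (integ _ _ f2p tq).
have := integrable_fin_num measurableT (integ _ _ g1p tp).
have := integrable_fin_num measurableT (integ _ _ g2p tp).
rewrite /comp => /fineK <- /fineK <- /fineK <- /fineK <-.
rewrite -!EFinB -!EFinN => -[h1] [h2]; congr EFin; lra.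
Qed.

End local_test.

Section slices.
Context {R : realType} {N d : nat}.
Local Notation X := 'M[R]_(N.+1, d).
Local Notation Y := 'M[R]_(N, d).
Local Notation V := 'rV[R]_d.
Local Notation leb m n := (@lebesgue_mx R m n).
Variable k : 'I_N.+1.

Lemma continuous_row : continuous (row k : X -> V).
Proof.
move=> x; apply: (cvg_mxP (FF := nbhs_filter x)) => i j; under eq_fun do rewrite mxE; rewrite mxE.
exact: coord_continuous.
Qed.

Lemma insert_rowE (v : V) (x : Y) : insert_row k v x = insert_row k v 0 + insert_row k 0 x.
Proof. by apply/matrixP => i j; rewrite !mxE; case: unliftP => *; rewrite ?mxE ?add0r ?addr0. Qed.

Lemma insert_row_shift c i (v : V) (x : Y) :
  insert_row k (c *: delta_mx 0 i + v) x = c *: delta_mx k i + insert_row k v x.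
Proof.
apply/matrixP => a b; rewrite !mxE; case: unliftP => [a' ->|->]; last by rewrite ?mxE !eqxx.
by rewrite ?mxE eq_sym (negbTE (neq_lift _ _)) mulr0 add0r.
Qed.

Lemma differentiable_insert_row (v : V) (x : Y) : differentiable (insert_row k ^~ x) v.
Proof.
rewrite (_ : insert_row k ^~ x = (fun v => insert_row k v 0) + cst (insert_row k 0 x)); last first.
  by apply/funext => w; rewrite insert_rowE.
apply: differentiableD => //.
pose f (v : V) : X := insert_row k v 0.
have fl : linear f.
  move=> c u w; apply/matrixP => a b; rewrite !mxE; case: unliftP => *; rewrite ?mxE//.
  by rewrite mulr0 addr0.
pose f_mixin := GRing.isLinear.Build _ _ _ _ _ fl.
pose fL : {linear V -> X} := HB.pack f f_mixin.
apply: (@linear_differentiable _ _ _ fL) => w; apply: (cvg_mxP (FF := nbhs_filter w)) => a b.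
rewrite /= /f; under eq_fun do rewrite mxE; rewrite mxE.
case: unliftP => *; first exact: cvg_cst.
exact: coord_continuous.
Qed.

Definition slice (phi : X -> R) (x : Y) : V -> R := fun v => phi (insert_row k v x).

(** The difference quotients are the same. *)
Lemma partial_slice phi x i : partial (0, i) (slice phi x) = slice (partial (k, i) phi) x.
Proof.
apply/funext => v; rewrite /partial /slice /derive; apply: (congr1 (fun F : R -> R => lim (F @ 0^'))).
by apply/funext => h; rewrite /= /shift /= insert_row_shift.
Qed.

(** The support of a slice is contained in the projection of the support. *)
Lemma test_slice phi x : test_function phi -> test_function (slice phi x).
Proof.
move=> [sp cp]; split.
  move=> s v.
  have -> : foldr partial (slice phi x) s =
      slice (foldr partial phi [seq (k, ij.2) | ij <- s]) x.
    by elim: s => //= -[a i] s ->; rewrite ord1 partial_slice.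
  by apply: (@differentiable_comp _ _ _ _ (insert_row k ^~ x)); [exact: differentiable_insert_row|exact: sp].
apply: (@compact_closure_sub _ _ _ _ (row k @` closure [set x | phi x != 0])).
  move=> v /= pv; exists (insert_row k v x); last exact: row_insert_row.
  exact: subset_closure.
by apply: continuous_compact => //; apply: continuous_subspaceT; exact: continuous_row.
Qed.

Definition subst_fun (u : 'I_N.+1 -> V -> R) (g : V -> R) j := if j == k then g else u j.

Lemma rprod_subst u g (x : X) :
  rprod (subst_fun u g) x = g (row k x) * \prod_(j | j != k) u j (row j x).
Proof.
rewrite /rprod (bigD1 k)//= /subst_fun eqxx; congr (_ * _); apply: eq_bigr => j jk.
by rewrite (negbTE jk).
Qed.

Lemma rprod_insert_row u g v (x : Y) : rprod (subst_fun u g) (insert_row k v x) =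
  g v * \prod_(j < N) u (lift k j) (row j x).
Proof.
rewrite /rprod (bigD1_ord k)//= /subst_fun eqxx row_insert_row; congr (_ * _).
by apply: eq_bigr => j _; rewrite eq_sym (negbTE (neq_lift _ _)) row_insert_row_lift.
Qed.

Lemma subst_fun_id u : subst_fun u (u k) = u.
Proof. by apply/funext => j; rewrite /subst_fun; case: eqP => // ->. Qed.

End slices.

Section product_rule.
Context {R : realType} {N d : nat}.
Local Notation X := 'M[R]_(N.+1, d).
Local Notation V := 'rV[R]_d.
Local Notation leb m n := (@lebesgue_mx R m n).
Variable p : R.
Hypothesis p1 : 1 <= p.

Lemma powR_prod_abs (f : 'I_N.+1 -> V -> R) (x : X) :
  `|rprod f x| `^ p = \prod_j (`|f j (row j x)| `^ p).
Proof.
rewrite /rprod normr_prod; elim: (index_enum _) => [|i s ih]; first by rewrite !big_nil powR1.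
by rewrite !big_cons powRM ?ih// prodr_ge0.
Qed.

(** Tonelli for |f_j|^p. *)
Lemma Lfun_rprod (f : 'I_N.+1 -> V -> R) : (forall j, f j \in Lfun (leb 1 d) p%:E) ->
  (rprod f : X -> R) \in Lfun (leb N.+1 d) p%:E.
Proof.
move=> fp; have mf j : measurable_fun [set: V] (f j) by have [] := (Lfun_finP (leb 1 d) p1 (f j)).1 (fp j).
apply/(Lfun_finP _ p1); split; first exact: measurable_prod_rows.
under eq_integral do rewrite powR_prod_abs -prodEFin.
rewrite (@lebesgue_prod_rows R N.+1 d (fun j v => (`|f j v| `^ p)%:E)).
- have : (0 <= \prod_j \int[leb 1 d]_v (`|f j v| `^ p)%:E < +oo)%E; last by case/andP.
  apply: (big_ind (fun x => 0 <= x < +oo)%E) => [|x y /andP[x0 xo] /andP[y0 yo]|j _].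
  + by rewrite lee01 ltry.
  + by rewrite mule_ge0// lte_mul_pinfty// ge0_fin_numE.
  + rewrite integral_ge0; last by move=> v _; rewrite lee_fin powR_ge0.
    by have [] := (Lfun_finP (leb 1 d) p1 (f j)).1 (fp j).
- by move=> j; exact: measurable_abs_powR.
- by move=> j v; rewrite lee_fin powR_ge0.
Qed.

Lemma Lfun_subst (k : 'I_N.+1) u g : (forall j, u j \in Lfun (leb 1 d) p%:E) -> g \in Lfun (leb 1 d) p%:E ->
  forall j, subst_fun k u g j \in Lfun (leb 1 d) p%:E.
Proof. by move=> up gp j; rewrite /subst_fun; case: ifP. Qed.

(** For fixed rows j <> k, the slice of a test function is a test function of the row
k, for which the hypothesis on u k applies. *)
Lemma weak_partial_rprod (k : 'I_N.+1) i u g : (forall j, u j \in Lfun (leb 1 d) p%:E) ->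
  g \in Lfun (leb 1 d) p%:E -> weak_partial (0, i) (u k) g ->
  weak_partial (k, i) (rprod u : X -> R) (rprod (subst_fun k u g)).
Proof.
move=> up gp wug phi tp.
have tq := partial_test (k, i) tp.
have lu := Lfun_loc_integrable p1 (Lfun_rprod up).
have lg := Lfun_loc_integrable p1 (Lfun_rprod (Lfun_subst k up gp)).
have i1 : (leb N.+1 d).-integrable [set: X] (EFin \o (fun x => rprod u x * partial (k, i) phi x)).
  by apply: integrable_loc_test => //; [exact: test_function_continuous|case: tq].
have i2 : (leb N.+1 d).-integrable [set: X] (EFin \o (fun x => rprod (subst_fun k u g) x * phi x)).
  by apply: integrable_loc_test => //; [exact: test_function_continuous|case: tp].
have i2N := integrableZl measurableT (-1) i2.
transitivity (\int[leb N.+1 d]_x ((-1)%R%:E * (EFin \o (fun x => rprod (subst_fun k u g) x * phi x)%R) x))%E; last first.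
  by rewrite (integralZl measurableT i2) mulN1e.
rewrite (lebesgue_integral_insert_row k i1) (lebesgue_integral_insert_row k i2N).
apply: eq_integral => x _; have ts := test_slice k x tp; have tps := partial_test (0, i) ts.
pose c := \prod_(j < N) u (lift k j) (row j x).
have i3 : (leb 1 d).-integrable [set: V] (EFin \o (fun v => u k v * partial (0, i) (slice k phi x) v)).
  apply: integrable_loc_test => //; [exact: Lfun_loc_integrable (up k)|exact: test_function_continuous|by case: tps].
have i4 : (leb 1 d).-integrable [set: V] (EFin \o (fun v => g v * slice k phi x v)).
  apply: integrable_loc_test => //; [exact: Lfun_loc_integrable gp|exact: test_function_continuous|by case: ts].
transitivity (c%:E * \int[leb 1 d]_v (u k v * partial (0, i) (slice k phi x) v)%:E)%E.
  rewrite -(integralZl measurableT i3); apply: eq_integral => v _ /=.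
  rewrite -{1}(subst_fun_id k u) rprod_insert_row -/c partial_slice -EFinM; congr EFin.
  by rewrite /slice; ring.
rewrite wug// -mulN1e muleA -(integralZl measurableT i4); apply: eq_integral => v _ /=.
by rewrite rprod_insert_row -/c -!EFinM; congr EFin; rewrite /slice; ring.
Qed.

End product_rule.

(** * Convergence of integrals with converging bounds *)

Section ereal_limits.
Context {R : realType}.

Lemma ecvg0P (a : nat -> \bar R) : (forall n, 0 <= a n)%E ->
  (a n @[n --> \oo] --> 0%E <-> forall e : R, 0 < e -> \forall n \near \oo, (a n <= e%:E)%E).
Proof.
move=> a0; split=> [/fine_cvgP[af ac] e e0|H].
  near=> n; have fn : a n \is a fin_num by near: n.
  rewrite -(fineK fn) lee_fin (le_trans (ler_norm _))//.
  by near: n; move/cvgr0Pnorm_le : ac; exact.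
apply/fine_cvgP; split.
  near=> n; rewrite ge0_fin_numE//; apply: (@le_lt_trans _ _ 1%:E); last exact: ltry.
  by near: n; exact: H.
apply/cvgr0Pnorm_le => e e0; near=> n.
have an : (a n <= e%:E)%E by near: n; exact: H.
rewrite /= ger0_norm ?fine_ge0// -lee_fin fineK// ge0_fin_numE//.
by rewrite (le_lt_trans an)// ltry.
Unshelve. all: by end_near. Qed.

(** Otherwise some subsequence stays away from 0. *)
Lemma cvg0_subseq (a : nat -> \bar R) : (forall n, 0 <= a n)%E ->
  (forall s : nat -> nat, (forall n, n <= s n)%N ->
    exists2 t : nat -> nat, (forall n, n <= t n)%N & a (s (t n)) @[n --> \oo] --> 0%E) ->
  a n @[n --> \oo] --> 0%E.
Proof.
move=> a0 H; apply/ecvg0P => // e e0; apply: contrapT => nH.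
have /choice[s hs] : forall n, exists m, (n <= m)%N /\ (e%:E < a m)%E.
  move=> n; apply: contrapT => nm; apply: nH; exists n => // m /= nm'.
  by rewrite leNgt; apply/negP => em; apply: nm; exists m.
have [t _ /ecvg0P ac] := H s (fun n => (hs n).1).
have [] := ac (fun n => a0 _) _ e0; move=> m _ /(_ m (leqnn m)).
by rewrite leNgt => /negP; apply; exact: (hs _).2.
Qed.

Lemma ex_fast_subseq (a : nat -> \bar R) (b : nat -> R) : (forall n, 0 <= a n)%E ->
  a n @[n --> \oo] --> 0%E -> (forall n, 0 < b n) ->
  exists2 t : nat -> nat, (forall n, n <= t n)%N & forall n, (a (t n) <= (b n)%:E)%E.
Proof.
move=> a0 /ecvg0P ac b0.
have /choice[t ht] : forall n, exists m, (n <= m)%N /\ (a m <= (b n)%:E)%E.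
  move=> n; have [M _ hM] := ac a0 _ (b0 n).
  by exists (maxn n M); split; [exact: leq_maxl|apply: hM; exact: leq_maxr].
by exists t => n; have [] := ht n.
Qed.

Lemma cvg_subseq (T : topologicalType) (u : nat -> T) (l : T) (s : nat -> nat) : (forall n, n <= s n)%N ->
  u n @[n --> \oo] --> l -> u (s n) @[n --> \oo] --> l.
Proof.
move=> hs ul; apply: cvg_trans ul => A [N _ NA]; exists N => // n /= Nn; apply: NA => /=; exact: leq_trans (hs n).
Qed.

(** By continuity of exp and ln if the limit is positive, directly if it is 0. *)
Lemma cvg_powR (f : nat -> R) l p : 0 < p -> (forall n, 0 <= f n) -> f n @[n --> \oo] --> l ->
  f n `^ p @[n --> \oo] --> l `^ p.
Proof.
move=> p0 f0 fl.
have l0 : 0 <= l by apply: (cvgr_to_ge fl); near=> n.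
have [l1|l1] := eqVneq l 0.
  rewrite l1 powR0 ?gt_eqF//; apply/cvgr0Pnorm_le => e e0.
  have e1 : 0 < e `^ p^-1 by rewrite powR_gt0.
  rewrite l1 in fl; move/cvgr0Pnorm_le : fl => /(_ _ e1); apply: filterS => n.
  rewrite ger0_norm// => h; rewrite ger0_norm ?powR_ge0//.
  rewrite (_ : e = (e `^ p^-1) `^ p); last by rewrite -powRrM mulVf ?gt_eqF// powRr1// ltW.
  by rewrite ge0_ler_powR ?nnegrE ?powR_ge0// ltW.
have lp : 0 < l by rewrite lt_neqAle eq_sym l1.
have c : (fun x : R => expR (p * ln x)) @ l --> expR (p * ln l).
  apply: continuous_cvg; first exact: continuous_expR.
  by apply: cvgMr; exact: continuous_ln.
have := cvg_comp _ _ fl c.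
rewrite [X in _ -> _ --> X]/powR (gt_eqF lp) => h; apply: cvg_trans h.
apply: near_eq_cvg; near=> n; rewrite /= /powR gt_eqF//; near: n.
exact: (cvgr_gt l).
Unshelve. all: by end_near. Qed.

(** The distance |a - b| is at most twice the larger of |a| and |b|. *)
Lemma powR_sub_le p (a b : R) : 1 <= p -> `|a - b| `^ p <= 2 `^ p * (`|a| `^ p + `|b| `^ p).
Proof.
move=> p1; have p0 : 0 <= p by rewrite (le_trans _ p1).
have h (x y : R) : 0 <= y -> y <= x -> (y + x) `^ p <= 2 `^ p * (x `^ p + y `^ p).
  move=> y0 yx; have x0 := le_trans y0 yx.
  apply: (@le_trans _ _ (2 `^ p * x `^ p)); last first.
    by rewrite ler_wpM2l ?powR_ge0// lerDl powR_ge0.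
  rewrite -powRM// ge0_ler_powR ?nnegrE ?addr_ge0 ?mulr_ge0//.
  by rewrite mulrDl mul1r lerD2r.
apply: (@le_trans _ _ ((`|a| + `|b|) `^ p)).
  by rewrite ge0_ler_powR ?nnegrE ?addr_ge0// ler_normB.
have [ab|ab] := leP `|a| `|b|; first by rewrite [X in _ * X]addrC h.
by rewrite addrC h// ltW.
Qed.

End ereal_limits.

Section pratt.
Context d (T : measurableType d) {R : realType} (mu : {measure set T -> \bar R}).
Implicit Types (f G : T -> R).

(** Dominated convergence with bounds G_n -> G whose integrals converge. The distance
|f_n - f| <= G_n + G is at most min(|f_n - f|, 2 G) + (G_n - G)^+, and
(G_n - G)^+ = (G - G_n)^+ + (G_n - G). Here min(|f_n - f|, 2 G) + (G - G_n)^+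
tends to 0 and is at most 3 G, so that dominated convergence applies, and the
integral of G_n - G tends to 0 by hypothesis. *)
Lemma pratt (f_ G_ : nat -> T -> R) f G :
  (forall n, measurable_fun [set: T] (f_ n)) -> measurable_fun [set: T] f ->
  (forall n, mu.-integrable [set: T] (EFin \o G_ n)) -> mu.-integrable [set: T] (EFin \o G) ->
  (forall n x, 0 <= G_ n x) -> (forall x, 0 <= G x) ->
  {ae mu, forall x, forall n, `|f_ n x| <= G_ n x} ->
  {ae mu, forall x, f_ n x @[n --> \oo] --> f x} ->
  {ae mu, forall x, G_ n x @[n --> \oo] --> G x} ->
  (\int[mu]_x (G_ n x)%:E @[n --> \oo] --> \int[mu]_x (G x)%:E)%E ->
  (\int[mu]_x (`|f_ n x - f x|)%:E @[n --> \oo] --> 0)%E.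
Proof.
move=> mf_ mf iG_ iG G_0 G0 fG ff GG IG.
have mG_ n : measurable_fun [set: T] (G_ n) by apply/measurable_EFinP; exact: measurable_int (iG_ n).
have mG : measurable_fun [set: T] G by apply/measurable_EFinP; exact: measurable_int iG.
pose e n x := Num.min `|f_ n x - f x| (2 * G x) + Num.max (G x - G_ n x) 0.
have me n : measurable_fun [set: T] (e n).
  apply: measurable_funD; last by apply: measurable_maxr => //; exact: measurable_funB.
  apply: measurable_minr; last exact: measurable_funM.
  by apply: measurableT_comp => //; exact: measurable_funB.
have e0 n x : 0 <= e n x.
  by rewrite addr_ge0// ?le_min ?normr_ge0 ?mulr_ge0 ?le_max ?lexx ?orbT.
have i3 : mu.-integrable [set: T] (fun x => 3%:E * (EFin \o G) x)%E by exact: integrableZl.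
have e3 n x : (`|(e n x)%:E| <= 3%:E * (EFin \o G) x)%E.
  rewrite /= lee_fin ger0_norm// (_ : 3 * G x = 2 * G x + G x); last by ring.
  by rewrite lerD// ?ge_min ?lexx ?orbT// ge_max G0 lerBlDr lerDl G_0.
have ie n : mu.-integrable [set: T] (EFin \o e n).
  apply: (le_integrable measurableT _ _ i3); first exact/measurable_EFinP.
  by move=> x _; rewrite (le_trans (e3 n x))// lee_abs.
have [_ _ Ie] : [/\ mu.-integrable [set: T] (cst 0%E : T -> \bar R),
    [sequence (\int[mu]_x `|(e n x)%:E - 0|)%E]_n @ \oo --> 0%E &
    [sequence (\int[mu]_x (e n x)%:E)%E]_n @ \oo --> (\int[mu]_x 0)%E].
  apply: (@dominated_convergence _ _ _ mu _ measurableT (fun n => EFin \o e n) _ (fun x => 3%:E * (EFin \o G) x)%E) => //.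
  - by move=> n; exact/measurable_EFinP.
  - apply: filterS2 ff GG => x fx Gx _; apply: (@cvg_EFin R _ _ _ (fun n => (e n x)%:E) 0); first by near=> n.
    rewrite /comp/= /e.
    apply: (@squeeze_cvgr _ _ _ _ (fun=> 0) (fun n => `|f_ n x - f x| + `|G x - G_ n x|)).
    + near=> n; rewrite -/(e n x) e0/= lerD// ?ge_min ?lexx//.
      by rewrite ge_max ler_norm normr_ge0.
    + exact: cvg_cst.
    + rewrite [X in _ --> X](_ : 0 = `|f x - f x| + `|G x - G x|); last by rewrite !subrr normr0 addr0.
      by apply: cvgD; apply: cvg_norm; apply: cvgB => //; exact: cvg_cst.
  - by apply: aeW => x n _; exact: e3.
rewrite integral0 in Ie.
have bd n : (\int[mu]_x (`|f_ n x - f x|)%:E <= \int[mu]_x (e n x)%:E + (\int[mu]_x (G_ n x)%:E - \int[mu]_x (G x)%:E))%E.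
  have iD := integrableB measurableT (iG_ n) iG.
  rewrite -(integralB measurableT (iG_ n) iG) -(integralD measurableT (ie n) iD).
  have k0 x : 0 <= e n x + (G_ n x - G x).
    rewrite /e -addrA addr_ge0// ?le_min ?normr_ge0 ?mulr_ge0//.
    by rewrite -(opprB (G x)) subr_ge0 le_max lexx.
  apply: ae_ge0_le_integral => //.
  - by apply/measurable_EFinP; apply: measurableT_comp => //; exact: measurable_funB.
  - by move=> x _; rewrite -EFinB -EFinD lee_fin.
  - apply: measurable_int (integrableD measurableT (ie n) iD).
  apply: filterS3 fG ff GG => x fGx fx Gx _; rewrite -EFinB -EFinD lee_fin.
  have fG1 : `|f x| <= G x.
    by apply: (@ler_cvg_to _ _ _ _ _ _ _ _ (cvg_norm fx) Gx); near=> m.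
  have fG2 : `|f_ n x - f x| <= G_ n x + G x by rewrite (le_trans (ler_normB _ _))// lerD.
  rewrite /e; have [h1|h1] := leP `|f_ n x - f x| (2 * G x).
    by rewrite -addrA lerDl -(opprB (G x)) subr_ge0 le_max lexx.
  apply: (le_trans fG2); rewrite (_ : G_ n x + G x = 2 * G x + 0 + (G_ n x - G x)); last by ring.
  by rewrite lerD2r lerD2l le_max lexx orbT.
apply: (@squeeze_cvge _ _ _ _ (fun=> 0%E) _ (fun n => \int[mu]_x (e n x)%:E + (\int[mu]_x (G_ n x)%:E - \int[mu]_x (G x)%:E))%E); [|exact: cvg_cst|].
  by near=> n; rewrite integral_ge0 //= bd.
rewrite [X in _ --> X](_ : _ = 0%E + (\int[mu]_x (G x)%:E - \int[mu]_x (G x)%:E))%E; last first.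
  by rewrite subee ?adde0//; exact: (integrable_fin_num measurableT iG).
apply: cvgeD => //; apply: cvgeB => //; last exact: cvg_cst.
by rewrite fin_num_adde_defl// fin_numN; exact: (integrable_fin_num measurableT iG).
Unshelve. all: by end_near. Qed.

Lemma cvg_integral_L1 (f_ : nat -> T -> R) f :
  (forall n, mu.-integrable [set: T] (EFin \o f_ n)) -> mu.-integrable [set: T] (EFin \o f) ->
  (\int[mu]_x (`|f_ n x - f x|)%:E @[n --> \oo] --> 0)%E ->
  (\int[mu]_x (f_ n x)%:E @[n --> \oo] --> \int[mu]_x (f x)%:E)%E.
Proof.
move=> if_ if0 /ecvg0P H.
have fn := integrable_fin_num measurableT if0.
have fnn n := integrable_fin_num measurableT (if_ n).
rewrite -(fineK fn); apply/fine_cvgP; split; first by apply: nearW => n; exact: fnn.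
apply/cvgrPdist_le => e e0; near=> n.
have nI : (\int[mu]_x (`|f_ n x - f x|)%:E <= e%:E)%E.
  by near: n; apply: H => // n; rewrite integral_ge0.
rewrite distrC -lee_fin; apply: le_trans nI.
have -> : (fine \o (fun n => \int[mu]_x (f_ n x)%:E)%E) n = fine (\int[mu]_x (EFin \o f_ n) x)%E by [].
rewrite -abse_EFin EFinB !fineK// -(integralB measurableT (if_ n) if0).
apply: le_trans (le_abse_integral _ measurableT _) _; last by [].
exact: measurable_int (integrableB measurableT (if_ n) if0).
Unshelve. all: by end_near. Qed.

(** The sum of the g_n has a finite integral, hence is finite almost everywhere. The
form of the bound 2^-n is that of [epsilon_trick0]. *)
Lemma ae_cvg0_summable (g : nat -> T -> R) :
  (forall n, measurable_fun [set: T] (g n)) -> (forall n x, 0 <= g n x) ->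
  (forall n, \int[mu]_x (g n x)%:E <= (2 / (2 ^ n.+1)%:R)%:E)%E ->
  {ae mu, forall x, g n x @[n --> \oo] --> 0}.
Proof.
move=> mg g0 Ig.
have mS : measurable_fun [set: T] (fun x => \sum_(n <oo) (g n x)%:E)%E.
  apply: ge0_emeasurable_sum => [n x _ _|n _]; first by rewrite lee_fin.
  exact/measurable_EFinP.
have iS : mu.-integrable [set: T] (fun x => \sum_(n <oo) (g n x)%:E)%E.
  apply/integrableP; split => //.
  under eq_integral => x _.
    rewrite gee0_abs; last by apply: nneseries_ge0 => n _ _; rewrite lee_fin.
    over.
  rewrite integral_nneseries//; last 2 first.
  - by move=> n; exact/measurable_EFinP.
  - by move=> n x _; rewrite lee_fin.
  apply: (@le_lt_trans _ _ (\sum_(n <oo) (2 / (2 ^ n.+1)%:R)%:E)%E).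
    by apply: lee_nneseries => n _ //; rewrite integral_ge0// => x _; rewrite lee_fin.
  by apply: (le_lt_trans (@epsilon_trick0 R 2 xpredT _)) => //; rewrite ltry.
have := integrable_ae measurableT iS; apply: filterS => x /(_ I) fx.
have gx0 n : (0 <= (g n x)%:E)%E by rewrite lee_fin.
have H : (\sum_(n <= k <oo) (g k x)%:E @[n --> \oo] --> 0)%E.
  apply: nneseries_tail_cvg => //; rewrite ltey_eq fx//.
suff : ((g n x)%:E @[n --> \oo] --> 0)%E by case/fine_cvgP.
apply: (@squeeze_cvge _ _ _ _ (fun=> 0%E) _ (fun n => \sum_(n <= k <oo) (g k x)%:E)%E) => //; last exact: cvg_cst.
near=> n; rewrite gx0/=.
apply: le_trans (nneseries_lim_ge n.+1 _); last by [].
by rewrite big_nat1.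
Unshelve. all: by end_near. Qed.

Variable p : R.
Hypothesis p1 : 1 <= p.
Let p0 : 0 < p. Proof. exact: lt_le_trans p1. Qed.

(** [pratt] applied to |f_n - f|^p, which is at most 2^p (G_n + G). *)
Lemma Lp_cvg_dominated (f_ G_ : nat -> T -> R) f G :
  (forall n, measurable_fun [set: T] (f_ n)) -> measurable_fun [set: T] f ->
  (forall n, mu.-integrable [set: T] (EFin \o G_ n)) -> mu.-integrable [set: T] (EFin \o G) ->
  (forall n x, 0 <= G_ n x) -> (forall x, 0 <= G x) ->
  (forall n x, `|f_ n x| `^ p <= G_ n x) ->
  {ae mu, forall x, f_ n x @[n --> \oo] --> f x} ->
  {ae mu, forall x, G_ n x @[n --> \oo] --> G x} ->
  (\int[mu]_x (G_ n x)%:E @[n --> \oo] --> \int[mu]_x (G x)%:E)%E ->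
  (\int[mu]_x (`|f_ n x - f x| `^ p)%:E @[n --> \oo] --> 0)%E.
Proof.
move=> mf_ mf iG_ iG G_0 G0 fG ff GG IG.
pose H n x := 2 `^ p * (G_ n x + G x); pose H0 x := 2 `^ p * (G x + G x).
have iD n : mu.-integrable [set: T] (EFin \o (fun x => G_ n x + G x)).
  exact: (integrableD measurableT (iG_ n) iG).
have iD0 : mu.-integrable [set: T] (EFin \o (fun x => G x + G x)).
  exact: (integrableD measurableT iG iG).
have E n : (\int[mu]_x (`|f_ n x - f x| `^ p)%:E = \int[mu]_x (`| `|f_ n x - f x| `^ p - cst 0%R x|)%:E)%E.
  by apply: eq_integral => x _; rewrite /cst subr0 (ger0_norm (powR_ge0 _ _)).
under eq_fun do rewrite E.
apply: (@pratt (fun n x => `|f_ n x - f x| `^ p) H (cst 0) H0).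
- move=> n; apply/measurable_EFinP; apply: measurable_abs_powR; exact: measurable_funB.
- exact: measurable_cst.
- by move=> n; exact: (integrableZl measurableT _ (iD n)).
- exact: (integrableZl measurableT _ iD0).
- by move=> n x; rewrite mulr_ge0 ?powR_ge0 ?addr_ge0.
- by move=> x; rewrite mulr_ge0 ?powR_ge0 ?addr_ge0.
- apply: filterS2 ff GG => x fx Gx n; rewrite ger0_norm ?powR_ge0//.
  rewrite (le_trans (powR_sub_le _ _ p1))// ler_wpM2l ?powR_ge0// lerD//.
  have fpx : `|f_ n x| `^ p @[n --> \oo] --> `|f x| `^ p.
    by apply: cvg_powR => //; exact: cvg_norm.
  by apply: (@ler_cvg_to _ _ _ _ _ _ _ _ fpx Gx); near=> m.
- apply: filterS ff => x fx; rewrite -(@powR0 R p) ?gt_eqF//; apply: cvg_powR => //.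
  rewrite -(normr0 R) -(subrr (f x)); apply: cvg_norm; apply: cvgB => //; exact: cvg_cst.
- apply: filterS GG => x Gx; apply: cvgMr; apply: cvgD => //; exact: cvg_cst.
- have {}E n : (\int[mu]_x (H n x)%:E = (2 `^ p)%:E * (\int[mu]_x (G_ n x)%:E + \int[mu]_x (G x)%:E))%E.
    rewrite -(integralD measurableT (iG_ n) iG) -(integralZl measurableT (iD n)).
    by apply: eq_integral => x _; rewrite -EFinM.
  have E0 : (\int[mu]_x (H0 x)%:E = (2 `^ p)%:E * (\int[mu]_x (G x)%:E + \int[mu]_x (G x)%:E))%E.
    rewrite -(integralD measurableT iG iG) -(integralZl measurableT iD0).
    by apply: eq_integral => x _; rewrite -EFinM.
  rewrite E0; under eq_fun do rewrite E.
  apply: cvgeZl => //; apply: cvgeD => //; last exact: cvg_cst.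
  by rewrite fin_num_adde_defl//; exact: (integrable_fin_num measurableT iG).
Unshelve. all: by end_near. Qed.

(** Continuity of the norm, from [pratt] with the bounds
2^p (|f_n - f|^p + |f|^p). *)
Lemma Lp_cvg_norm (f_ : nat -> T -> R) f :
  (forall n, measurable_fun [set: T] (f_ n)) -> measurable_fun [set: T] f ->
  mu.-integrable [set: T] (fun x => (`|f x| `^ p)%:E) ->
  (forall n, mu.-integrable [set: T] (fun x => (`|f_ n x - f x| `^ p)%:E)) ->
  {ae mu, forall x, f_ n x @[n --> \oo] --> f x} ->
  (\int[mu]_x (`|f_ n x - f x| `^ p)%:E @[n --> \oo] --> 0)%E ->
  (\int[mu]_x (`|f_ n x| `^ p)%:E @[n --> \oo] --> \int[mu]_x (`|f x| `^ p)%:E)%E.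
Proof.
move=> mf_ mf if0 ifd ff I0.
pose H n x := 2 `^ p * (`|f_ n x - f x| `^ p + `|f x| `^ p); pose H0 x := 2 `^ p * `|f x| `^ p.
have iD n : mu.-integrable [set: T] (EFin \o (fun x => `|f_ n x - f x| `^ p + `|f x| `^ p)).
  exact: (integrableD measurableT (ifd n) if0).
have iH n : mu.-integrable [set: T] (EFin \o H n) by exact: (integrableZl measurableT _ (iD n)).
have iH0 : mu.-integrable [set: T] (EFin \o H0) by exact: (integrableZl measurableT _ if0).
have fH n x : `|f_ n x| `^ p <= H n x.
  have := powR_sub_le (f_ n x - f x) (- f x) p1.
  by rewrite opprK subrK normrN.
have fpx : {ae mu, forall x, `|f_ n x| `^ p @[n --> \oo] --> `|f x| `^ p}.
  by apply: filterS ff => x fx; apply: cvg_powR => //; exact: cvg_norm.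
apply: cvg_integral_L1 => //.
  move=> n; apply: (le_integrable measurableT _ _ (iH n)).
    exact: measurable_abs_powR.
  by move=> x _; rewrite /= lee_fin ger0_norm ?powR_ge0// (le_trans (fH n x))// ler_norm.
apply: (@pratt _ H _ H0) => //.
- move=> n; apply/measurable_EFinP; exact: measurable_abs_powR.
- apply/measurable_EFinP; exact: measurable_abs_powR.
- by move=> n x; rewrite mulr_ge0 ?powR_ge0 ?addr_ge0 ?powR_ge0.
- by move=> x; rewrite mulr_ge0 ?powR_ge0.
- by apply: aeW => x n; rewrite ger0_norm ?powR_ge0.
- apply: filterS ff => x fx; apply: cvgMr; rewrite -[X in _ --> X]add0r.
  apply: cvgD; last exact: cvg_cst.
  rewrite -(@powR0 R p) ?gt_eqF//; apply: cvg_powR => //.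
  rewrite -(normr0 R) -(subrr (f x)); apply: cvg_norm; apply: cvgB => //; exact: cvg_cst.
- have E n : (\int[mu]_x (H n x)%:E = (2 `^ p)%:E * (\int[mu]_x (`|f_ n x - f x| `^ p)%:E + \int[mu]_x (`|f x| `^ p)%:E))%E.
    rewrite -(integralD measurableT (ifd n) if0) -(integralZl measurableT (iD n)).
    by apply: eq_integral => x _; rewrite -EFinM.
  have E0 : (\int[mu]_x (H0 x)%:E = (2 `^ p)%:E * (0 + \int[mu]_x (`|f x| `^ p)%:E))%E.
    by rewrite add0e -(integralZl measurableT if0).
  rewrite E0; under eq_fun do rewrite E.
  by apply: cvgeZl => //; apply: cvgeD => //; exact: cvg_cst.
Qed.

End pratt.

(** * The p-th root of the density of Theta as a Sobolev function *)

Lemma sqnorm_delta (R : realType) N d (k : 'I_N) (i : 'I_d) : sqnorm (delta_mx k i : 'M[R]_(N, d)) = 1.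
Proof.
rewrite /sqnorm (bigD1 k)//= (bigD1 i)//= mxE !eqxx expr1n !big1 ?addr0// => [j jk|j ji].
  by rewrite big1// => l _; rewrite mxE (negbTE jk) expr0n.
by rewrite mxE (negbTE ji) andbF expr0n.
Qed.

Lemma row_delta (R : realType) N d (k j : 'I_N) (i : 'I_d) : j != k ->
  row j (delta_mx k i : 'M[R]_(N, d)) = 0.
Proof. by move=> jk; apply/rowP => l; rewrite !mxE (negbTE jk). Qed.

Section theta_sobolev.
Context {R : realType} {N d : nat}.
Local Notation X := 'M[R]_(N.+1, d).
Local Notation V := 'rV[R]_d.
Local Notation leb m n := (@lebesgue_mx R m n).
Variables p eps : R.
Hypothesis p1 : 1 <= p.
Hypothesis e0 : 0 < eps.
Variables (mu : probability X R) (u : 'I_N.+1 -> V -> R).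

Definition hfun (x : X) : R := Hfun eps mu x `^ p^-1.

(** The p-th root of the density of Theta; see [root_density_Theta]. *)
Definition Wfun (x : X) : R := hfun x * rprod u x.

(** The product rule for h u_1 ... u_N when g is the derivative of u_k. *)
Definition Vfun k i (g : V -> R) (x : X) : R :=
  hfun x * rprod (subst_fun k u g) x + partial (k, i) hfun x * rprod u x.

(** The function that dominates |V_ki|^p: the two terms bound the p-th powers of the
two terms of [Vfun]. *)
Definition Vdom k i (g : V -> R) (x : X) : R :=
  2 `^ p * (Hfun eps mu x * (`|g (row k x)| `^ p * \prod_(j | j != k) (u j (row j x) `^ p)) +
    expR (2 * eps)^-1 * (Hfun eps mu (x + delta_mx k i) *
      (u k (row k x) `^ p * \prod_(j | j != k) (u j (row j x) `^ p)) +
      Hfun eps mu (x - delta_mx k i) *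
      (u k (row k x) `^ p * \prod_(j | j != k) (u j (row j x) `^ p)))).

Hypotheses (up : forall j, u j \in Lfun (leb 1 d) p%:E) (u0 : forall j v, 0 <= u j v).
Hypothesis muE : forall j A, measurable A ->
  marginal j mu A = (\int[leb 1 d]_(v in A) (u j v `^ p)%:E)%E.

Let p0 : 0 < p. Proof. exact: lt_le_trans p1. Qed.
Let N0 : (0 < N.+1)%N. Proof. by []. Qed.

Let mLfun (g : V -> R) : g \in Lfun (leb 1 d) p%:E -> measurable_fun [set: V] g.
Proof. by case/(Lfun_finP (leb 1 d) p1). Qed.

Let mu_ j : measurable_fun [set: V] (fun v => u j v `^ p).
Proof. by apply: measurable_powR_comp; exact: mLfun. Qed.

Let H0 x : 0 < Hfun eps mu x. Proof. exact: Hfun_gt0. Qed.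

Lemma hfun_powR x : hfun x `^ p = Hfun eps mu x.
Proof. by rewrite /hfun -powRrM mulVf ?gt_eqF// powRr1// ltW. Qed.

Lemma hfun_ge0 x : 0 <= hfun x. Proof. exact: powR_ge0. Qed.

Lemma smooth_hfun : smooth hfun.
Proof. by apply: smooth_algP; apply: smooth_alg_pow => //; exact: smooth_alg_Hfun. Qed.

(** The logarithmic derivative of h is 1/p times that of H. *)
Lemma partial_hfun ij x : partial ij hfun x = hfun x * (p^-1 * (partial ij (Hfun eps mu) x / Hfun eps mu x)).
Proof.
have [df _] := smooth_alg_partial (smooth_alg_Hfun e0 N0 mu).
have [_] := @derive_comp1 _ _ _ (@powR R ^~ p^-1) _ x (delta_mx ij.1 ij.2) _ (df x) (@is_derive1_powR R p^-1 _ (H0 x)).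
rewrite /partial => ->.
have -> : Hfun eps mu x `^ (p^-1 - 1) = hfun x / Hfun eps mu x.
  rewrite powRD; last by rewrite (gt_eqF (H0 x)) implybT.
  by rewrite powR_inv1// ltW.
ring.
Qed.

(** With t the logarithmic derivative of H, |t / p|^p <= exp |t| <= exp t + exp (-t),
and [Hfun_tilt] in the directions e_ki and - e_ki bounds H exp t and H exp (-t). *)
Lemma partial_hfun_le k i x : `|partial (k, i) hfun x| `^ p <=
  expR (2 * eps)^-1 * (Hfun eps mu (x + delta_mx k i) + Hfun eps mu (x - delta_mx k i)).
Proof.
rewrite partial_hfun; set t := _ / _.
have t1 := Hfun_tilt e0 N0 mu x (delta_mx k i).
have t2 := Hfun_tilt e0 N0 mu x (- delta_mx k i).
rewrite sqnormN !sqnorm_delta mulr1 in t1 t2.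
have dN : 'D_(- delta_mx k i) (Hfun eps mu) x = - 'D_(delta_mx k i) (Hfun eps mu) x.
  have [df _] := smooth_alg_partial (smooth_alg_Hfun e0 N0 mu).
  by rewrite !deriveE// linearN.
rewrite dN mulNr in t2.
rewrite normrM powRM// (ger0_norm (hfun_ge0 _)) hfun_powR.
have pt : `|p^-1 * t| `^ p <= expR t + expR (- t).
  rewrite normrM (@ger0_norm _ p^-1) ?invr_ge0 ?(ltW p0)//.
  set s := p^-1 * `|t|; have s0 : 0 <= s by rewrite mulr_ge0// invr_ge0 ltW.
  apply: (@le_trans _ _ (expR s `^ p)).
    rewrite ge0_ler_powR ?nnegrE ?expR_ge0// ?(ltW p0)//.
    by rewrite (le_trans _ (expR_ge1Dx _))// lerDr.
  rewrite -expRM mulrC mulrA divff ?gt_eqF// mul1r.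
  have [h|h] := leP 0 t; first by rewrite ger0_norm// lerDl expR_ge0.
  by rewrite ltr0_norm// lerDr expR_ge0.
apply: (le_trans (ler_wpM2l (ltW (H0 x)) pt)).
rewrite mulrDr [leRHS]mulrDr; apply: lerD; [exact: t1|exact: t2].
Qed.

Lemma rprod_powR x : rprod (fun j v => u j v `^ p) x = rprod u x `^ p.
Proof.
have r0 : 0 <= rprod u x by exact: prodr_ge0.
rewrite -[in RHS](ger0_norm r0) powR_prod_abs//; apply: eq_bigr => j _.
by rewrite ger0_norm.
Qed.

Lemma Wfun_powR x : Wfun x `^ p = tdens eps mu (fun j v => u j v `^ p) x.
Proof.
by rewrite /Wfun powRM ?hfun_ge0 ?prodr_ge0// hfun_powR -rprod_powR.
Qed.

Lemma Wfun_ge0 x : 0 <= Wfun x.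
Proof. by rewrite mulr_ge0 ?hfun_ge0 ?prodr_ge0. Qed.

Let r0 j v : 0 <= u j v `^ p. Proof. exact: powR_ge0. Qed.

Lemma root_density_Theta : Theta eps mu `<< leb N.+1 d /\
  {ae leb N.+1 d, forall x, root_density p (Theta eps mu) x = Wfun x}.
Proof.
have [h1 h2] := @root_density_unique _ _ _ p (Theta eps mu) _
  (@measurable_tdens _ _ _ _ e0 N0 mu (fun j v => u j v `^ p) mu_) (tdens_ge0 e0 N0 mu r0) (Theta_density e0 N0 mu_ r0 muE).
split => //; apply: filterS h2 => x ->.
by rewrite -Wfun_powR powR_Kinv// Wfun_ge0.
Qed.

Lemma measurable_hfun : measurable_fun [set: X] hfun.
Proof. by apply: measurable_continuous; apply: smooth_continuous; exact: smooth_hfun. Qed.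

Lemma measurable_partial_hfun ij : measurable_fun [set: X] (partial ij hfun).
Proof. by apply: measurable_continuous; apply: smooth_continuous; apply: smooth_partial; exact: smooth_hfun. Qed.

Lemma measurable_rprod_u : measurable_fun [set: X] (rprod u).
Proof. by apply: measurable_prod_rows => j; exact: mLfun. Qed.

Lemma Wfun_Lfun : Wfun \in Lfun (leb N.+1 d) p%:E.
Proof.
apply/(Lfun_finP _ p1); split.
  by apply: measurable_funM; [exact: measurable_hfun|exact: measurable_rprod_u].
under eq_integral do rewrite (ger0_norm (Wfun_ge0 _)) Wfun_powR.
by rewrite (integral_tdens e0 N0 mu_ r0 muE) ltry.
Qed.

Section directional.
Variables (k : 'I_N.+1) (i : 'I_d) (g : V -> R).
Hypothesis gp : g \in Lfun (leb 1 d) p%:E.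

Let mg : measurable_fun [set: V] (fun v => `|g v| `^ p).
Proof. by apply/measurable_EFinP; apply: measurable_abs_powR; exact: mLfun. Qed.

(** The inequality |a + b|^p <= 2^p (|a|^p + |b|^p), then the rows j <> k carry
u_j^p = r_j. *)
Lemma Vfun_le x : `|Vfun k i g x| `^ p <= Vdom k i g x.
Proof.
have := powR_sub_le (hfun x * rprod (subst_fun k u g) x) (- (partial (k, i) hfun x * rprod u x)) p1.
rewrite opprK => /le_trans; apply; rewrite ler_wpM2l ?powR_ge0// lerD//.
  rewrite normrM powRM// (ger0_norm (hfun_ge0 _)) hfun_powR powR_prod_abs//.
  rewrite (bigD1 k)//= /subst_fun eqxx ler_wpM2l ?(ltW (H0 x))// ler_wpM2l ?powR_ge0//.
  rewrite (eq_bigr (fun j => u j (row j x) `^ p))// => j jk.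
  by rewrite (negbTE jk) ger0_norm.
rewrite normrN normrM powRM// -mulrDl mulrA ler_pM ?powR_ge0 ?partial_hfun_le//.
rewrite (@ger0_norm _ (rprod u x)) ?prodr_ge0// -rprod_powR.
by rewrite /rprod (bigD1 k).
Qed.

Lemma Vdom_ge0 x : 0 <= Vdom k i g x. Proof. by rewrite (le_trans _ (Vfun_le x)) ?powR_ge0. Qed.

Let mass W (f : V -> R) : measurable_fun [set: V] f -> (forall v, 0 <= f v) ->
  (forall j, j != k -> row j W = 0) ->
  (\int[leb N.+1 d]_x (Hfun eps mu (x + W) * (f (row k x) * \prod_(j | j != k) (u j (row j x) `^ p)))%:E =
   \int[leb 1 d]_v (f v)%:E)%E.
Proof. by move=> mf f0 W0; exact: (theta_mass e0 N0 mu_ r0 muE mf f0 W0). Qed.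

Lemma measurable_mass W (f : V -> R) : measurable_fun [set: V] f ->
  measurable_fun [set: X] (fun x =>
    Hfun eps mu (x + W) * (f (row k x) * \prod_(j | j != k) (u j (row j x) `^ p))).
Proof.
move=> mf.
have -> : (fun x : X => Hfun eps mu (x + W) * (f (row k x) * \prod_(j | j != k) (u j (row j x) `^ p))) =
    fun x => Hfun eps mu (x + W) * rprod (subst_fun k (fun j v => u j v `^ p) f) x.
  by apply/funext => x; rewrite rprod_subst.
apply: measurable_funM.
  apply: (measurableT_comp (measurable_Hfun e0 N0 mu)).
  apply: measurable_fun_mxP => a b; under eq_fun do rewrite mxE.
  by apply: measurable_funD => //; exact: measurable_mx_coord.
by apply: measurable_prod_rows => j; rewrite /subst_fun; case: (j == k) => //; exact: mu_.
Qed.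

Lemma measurable_Vdom : measurable_fun [set: X] (Vdom k i g).
Proof.
apply: measurable_funM => //; apply: measurable_funD.
  have := @measurable_mass 0 _ mg; apply: eq_measurable_fun => x _.
  by rewrite addr0.
apply: measurable_funM => //; apply: measurable_funD; exact: (@measurable_mass _ _ (mu_ k)).
Qed.

(** Three instances of [theta_mass]: one with |g|^p in place of r_k, and two with r_k
itself and H translated by e_ki and - e_ki. *)
Lemma integral_Vdom : (\int[leb N.+1 d]_x (Vdom k i g x)%:E =
  (2 `^ p)%:E * (\int[leb 1 d]_v (`|g v| `^ p)%:E + (expR (2 * eps)^-1 * 2)%:E))%E.
Proof.
have pr0 x : 0 <= \prod_(j | j != k) (u j (row j x) `^ p) by apply: prodr_ge0.
have t0 W (f : V -> R) (f0 : forall v, 0 <= f v) x :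
    (0 <= (Hfun eps mu (x + W) * (f (row k x) * \prod_(j | j != k) (u j (row j x) `^ p)))%:E)%E.
  by rewrite lee_fin mulr_ge0 ?(ltW (H0 _))// mulr_ge0.
have g0 v : 0 <= `|g v| `^ p by exact: powR_ge0.
have m1 := measurable_mass 0 mg.
have m2 := measurable_mass (delta_mx k i) (mu_ k).
have m3 := measurable_mass (- delta_mx k i) (mu_ k).
have Ik : (\int[leb 1 d]_v (u k v `^ p)%:E = 1)%E by exact: (@integral_r _ _ _ mu (fun j v => u j v `^ p) muE k).
pose a W (f : V -> R) (x : X) := (Hfun eps mu (x + W) * (f (row k x) * \prod_(j | j != k) (u j (row j x) `^ p)))%:E.
transitivity (\int[leb N.+1 d]_x ((2 `^ p)%:E * (a 0%R (fun v => `|g v| `^ p)%R x +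
    (expR (2 * eps)^-1)%:E * (a (delta_mx k i) (fun v => u k v `^ p)%R x + a (- delta_mx k i)%R (fun v => u k v `^ p)%R x))))%E.
  by apply: eq_integral => x _; rewrite /a -!EFinD -!EFinM addr0.
have am W (f : V -> R) : measurable_fun [set: V] f -> measurable_fun [set: X] (a W f).
  by move=> mf; apply/measurable_EFinP; exact: measurable_mass.
have a0 W f (f0 : forall v, 0 <= f v) x : (0 <= a W f x)%E by exact: t0.
rewrite ge0_integralZl//; last 2 first.
- by apply: emeasurable_funD; [exact: am|apply: emeasurable_funM => //; apply: emeasurable_funD; exact: am].
- by move=> x _; rewrite adde_ge0 ?mule_ge0 ?adde_ge0 ?a0// lee_fin expR_ge0.
congr (_ * _)%E; rewrite ge0_integralD//; last 4 first.
- by move=> x _; exact: a0.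
- exact: am.
- by move=> x _; rewrite mule_ge0 ?adde_ge0 ?a0// lee_fin expR_ge0.
- by apply: emeasurable_funM => //; apply: emeasurable_funD; exact: am.
rewrite ge0_integralZl//; try solve [by apply: emeasurable_funD; exact: am
  | by move=> x _; rewrite adde_ge0 ?a0 | by rewrite lee_fin expR_ge0].
rewrite ge0_integralD//; try solve [exact: am | by move=> x _; exact: a0].
congr (_ + _)%E; first by apply: mass => // j _; exact: row0.
rewrite [RHS]EFinM; congr (_ * _)%E; rewrite [RHS](_ : _ = 1 + 1)%E; last by rewrite -EFinD.
congr (_ + _)%E; rewrite -Ik.
- by apply: mass => // j jk; exact: row_delta.
- by apply: mass => // j jk; rewrite linearN/= row_delta// oppr0.
Qed.

Lemma integrable_Vdom : (leb N.+1 d).-integrable [set: X] (EFin \o Vdom k i g).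
Proof.
apply/integrableP; split; first by apply/measurable_EFinP; exact: measurable_Vdom.
under eq_integral do rewrite /= (ger0_norm (Vdom_ge0 _)).
rewrite integral_Vdom lte_mul_pinfty ?lee_fin ?powR_ge0// lte_add_pinfty ?ltry//.
by have [] := (Lfun_finP (leb 1 d) p1 g).1 gp.
Qed.

Lemma measurable_Vfun : measurable_fun [set: X] (Vfun k i g).
Proof.
apply: measurable_funD; apply: measurable_funM.
- exact: measurable_hfun.
- by apply: measurable_prod_rows => j; apply: mLfun; exact: Lfun_subst.
- exact: measurable_partial_hfun.
- exact: measurable_rprod_u.
Qed.

Lemma Vfun_Lfun : Vfun k i g \in Lfun (leb N.+1 d) p%:E.
Proof.
apply/(Lfun_finP _ p1); split; first exact: measurable_Vfun.
have /integrableP[_] := integrable_Vdom; apply: le_lt_trans.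
apply: ge0_le_integral => //; try solve [by move=> x _; rewrite lee_fin powR_ge0
  | by apply: measurable_abs_powR; exact: measurable_Vfun].
- by apply: measurableT_comp => //; apply/measurable_EFinP; exact: measurable_Vdom.
- by move=> x _; rewrite /= lee_fin (ger0_norm (Vdom_ge0 _)) Vfun_le.
Qed.

Lemma weak_partial_Wfun : weak_partial (0, i) (u k) g -> weak_partial (k, i) Wfun (Vfun k i g).
Proof.
move=> ug; apply: (weak_partialM p1); try exact: smooth_hfun.
- exact: Lfun_rprod.
- by apply: Lfun_rprod => //; exact: Lfun_subst.
- exact: (weak_partial_rprod p1).
Qed.

End directional.
End theta_sobolev.

(** * The Sobolev distance and L^p distances *)

Lemma ecvg0_sum (R : realType) (I : Type) (s : seq I) (a : nat -> I -> \bar R) :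
  (forall i, a n i @[n --> \oo] --> 0%E) -> (\sum_(i <- s) a n i)%E @[n --> \oo] --> 0%E.
Proof.
move=> ai; elim: s => [|i s ih]; first by under eq_fun do rewrite big_nil; exact: cvg_cst.
under eq_fun do rewrite big_cons.
have : (a n i + \sum_(j <- s) a n j)%E @[n --> \oo] --> (0 + 0)%E by exact: cvgeD.
by rewrite adde0.
Qed.

Section sobolev_distance.
Context {R : realType} {m n : nat}.
Local Notation M := 'M[R]_(m, n).
Local Notation leb := (@lebesgue_mx R m n).
Variable p : R.
Hypothesis p1 : 1 <= p.
Let p0 : 0 < p. Proof. exact: lt_le_trans p1. Qed.
Implicit Types f g u v : M -> R.

Local Notation Lp f := (f \in Lfun leb p%:E).

Let Lp_meas f : Lp f -> measurable_fun [set: M] f.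
Proof. by case/(Lfun_finP leb p1). Qed.

Lemma LfunB f g : Lp f -> Lp g -> Lp (f \- g).
Proof.
move=> /(Lfun_finP leb p1)[mf If] /(Lfun_finP leb p1)[mg Ig].
have mfp := measurable_abs_powR p mf; have mgp := measurable_abs_powR p mg.
have pw0 (h : M -> R) x : (0 <= (`|h x| `^ p)%:E)%E by rewrite lee_fin powR_ge0.
apply/(Lfun_finP leb p1); split; first exact: measurable_funB.
apply: (@le_lt_trans _ _ (\int[leb]_x ((2 `^ p)%:E * ((`|f x| `^ p)%:E + (`|g x| `^ p)%:E)))%E).
  apply: ge0_le_integral => //.
  - by apply: measurable_abs_powR; exact: measurable_funB.
  - by apply: emeasurable_funM => //; exact: emeasurable_funD.
  - by move=> x _; rewrite -EFinD -EFinM lee_fin powR_sub_le.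
rewrite ge0_integralZl//; try solve [exact: emeasurable_funD
  | by move=> x _; rewrite adde_ge0 | by rewrite lee_fin powR_ge0].
rewrite ge0_integralD// lte_mul_pinfty ?lee_fin ?powR_ge0//.
exact: lte_add_pinfty.
Qed.

Lemma ae_integral_powR f g : measurable_fun [set: M] f -> measurable_fun [set: M] g ->
  {ae leb, forall x, f x = g x} ->
  (\int[leb]_x (`|f x| `^ p)%:E = \int[leb]_x (`|g x| `^ p)%:E)%E.
Proof.
move=> mf mg fg; apply: ae_eq_integral => //; try exact: measurable_abs_powR.
by apply: filterS fg => x -> _.
Qed.

Lemma Lfun_ae f g : measurable_fun [set: M] g -> {ae leb, forall x, f x = g x} -> Lp f -> Lp g.
Proof.
move=> mg fg /(Lfun_finP leb p1)[mf If]; apply/(Lfun_finP leb p1); split => //.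
by rewrite -(ae_integral_powR mf mg fg).
Qed.

Lemma weak_partial_ae ij f g h : measurable_fun [set: M] f -> measurable_fun [set: M] g ->
  {ae leb, forall x, f x = g x} -> weak_partial ij f h -> weak_partial ij g h.
Proof.
move=> mf mg fg wf phi tp; rewrite -wf//.
have mp : measurable_fun [set: M] (partial ij phi).
  by apply: measurable_continuous; apply: test_function_continuous; exact: partial_test.
apply: ae_eq_integral => //; try by apply/measurable_EFinP; exact: measurable_funM.
by apply: filterS fg => x -> _.
Qed.

(** The chosen weak derivative satisfies its specification as soon as there is one;
it is then unique. *)
Lemma weak_derivativeP ij f g : Lp g -> weak_partial ij f g ->
  [/\ Lp (weak_derivative p ij f), weak_partial ij f (weak_derivative p ij f) &
   {ae leb, forall x, weak_derivative p ij f x = g x}].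
Proof.
move=> gp wg.
have [h1 h2] : [set g | g \in Lfun leb p%:E /\ weak_partial ij f g] (weak_derivative p ij f).
  by apply: getPex; exists g.
by split => //; exact: (weak_partial_unique p1 h1 gp h2 wg).
Qed.

Lemma weak_derivative_sobolev1 ij f : sobolev1 p f ->
  Lp (weak_derivative p ij f) /\ weak_partial ij f (weak_derivative p ij f).
Proof. by move=> [_ /(_ ij)[g gp wg]]; have [] := weak_derivativeP gp wg. Qed.

Lemma weak_derivativeB ij u v f g : Lp u -> Lp v -> Lp f -> Lp g ->
  weak_partial ij u f -> weak_partial ij v g ->
  Lp (weak_derivative p ij (u \- v)) /\
  {ae leb, forall x, weak_derivative p ij (u \- v) x = f x - g x}.
Proof.
move=> up vp fp gp wf wg.
by have [] := weak_derivativeP (LfunB fp gp) (weak_partialB p1 up fp vp gp wf wg).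
Qed.

Lemma weak_gradient_ge ij f x : `|weak_derivative p ij f x| <= weak_gradient_norm p f x.
Proof.
rewrite /weak_gradient_norm -sqrtr_sqr ler_wsqrtr//.
by rewrite (bigD1 ij)//= lerDl sumr_ge0// => k _; exact: sqr_ge0.
Qed.

(** The Euclidean norm is at most the sum of the absolute values, and each of these is
at most S^(1/p), where S is the sum of the p-th powers. *)
Lemma weak_gradient_le f x : `|weak_gradient_norm p f x| `^ p <=
  #|{: 'I_m * 'I_n}|%:R `^ p * \sum_ij `|weak_derivative p ij f x| `^ p.
Proof.
set a := fun ij => weak_derivative p ij f x; set S := \sum_ij _.
have S0 : 0 <= S by apply: sumr_ge0 => ij _; exact: powR_ge0.
have aS ij : `|a ij| <= S `^ p^-1.
  rewrite -[leLHS](powR_Kinv p1 (normr_ge0 _)) ge0_ler_powR ?nnegrE ?invr_ge0 ?powR_ge0 ?(ltW p0)//.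
  by rewrite /S (bigD1 ij)//= lerDl sumr_ge0// => k _; exact: powR_ge0.
have h : weak_gradient_norm p f x <= #|{: 'I_m * 'I_n}|%:R * S `^ p^-1.
  apply: (@le_trans _ _ (\sum_ij `|a ij|)); last first.
    by apply: (le_trans (ler_sum _ (fun ij _ => aS ij))); rewrite sumr_const mulr_natl.
  rewrite -(@ger0_norm _ (\sum_ij _)) ?sumr_ge0// -sqrtr_sqr ler_wsqrtr//.
  rewrite expr2 mulr_suml ler_sum// => ij _.
  rewrite -/(a ij) -(real_normK (num_real (a ij))) expr2 ler_wpM2l//.
  by rewrite (bigD1 ij)//= lerDl sumr_ge0.
rewrite ger0_norm ?sqrtr_ge0//.
apply: (le_trans (ge0_ler_powR _ _ _ h)); rewrite ?nnegrE ?sqrtr_ge0 ?mulr_ge0 ?powR_ge0 ?(ltW p0)//.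
by rewrite powRM ?powR_ge0// powR_invK.
Qed.

Lemma measurable_weak_gradient f : (forall ij, Lp (weak_derivative p ij f)) ->
  measurable_fun [set: M] (weak_gradient_norm p f).
Proof.
move=> wp.
have -> : weak_gradient_norm p f = fun x => (\sum_ij weak_derivative p ij f x ^+ 2) `^ 2^-1.
  by apply/funext => x; rewrite powR12_sqrt// sumr_ge0// => ij _; exact: sqr_ge0.
apply: measurable_powR_comp; apply: measurable_sum => ij; apply: measurable_funX; exact: Lp_meas.
Qed.

Lemma sobolev1_normE f : (sobolev1_norm p f `^ p =
  \int[leb]_x (`|f x| `^ p)%:E + \int[leb]_x (`|weak_gradient_norm p f x| `^ p)%:E)%E.
Proof.
rewrite /sobolev1_norm !Lnorm_powR// -poweRrM mulVf ?gt_eqF// poweRe1//.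
by rewrite adde_ge0// integral_ge0// => x _; rewrite lee_fin powR_ge0.
Qed.

Implicit Types mu nu : probability M R.

(** By uniqueness, the weak derivative of the difference is the difference of the weak
derivatives. *)
Lemma d1p_ge mu nu (e : R) : P1p p mu -> P1p p nu -> 0 <= e -> (d1p p mu nu <= e%:E)%E ->
  (\int[leb]_x (`|root_density p mu x - root_density p nu x| `^ p)%:E <= (e `^ p)%:E)%E /\
  forall ij, (\int[leb]_x (`|weak_derivative p ij (root_density p mu) x -
    weak_derivative p ij (root_density p nu) x| `^ p)%:E <= (e `^ p)%:E)%E.
Proof.
move=> Pmu Pnu e_ge0; rewrite /d1p asboolT// => de.
have {}de : (sobolev1_norm p (root_density p mu \- root_density p nu)%R `^ p <= (e `^ p)%:E)%E.
  rewrite -poweR_EFin gt0_ler_poweR ?(ltW p0)// in_itv/= ?leey ?andbT ?lee_fin//.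
  exact: poweR_ge0.
rewrite sobolev1_normE in de; set u := root_density p mu in de *; set v := root_density p nu in de *.
have I1 : (0 <= \int[leb]_x (`|(u \- v) x| `^ p)%:E)%E.
  by apply: integral_ge0 => x _; rewrite lee_fin powR_ge0.
have I2 : (0 <= \int[leb]_x (`|weak_gradient_norm p (u \- v) x| `^ p)%:E)%E.
  by apply: integral_ge0 => x _; rewrite lee_fin powR_ge0.
split; first by apply: le_trans de; rewrite leeDl.
have W ij := weak_derivativeB Pmu.2.1 Pnu.2.1
  (weak_derivative_sobolev1 ij Pmu.2).1 (weak_derivative_sobolev1 ij Pnu.2).1
  (weak_derivative_sobolev1 ij Pmu.2).2 (weak_derivative_sobolev1 ij Pnu.2).2.
move=> ij; rewrite -(ae_integral_powR (Lp_meas (W ij).1) _ (W ij).2); last first.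
  by apply: measurable_funB; apply: Lp_meas;
    [exact: (weak_derivative_sobolev1 ij Pmu.2).1|exact: (weak_derivative_sobolev1 ij Pnu.2).1].
apply: le_trans de; apply: (@le_trans _ _ (\int[leb]_x (`|weak_gradient_norm p (u \- v) x| `^ p)%:E)%E).
  apply: ge0_le_integral => //; try solve [by move=> x _; rewrite lee_fin powR_ge0].
  - by apply: measurable_abs_powR; exact: Lp_meas (W ij).1.
  - by apply: measurable_abs_powR; apply: measurable_weak_gradient => kl; exact: (W kl).1.
  - move=> x _; rewrite lee_fin ge0_ler_powR ?nnegrE ?(ltW p0)//.
    by rewrite (le_trans (weak_gradient_ge ij _ x))// ler_norm.
by rewrite leeDr.
Qed.

(** Membership can be checked on any representative of the root density. *)
Lemma P1p_of mu f (F : 'I_m * 'I_n -> M -> R) : mu `<< leb -> Lp f ->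
  {ae leb, forall x, root_density p mu x = f x} ->
  (forall ij, Lp (F ij)) -> (forall ij, weak_partial ij f (F ij)) ->
  P1p p mu /\ forall ij, weak_partial ij (root_density p mu) (F ij).
Proof.
move=> mul fp rf Fp wF.
have mr := measurable_root_density p mul.
have fr : {ae leb, forall x, f x = root_density p mu x} by apply: filterS rf => x ->.
have wr ij : weak_partial ij (root_density p mu) (F ij).
  by apply: (weak_partial_ae _ mr fr (wF ij)); exact: Lp_meas.
by split => //; split => //; split; [exact: (Lfun_ae mr fr)|move=> ij; exists (F ij)].
Qed.

(** The functions f, g may be any representatives of the root densities and F, G any
weak derivatives: all choices agree almost everywhere. *)
Lemma d1p_le mu nu f g (F G : 'I_m * 'I_n -> M -> R) :
  mu `<< leb -> Lp f -> {ae leb, forall x, root_density p mu x = f x} ->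
  (forall ij, Lp (F ij)) -> (forall ij, weak_partial ij f (F ij)) ->
  nu `<< leb -> Lp g -> {ae leb, forall x, root_density p nu x = g x} ->
  (forall ij, Lp (G ij)) -> (forall ij, weak_partial ij g (G ij)) ->
  (d1p p mu nu `^ p <= \int[leb]_x (`|f x - g x| `^ p)%:E +
    (#|{: 'I_m * 'I_n}|%:R `^ p)%:E * \sum_ij \int[leb]_x (`|F ij x - G ij x| `^ p)%:E)%E.
Proof.
move=> mul fp rf Fp wF nul gp rg Gp wG.
have [Pmu wmu] := P1p_of mul fp rf Fp wF.
have [Pnu wnu] := P1p_of nul gp rg Gp wG.
rewrite /d1p asboolT// sobolev1_normE.
set u := root_density p mu; set v := root_density p nu.
have W ij := weak_derivativeB Pmu.2.1 Pnu.2.1 (Fp ij) (Gp ij) (wmu ij) (wnu ij).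
have pw0 (h : M -> R) x : (0 <= (`|h x| `^ p)%:E)%E by rewrite lee_fin powR_ge0.
have mW ij := measurable_abs_powR p (Lp_meas (W ij).1).
apply: leeD.
  rewrite (@ae_integral_powR (u \- v) (f \- g))//.
  - by apply: measurable_funB; apply: Lp_meas; [exact: Pmu.2.1|exact: Pnu.2.1].
  - by apply: measurable_funB; exact: Lp_meas.
  - by apply: filterS2 rf rg => x; rewrite /u /v/= => -> ->.
apply: (@le_trans _ _ (\int[leb]_x ((#|{: 'I_m * 'I_n}|%:R `^ p)%:E *
    \sum_ij (`|weak_derivative p ij (u \- v) x| `^ p)%:E))%E).
  apply: ge0_le_integral => //.
  - by apply: measurable_abs_powR; apply: measurable_weak_gradient => kl; exact: (W kl).1.
  - by apply: emeasurable_funM => //; exact: emeasurable_sum.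
  - by move=> x _; rewrite sumEFin -EFinM lee_fin weak_gradient_le.
rewrite ge0_integralZl//; try solve [exact: emeasurable_sum
  | by move=> x _; exact: sume_ge0 | by rewrite lee_fin powR_ge0].
rewrite ge0_integral_sum// lee_wpmul2l ?lee_fin ?powR_ge0// lee_sum// => ij _.
rewrite (ae_integral_powR (Lp_meas (W ij).1) _ (W ij).2)//.
by apply: measurable_funB; exact: Lp_meas.
Qed.

End sobolev_distance.

(** * Pointwise convergence of H under weak convergence *)

Section weak_limits.
Context {R : realType}.

Lemma weak_cvg_Rintegral m n (P_ : nat -> probability 'M[R]_(m, n) R) P psi :
  weak_cvg P_ P -> Cb psi -> \int[P_ i]_x psi x @[i --> \oo] --> \int[P]_x psi x.
Proof.
move=> PP Cpsi; have [cpsi [C hC]] := Cpsi.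
have ip (Q : probability 'M[R]_(m, n) R) : (\int[Q]_x (psi x)%:E = (\int[Q]_x psi x)%:E)%E.
  rewrite /Rintegral fineK//; apply: integrable_fin_num => //.
  by apply: (integrable_bounded _ (measurable_continuous cpsi) hC).
have := PP _ Cpsi; rewrite ip; under eq_fun do rewrite ip.
by case/fine_cvgP.
Qed.

Lemma weak_cvg_marginal N d (k : 'I_N.+1) (mu_ : nat -> probability 'M[R]_(N.+1, d) R) mu :
  weak_cvg mu_ mu -> weak_cvg (fun n => marginal k (mu_ n)) (marginal k mu).
Proof.
move=> mm psi [cpsi [C hC]].
have ip (Q : probability 'M[R]_(N.+1, d) R) :
    (\int[marginal k Q]_v (psi v)%:E = \int[Q]_x (psi (row k x))%:E)%E.
  apply: (@integral_distribution _ _ _ _ _ Q (row k) (EFin \o psi)).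
    by apply/measurable_EFinP; exact: measurable_continuous cpsi.
  apply: (@integrable_bounded _ _ _ Q (psi \o row k) C) => [|x]; last exact: hC.
  exact: (measurableT_comp (measurable_continuous cpsi) (measurable_row k)).
rewrite ip; under eq_fun do rewrite ip; apply: (mm (psi \o row k)); split.
  by move=> x; apply: continuous_comp; [exact: continuous_row|exact: cpsi].
by exists C => x; exact: hC.
Qed.

(** The inverses converge, hence are bounded. *)
Lemma ex_lower_bound (f : nat -> R) (l : R) : (forall n, 0 < f n) -> 0 < l ->
  f n @[n --> \oo] --> l -> exists2 z, 0 < z & forall n, z <= f n.
Proof.
move=> f0 l0 fl.
have : (f n)^-1 @[n --> \oo] --> l^-1 by apply: cvgV => //; rewrite gt_eqF.
move=> /cvgP /cvg_seq_bounded [M [_ hM]].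
have M0 : 0 < `|M| + 1 by rewrite ltr_wpDl.
exists (`|M| + 1)^-1; first by rewrite invr_gt0.
move=> n; rewrite -[leRHS]invrK lef_pV2 ?posrE ?invr_gt0//.
apply: le_trans (ler_norm _) _.
by apply: (hM (`|M| + 1)) => //; rewrite (le_lt_trans (ler_norm M))// ltrDl.
Qed.

Lemma cvg_prod_seq (I : Type) (s : seq I) (P : pred I) (f : nat -> I -> R) (l : I -> R) :
  (forall i, f n i @[n --> \oo] --> l i) ->
  \prod_(i <- s | P i) f n i @[n --> \oo] --> \prod_(i <- s | P i) l i.
Proof.
move=> fl; elim: s => [|i s ih].
  by rewrite big_nil; under eq_fun do rewrite big_nil; exact: cvg_cst.
rewrite big_cons; under eq_fun do rewrite big_cons.
by case: (P i) => //; exact: cvgM.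
Qed.

Section theta_limits.
Context {N d : nat}.
Local Notation X := 'M[R]_(N.+1, d).
Variables (eps : R) (mu_ : nat -> probability X R) (mu : probability X R).
Hypothesis e0 : 0 < eps.
Hypothesis mm : weak_cvg mu_ mu.
Let N0 : (0 < N.+1)%N. Proof. by []. Qed.

Lemma cvg_convolution k v :
  convolution eps (marginal k (mu_ n)) v @[n --> \oo] --> convolution eps (marginal k mu) v.
Proof. exact: (weak_cvg_Rintegral (@weak_cvg_marginal _ _ k _ _ mm) (Cb_eta e0 v)). Qed.

Lemma cvg_tweight y : tweight eps (mu_ n) y @[n --> \oo] --> tweight eps mu y.
Proof.
apply: cvgM.
  apply: cvgM; first exact: cvg_cst.
  exact: (weak_cvg_Rintegral mm (Cb_smoothing_kernel e0 y)).
apply: cvgV; first by rewrite gt_eqF// Pprod_gt0.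
by apply: cvg_prod_seq => k; exact: cvg_convolution.
Qed.

(** The Gaussian masses of the marginals converge to positive limits, hence are bounded
below by a common positive constant. *)
Lemma ex_tweight_gaussbound : exists a C,
  [/\ 0 < a, 0 <= C & forall n, gaussbound a C (tweight eps (mu_ n))].
Proof.
have gm (k : 'I_N.+1) : @gaussmass R N.+1 d eps (marginal k (mu_ n)) @[n --> \oo] -->
    @gaussmass R N.+1 d eps (marginal k mu).
  by apply: (weak_cvg_Rintegral (@weak_cvg_marginal _ _ k _ _ mm)); exact: Cb_gaussmass.
have [||z z0 hz] := @ex_common_lb R 'I_N.+1 (fun k z => forall n, z <= @gaussmass R N.+1 d eps (marginal k (mu_ n))).
- by move=> k z z' _ h H n; apply: le_trans (H n).
- by move=> k; apply: ex_lower_bound (gm k) => [n|]; exact: gaussmass_gt0.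
exists (2 * eps * N.+1%:R ^+ 2)^-1; eexists; split; last first.
- by move=> n; exact: (tweight_gaussbound e0 N0 z0 (hz ^~ n)).
- by rewrite addr_ge0// mulr_ge0 ?exprn_ge0 ?eta_ge0// invr_ge0 exprn_ge0// ltW.
- by rewrite invr_gt0 !mulr_gt0// exprn_gt0// ltr0n.
Qed.

Lemma cvg_tweight_laplace q x : expgrowth q ->
  laplace eps^-1 (tweight eps (mu_ n)) q x @[n --> \oo] --> laplace eps^-1 (tweight eps mu) q x.
Proof.
move=> gq; have [a [C [a0 C0 hC]]] := ex_tweight_gaussbound.
apply: (cvg_laplace a0 C0 hC) => //; first exact: measurable_tweight.
exact: cvg_tweight.
Qed.

Lemma cvg_Hfun x : Hfun eps (mu_ n) x @[n --> \oo] --> Hfun eps mu x.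
Proof. by apply: cvgMr; apply: cvg_tweight_laplace; exact: expgrowth_cst. Qed.

Lemma cvg_derive_Hfun v x : 'D_v (Hfun eps (mu_ n)) x @[n --> \oo] --> 'D_v (Hfun eps mu) x.
Proof.
rewrite derive_Hfun//; under eq_fun do rewrite derive_Hfun//.
apply: cvgMr; apply: cvgB.
  by apply: cvg_tweight_laplace; apply: expgrowthM; [exact: expgrowth_cst|exact: expgrowth_dotp].
by apply: cvgMr; apply: cvg_tweight_laplace; exact: expgrowth_cst.
Qed.

End theta_limits.
End weak_limits.

(** * Continuity of Theta along fast sequences *)

Section row_null_sets.
Context {R : realType} {N d : nat}.
Local Notation leb m n := (@lebesgue_mx R m n).

(** The preimage by a row of a null set is a null set: its measure is a product with a
factor 0. *)
Lemma ae_row (k : 'I_N) (Q : 'rV[R]_d -> Prop) : {ae leb 1 d, forall v, Q v} ->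
  {ae leb N d, forall x, Q (row k x)}.
Proof.
move=> [B [mB B0 QB]].
have mrB : measurable [set x : 'M[R]_(N, d) | B (row k x)].
  by rewrite -[X in measurable X]setTI; exact: (measurable_row k).
exists [set x | B (row k x)]; split => //; last by move=> x; exact: QB.
pose a j (v : 'rV[R]_d) : \bar R := if j == k then (\1_B v)%:E else 1%E.
transitivity (\int[leb N d]_x \prod_j a j (row j x))%E.
  rewrite -[in LHS](setIT [set x | B (row k x)]) -integral_indic//; apply: eq_integral => x _.
  rewrite (bigD1 k)//= big1 ?mule1 /a ?eqxx//.
  by move=> j /negbTE ->.
rewrite lebesgue_prod_rows.
- rewrite (bigD1 k)//= /a eqxx integral_indic// setIT.
  by rewrite [X in (X * _)%E]B0 mul0e.
- move=> j; rewrite /a; case: (j == k) => //.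
  by apply/measurable_EFinP; exact: measurable_indic.
- by move=> j v; rewrite /a; case: (j == k); rewrite lee_fin ?ler01.
Qed.

Lemma ae_rows (Q : 'I_N -> 'rV[R]_d -> Prop) : (forall k, {ae leb 1 d, forall v, Q k v}) ->
  {ae leb N d, forall x, forall k, Q k (row k x)}.
Proof. by move=> h; apply: filter_forall => k; exact: ae_row. Qed.

End row_null_sets.

Section fast_convergence.
Context d (T : measurableType d) {R : realType} (m : {measure set T -> \bar R}) (p : R).
Hypothesis p1 : 1 <= p.
Let p0 : 0 < p. Proof. exact: lt_le_trans p1. Qed.
Variables (f_ : nat -> T -> R) (f : T -> R).
Hypotheses (mf_ : forall n, f_ n \in Lfun m p%:E) (mf : f \in Lfun m p%:E).
Hypothesis If : forall n, (\int[m]_x (`|f_ n x - f x| `^ p)%:E <= (2 / (2 ^ n.+1)%:R)%:E)%E.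

(** By [ae_cvg0_summable] applied to |f_n - f|^p. *)
Lemma fast_Lp_ae : {ae m, forall x, f_ n x @[n --> \oo] --> f x}.
Proof.
have [mmf _] := (Lfun_finP m p1 f).1 mf.
have mmf_ n : measurable_fun [set: T] (f_ n) by have [] := (Lfun_finP m p1 (f_ n)).1 (mf_ n).
have := @ae_cvg0_summable _ _ _ m (fun n x => `|f_ n x - f x| `^ p) _ _ If.
case.
- by move=> n; apply/measurable_EFinP; apply: measurable_abs_powR; exact: measurable_funB.
- by move=> n x; exact: powR_ge0.
move=> B [mB B0 QB]; exists B; split => //; apply: subset_trans QB => x /=.
apply: contra_not => fx.
have : (`|f_ n x - f x| `^ p) `^ p^-1 @[n --> \oo] --> (0 : R) `^ p^-1.
  by apply: cvg_powR fx => [|n]; rewrite ?invr_gt0 ?powR_ge0.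
rewrite powR0 ?invr_eq0 ?gt_eqF//; under eq_fun do rewrite powR_Kinv//.
move=> nx; apply/cvgrPdist_le => e e1; move/cvgr0Pnorm_le : nx => /(_ _ e1).
by apply: filterS => n; rewrite normr_id distrC.
Qed.

Lemma fast_Lp_cvg0 : (\int[m]_x (`|f_ n x - f x| `^ p)%:E @[n --> \oo] --> 0)%E.
Proof.
have c : (2 / (2 ^ n.+1)%:R : R) @[n --> \oo] --> (0 : R).
  have := @cvg_expr R 2^-1; rewrite ger0_norm// invf_lt1// ltr1n => /(_ isT).
  apply: cvg_trans; apply: near_eq_cvg; near=> n.
  by rewrite exprVn natrX exprS invfM mulrA divff ?mul1r// pnatr_eq0.
apply: (@squeeze_cvge _ _ _ _ (fun=> 0%E) _ (fun n => (2 / (2 ^ n.+1)%:R)%:E)); [|exact: cvg_cst|].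
  by apply: nearW => n; rewrite If andbT integral_ge0// => x _; rewrite lee_fin powR_ge0.
by apply/fine_cvgP; split => //; apply: nearW.
Unshelve. all: by end_near. Qed.

Lemma fast_Lp_norm :
  (\int[m]_x (`|f_ n x| `^ p)%:E @[n --> \oo] --> \int[m]_x (`|f x| `^ p)%:E)%E.
Proof.
have [mmf fi] := (Lfun_finP m p1 f).1 mf.
have mmf_ n : measurable_fun [set: T] (f_ n) by have [] := (Lfun_finP m p1 (f_ n)).1 (mf_ n).
have inte (h : T -> R) : measurable_fun [set: T] h -> (\int[m]_x (`|h x| `^ p)%:E < +oo)%E ->
    m.-integrable [set: T] (fun x => (`|h x| `^ p)%:E).
  move=> mh hi; apply/integrableP; split; first exact: measurable_abs_powR.
  by under eq_integral do rewrite gee0_abs ?lee_fin ?powR_ge0//.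
apply: (Lp_cvg_norm p1) => //.
- exact: inte.
- move=> n; apply: (inte (fun x => f_ n x - f x)); first exact: measurable_funB.
  by rewrite (le_lt_trans (If n))// ltry.
- exact: fast_Lp_ae.
- exact: fast_Lp_cvg0.
Qed.

End fast_convergence.

Lemma cvg_eq (T : topologicalType) (a b : nat -> T) (l l' : T) : (forall n, a n = b n) -> l = l' ->
  b n @[n --> \oo] --> l' -> a n @[n --> \oo] --> l.
Proof. by move=> ab -> bl; under eq_fun do rewrite ab. Qed.

Lemma d1p_ge0 (R : realType) m n p (mu nu : probability 'M[R]_(m, n) R) : (0 <= d1p p mu nu)%E.
Proof. by rewrite /d1p; case: ifP => // _; exact: poweR_ge0. Qed.

Section theta_continuity.
Context {R : realType} {N d : nat}.
Local Notation X := 'M[R]_(N.+1, d).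
Local Notation V := 'rV[R]_d.
Local Notation leb m n := (@lebesgue_mx R m n).
Variables p eps : R.
Hypothesis p1 : 1 <= p.
Hypothesis e0 : 0 < eps.
Let p0 : 0 < p. Proof. exact: lt_le_trans p1. Qed.
Implicit Types nu : probability X R.

Definition uroot nu j : V -> R := root_density p (marginal j nu).
Definition ugrad nu j i : V -> R := weak_derivative p (0, i) (uroot nu j).

Section marginals.
Variable nu : probability X R.
Hypothesis Pnu : forall j, P1p p (marginal j nu).

Lemma uroot_Lfun j : uroot nu j \in Lfun (leb 1 d) p%:E.
Proof. exact: (Pnu j).2.1. Qed.

Lemma uroot_ge0 j v : 0 <= uroot nu j v. Proof. exact: root_density_ge0. Qed.

Lemma uroot_spec j A : measurable A -> marginal j nu A = (\int[leb 1 d]_(v in A) (uroot nu j v `^ p)%:E)%E.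
Proof. by move=> mA; exact: (root_density_spec p1 (Pnu j).1 mA). Qed.

Lemma ugrad_Lfun j i : ugrad nu j i \in Lfun (leb 1 d) p%:E.
Proof. exact: (weak_derivative_sobolev1 p1 _ (Pnu j).2).1. Qed.

Lemma ugrad_weak_partial j i : weak_partial (0, i) (uroot nu j) (ugrad nu j i).
Proof. exact: (weak_derivative_sobolev1 p1 _ (Pnu j).2).2. Qed.

End marginals.

Variables (mu_ : nat -> probability X R) (mu : probability X R).
Hypothesis mm : weak_cvg mu_ mu.
Hypotheses (P_ : forall n j, P1p p (marginal j (mu_ n))) (P0 : forall j, P1p p (marginal j mu)).
Hypothesis fast0 : forall j n, (\int[leb 1 d]_v (`|uroot (mu_ n) j v - uroot mu j v| `^ p)%:E <=
  (2 / (2 ^ n.+1)%:R)%:E)%E.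
Hypothesis fast1 : forall j i n, (\int[leb 1 d]_v (`|ugrad (mu_ n) j i v - ugrad mu j i v| `^ p)%:E <=
  (2 / (2 ^ n.+1)%:R)%:E)%E.

Let W n := Wfun p eps (mu_ n) (uroot (mu_ n)).
Let W0 := Wfun p eps mu (uroot mu).
Let F n ki := Vfun p eps (mu_ n) (uroot (mu_ n)) ki.1 ki.2 (ugrad (mu_ n) ki.1 ki.2).
Let F0 ki := Vfun p eps mu (uroot mu) ki.1 ki.2 (ugrad mu ki.1 ki.2).

Let ae_u : {ae leb N.+1 d, forall x, forall j, uroot (mu_ n) j (row j x) @[n --> \oo] --> uroot mu j (row j x)}.
Proof.
apply: (ae_rows (Q := fun j v => uroot (mu_ n) j v @[n --> \oo] --> uroot mu j v)) => j.
exact: (fast_Lp_ae p1 (fun n => uroot_Lfun (P_ n) j) (uroot_Lfun P0 j) (fast0 j)).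
Qed.

Let ae_g k i : {ae leb N.+1 d, forall x, ugrad (mu_ n) k i (row k x) @[n --> \oo] --> ugrad mu k i (row k x)}.
Proof.
apply: (@ae_row _ _ _ k (fun v => ugrad (mu_ n) k i v @[n --> \oo] --> ugrad mu k i v)).
exact: (fast_Lp_ae p1 (fun n => ugrad_Lfun (P_ n) k i) (ugrad_Lfun P0 k i) (fast1 k i)).
Qed.

Let cvg_hfun x : hfun p eps (mu_ n) x @[n --> \oo] --> hfun p eps mu x.
Proof.
apply: cvg_powR; [by rewrite invr_gt0|by move=> n; rewrite ltW// Hfun_gt0|exact: cvg_Hfun].
Qed.

Let cvg_partial_hfun ki x : partial ki (hfun p eps (mu_ n)) x @[n --> \oo] --> partial ki (hfun p eps mu) x.
Proof.
have E nu := partial_hfun p e0 nu ki x.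
apply: (cvg_eq (fun n => E (mu_ n)) (E mu)); apply: cvgM; first exact: cvg_hfun.
apply: cvgMr; apply: cvgM; first exact: (cvg_derive_Hfun e0 mm).
by apply: cvgV; [rewrite gt_eqF// Hfun_gt0|exact: (cvg_Hfun e0 mm)].
Qed.

Let cvg_rest k (x : X) : (forall j, uroot (mu_ n) j (row j x) @[n --> \oo] --> uroot mu j (row j x)) ->
  \prod_(j | j != k) (uroot (mu_ n) j (row j x) `^ p) @[n --> \oo] -->
  \prod_(j | j != k) (uroot mu j (row j x) `^ p).
Proof.
move=> ux; apply: cvg_prod_seq => j.
apply: (cvg_powR p0 (fun n => uroot_ge0 (mu_ n) j (row j x)) (ux j)).
Qed.

(** The bounds are W_n^p itself, of integral 1. *)
Lemma cvg_Wfun : (\int[leb N.+1 d]_x (`|W n x - W0 x| `^ p)%:E @[n --> \oo] --> 0)%E.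
Proof.
have facts nu (Pnu : forall j, P1p p (marginal j nu)) :
    measurable_fun [set: X] (Wfun p eps nu (uroot nu)) /\
    (leb N.+1 d).-integrable [set: X] (EFin \o (fun x => Wfun p eps nu (uroot nu) x `^ p)) /\
    (\int[leb N.+1 d]_x (Wfun p eps nu (uroot nu) x `^ p)%:E = 1)%E.
  have up := uroot_Lfun Pnu; have us := uroot_spec Pnu; have ug := uroot_ge0 nu.
  have [m1 _] := (Lfun_finP _ p1 _).1 (Wfun_Lfun p1 e0 up ug us).
  have I1 : (\int[leb N.+1 d]_x (Wfun p eps nu (uroot nu) x `^ p)%:E = 1)%E.
    under eq_integral do rewrite Wfun_powR//.
    apply: integral_tdens => //.
    - move=> j; apply: measurable_powR_comp.
      by have [] := (Lfun_finP _ p1 _).1 (up j).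
    - by move=> j v; exact: powR_ge0.
  split => //; split => //; apply/integrableP; split.
    by apply/measurable_EFinP; exact: measurable_powR_comp.
  by under eq_integral do rewrite /= ger0_norm ?powR_ge0//; rewrite I1 ltry.
apply: (@Lp_cvg_dominated _ _ _ (leb N.+1 d) p p1 W (fun n x => W n x `^ p) W0 (fun x => W0 x `^ p)).
- by move=> n; exact: (facts _ (P_ n)).1.
- exact: (facts _ P0).1.
- by move=> n; exact: (facts _ (P_ n)).2.1.
- exact: (facts _ P0).2.1.
- by move=> n x; exact: powR_ge0.
- by move=> x; exact: powR_ge0.
- by move=> n x; rewrite ger0_norm// Wfun_ge0// => j v; exact: uroot_ge0.
- apply: filterS ae_u => x ux; apply: cvgM => //; exact: cvg_prod_seq.
- apply: filterS ae_u => x ux; apply: cvg_powR => //.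
    by move=> n; rewrite Wfun_ge0// => j v; exact: uroot_ge0.
  by apply: cvgM => //; exact: cvg_prod_seq.
- by apply: (cvg_eq (fun n => (facts _ (P_ n)).2.2) (facts _ P0).2.2); exact: cvg_cst.
Qed.

(** The bounds are [Vdom]; their integrals converge with the L^p norms of the
derivatives of the u_k. *)
Lemma cvg_Vfun ki : (\int[leb N.+1 d]_x (`|F n ki x - F0 ki x| `^ p)%:E @[n --> \oo] --> 0)%E.
Proof.
case: ki => k i; rewrite /F /F0/=.
have up n := uroot_Lfun (P_ n); have us n := uroot_spec (P_ n); have ug n := uroot_ge0 (mu_ n).
have up0 := uroot_Lfun P0; have us0 := uroot_spec P0; have ug0 := uroot_ge0 mu.
have gp n := ugrad_Lfun (P_ n) k i; have gp0 := ugrad_Lfun P0 k i.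
apply: (@Lp_cvg_dominated _ _ _ (leb N.+1 d) p p1 _
  (fun n => Vdom p eps (mu_ n) (uroot (mu_ n)) k i (ugrad (mu_ n) k i)) _
  (Vdom p eps mu (uroot mu) k i (ugrad mu k i))).
- by move=> n; exact: (measurable_Vfun p1 e0 (mu_ n) (up n) k i (gp n)).
- exact: (measurable_Vfun p1 e0 mu up0 k i gp0).
- by move=> n; exact: (integrable_Vdom p1 e0 (up n) (ug n) (us n) k i (gp n)).
- exact: (integrable_Vdom p1 e0 up0 ug0 us0 k i gp0).
- by move=> n x; exact: (Vdom_ge0 p1 e0 (mu_ n) (ug n)).
- by move=> x; exact: (Vdom_ge0 p1 e0 mu ug0).
- by move=> n x; exact: (Vfun_le p1 e0 (mu_ n) (ug n)).
- apply: filterS2 ae_u (ae_g k i) => x ux gx; apply: cvgD; apply: cvgM => //.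
    by apply: cvg_prod_seq => j; rewrite /subst_fun; case: eqP => // ->.
  exact: cvg_prod_seq.
- apply: filterS2 ae_u (ae_g k i) => x ux gx; apply: cvgMr.
  have uk : uroot (mu_ n) k (row k x) `^ p @[n --> \oo] --> uroot mu k (row k x) `^ p.
    by apply: cvg_powR => // n; exact: uroot_ge0.
  apply: cvgD.
    apply: cvgM; first exact: cvg_Hfun.
    apply: cvgM; last exact: cvg_rest.
    by apply: cvg_powR => //; exact: cvg_norm.
  by apply: cvgMr; apply: cvgD; (apply: cvgM; [exact: cvg_Hfun|apply: cvgM => //; exact: cvg_rest]).
- apply: (cvg_eq (fun n => integral_Vdom p1 e0 (up n) (us n) k i (gp n))
    (integral_Vdom p1 e0 up0 us0 k i gp0)).
  apply: cvgeZl => //; apply: cvgeD => //; [by rewrite fin_num_adde_defl| |exact: cvg_cst].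
  exact: (fast_Lp_norm p1 gp gp0 (fast1 k i)).
Qed.

(** The limits [cvg_Wfun] and [cvg_Vfun], through [d1p_le]. *)
Lemma cvg_Theta_fast : d1p p (Theta eps (mu_ n)) (Theta eps mu) @[n --> \oo] --> 0%E.
Proof.
have dle n : (d1p p (Theta eps (mu_ n)) (Theta eps mu) `^ p <=
    \int[leb N.+1 d]_x (`|W n x - W0 x| `^ p)%:E +
    (#|{: 'I_N.+1 * 'I_d}|%:R `^ p)%:E * \sum_ki \int[leb N.+1 d]_x (`|F n ki x - F0 ki x| `^ p)%:E)%E.
  have facts nu (Pnu : forall j, P1p p (marginal j nu)) :
      let w := Wfun p eps nu (uroot nu) in
      let v ki := Vfun p eps nu (uroot nu) ki.1 ki.2 (ugrad nu ki.1 ki.2) in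
      [/\ Theta eps nu `<< leb N.+1 d, w \in Lfun (leb N.+1 d) p%:E,
        {ae leb N.+1 d, forall x, root_density p (Theta eps nu) x = w x},
        (forall ki, v ki \in Lfun (leb N.+1 d) p%:E) & (forall ki, weak_partial ki w (v ki))].
    have up := uroot_Lfun Pnu; have us := uroot_spec Pnu; have ug := uroot_ge0 nu.
    have [h1 h2] := root_density_Theta p1 e0 up ug us.
    split => //; [exact: Wfun_Lfun| |].
      by case=> k i; apply: Vfun_Lfun => //; exact: ugrad_Lfun.
    case=> k i; apply: weak_partial_Wfun => //; [exact: ugrad_Lfun|exact: ugrad_weak_partial].
  have [a1 a2 a3 a4 a5] := facts _ (P_ n); have [b1 b2 b3 b4 b5] := facts _ P0.
  exact: (d1p_le p1 a1 a2 a3 a4 a5 b1 b2 b3 b4 b5).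
have c0 : ((\int[leb N.+1 d]_x (`|W n x - W0 x| `^ p)%:E +
    (#|{: 'I_N.+1 * 'I_d}|%:R `^ p)%:E * \sum_ki \int[leb N.+1 d]_x (`|F n ki x - F0 ki x| `^ p)%:E)%E
    @[n --> \oo] --> 0%E).
  have c1 : ((#|{: 'I_N.+1 * 'I_d}|%:R `^ p)%:E * \sum_ki \int[leb N.+1 d]_x (`|F n ki x - F0 ki x| `^ p)%:E)%E
      @[n --> \oo] --> 0%E.
    have s0 : (\sum_ki \int[leb N.+1 d]_x (`|F n ki x - F0 ki x| `^ p)%:E)%E @[n --> \oo] --> 0%E.
      by apply: ecvg0_sum => ki; exact: cvg_Vfun.
    by have := cvgeZl (isT : (#|{: 'I_N.+1 * 'I_d}|%:R `^ p)%:E \is a fin_num) s0; rewrite mule0.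
  by have := cvgeD _ cvg_Wfun c1; rewrite adde0; apply.
apply/ecvg0P => [n|e e_gt0]; first exact: d1p_ge0.
move/ecvg0P : c0 => /(_ _ (e `^ p)) H.
have {}H := H _ (powR_gt0 _ e_gt0).
near=> n.
have : (d1p p (Theta eps (mu_ n)) (Theta eps mu) `^ p <= (e `^ p)%:E)%E.
  apply: (le_trans (dle n)); near: n; apply: H => n.
  by rewrite (le_trans _ (dle n))// poweR_ge0.
move=> /(@gt0_ler_poweR _ p^-1); rewrite -poweR_EFin -!poweRrM divff ?gt_eqF// !poweRe1 ?lee_fin ?(ltW e_gt0) ?d1p_ge0//.
by apply; rewrite ?invr_ge0 ?(ltW p0)// in_itv/= leey andbT ?poweR_ge0// lee_fin powR_ge0.
Unshelve. all: by end_near. Qed.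

End theta_continuity.

(** * Continuity of Theta *)

Lemma weak_cvg_subseq (R : realType) m n (P_ : nat -> probability 'M[R]_(m, n) R) P (s : nat -> nat) :
  (forall i, i <= s i)%N -> weak_cvg P_ P -> weak_cvg (fun i => P_ (s i)) P.
Proof. by move=> hs PP psi Cpsi; exact: (cvg_subseq hs (PP psi Cpsi)). Qed.

Unset Implicit Arguments.

Theorem theorem5p1 (R : realType) (d N : nat) (hd : (0 < d)%N) (hN : (0 < N)%N)
    (p : R) (hp : 1 <= p)
    (mu_ : nat -> probability 'M[R]_(N, d) R) (mu : probability 'M[R]_(N, d) R)
    (mu_weak : weak_cvg mu_ mu)
    (mu_P1p : forall j : 'I_N,
      [/\ forall n, P1p p (marginal j (mu_ n)),
          P1p p (marginal j mu) &
          d1p p (marginal j (mu_ n)) (marginal j mu) @[n --> \oo] --> 0%E])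
    (eps : R) (heps : 0 < eps) :
  d1p p (Theta eps (mu_ n)) (Theta eps mu) @[n --> \oo] --> 0%E.
Proof.
case: N hN mu_ mu mu_weak mu_P1p => // N _ mu_ mu mu_weak mu_P1p.
apply: cvg0_subseq => [n|s hs]; first exact: d1p_ge0.
pose D n j := d1p p (marginal j (mu_ (s n))) (marginal j mu).
have D0 : (\sum_j D n j)%E @[n --> \oo] --> 0%E.
  apply: ecvg0_sum => j; have [_ _ Dj] := mu_P1p j.
  exact: (cvg_subseq hs Dj).
pose b n : R := 2 / (2 ^ n.+1)%:R.
have b0 n : 0 < b n by rewrite divr_gt0// ltr0n expn_gt0.
have b1 n : b n <= 1.
  by rewrite ler_pdivrMr ?ltr0n ?expn_gt0// mul1r ler_nat expnS leq_pmulr// expn_gt0.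
have [n|t ht Dt] := ex_fast_subseq _ D0 b0.
  by apply: sume_ge0 => j _; exact: d1p_ge0.
exists t => //.
(* The distance bounds p-th roots of integrals; as b n <= 1, the integrals are still at
   most b n. *)
have bp n : b n `^ p <= b n.
  by rewrite -[leRHS]powRr1 ?(ltW (b0 n))// ger_powR// b0 b1.
have fast j n := d1p_ge hp (let: And3 h _ _ := mu_P1p j in h (s (t n)))
  (let: And3 _ h _ := mu_P1p j in h) (ltW (b0 n)).
have Dj j n : (D (t n) j <= (b n)%:E)%E.
  apply: le_trans (Dt n); rewrite (bigD1 j)//= leeDl// sume_ge0// => i _.
  exact: d1p_ge0.
apply: (cvg_Theta_fast hp heps (mu_ := fun n => mu_ (s (t n)))).
- apply: (weak_cvg_subseq _ mu_weak) => n; exact: leq_trans (ht n) (hs _).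
- by move=> n j; have [h _ _] := mu_P1p j; exact: h.
- by move=> j; have [_ h _] := mu_P1p j; exact: h.
- move=> j n; have [h _] := fast j n (Dj j n).
  by apply: (le_trans h); rewrite lee_fin bp.
- move=> j i n; have [_ h] := fast j n (Dj j n).
  by apply: (le_trans (h (0, i))); rewrite lee_fin bp.
Qed.
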